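(* Let $\Lambda$ be a free abelian group of finite rank and let $\mathcal{A}$ be a structurable $\Lambda$-torus of class I over $F$. Then: (a) If $\mathcal{A}$ is associative, then $\mathcal{A}$ is isograded isomorphic (as a graded algebra with involution) to $$\mathcal{A}_1\otimes\cdots\otimes\mathcal{A}_k\otimes\mathcal{A}_{k+1}\otimes\mathcal{P}(r)$$ for some $k\ge 0$, $r\ge 0$, where $\mathcal{A}_i=\mathcal{C}(2)$ for $1\le i\le k$, and $\mathcal{A}_{k+1}$ is one of $F$, $\mathcal{C}(1)$ or $\mathcal{C}_*(2)$, with $\mathcal{A}_{k+1}=\mathcal{C}(1)$ if $k=0$. (b) If $\mathcal{A}$ is not associative, then $\mathcal{A}$ is isograded isomorphic (as a graded algebra with involution) to $$\mathcal{C}(3)\otimes\mathcal{C}(k)\otimes\mathcal{P}(r)$$ for some $0\le k\le 3$ and $r\ge 0$. Conversely, each of the graded algebras with involution listed in (a) and (b) is a structurable torus of class I.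
   Context: $F$ is a field of characteristic $\ne 2,3$. ''Algebra'' means unital, not necessarily associative $F$-algebra; $[x,y]=xy-yx$, $L_xy=xy$, $R_xy=yx$; $\otimes=\otimes_F$. An algebra with involution is an algebra with an anti-automorphism $*$ of period 2; $\mathcal{A}_{\pm}=\{x: x^*=\pm x\}$. Gradings. For an abelian group $\Lambda$, a $\Lambda$-graded algebra with involution is $\mathcal{A}=\bigoplus_{\lambda\in\Lambda}\mathcal{A}^\lambda$ with $\mathcal{A}^\lambda\mathcal{A}^\mu\subset\mathcal{A}^{\lambda+\mu}$ and $(\mathcal{A}^\lambda)^*=\mathcal{A}^\lambda$. $\operatorname{supp}(\mathcal{A})=\{\lambda:\mathcal{A}^\lambda\ne0\}$; $\mathcal{A}$ is finely graded if $\dim\mathcal{A}^\lambda=1$ for all $\lambda\in\operatorname{supp}(\mathcal{A})$. For a subgroup $M$, $\mathcal{A}^M=\bigoplus_{\lambda\in M}\mathcal{A}^\lambda$. A $\Lambda$-graded and a $\Lambda'$-graded algebra with involution $\mathcal{A},\mathcal{A}'$ are isograded isomorphic if there are an isomorphism $\varphi:\mathcal{A}\to\mathcal{A}'$ of algebras with involution and a group isomorphism $\theta:\Lambda\to\Lambda'$ with $\varphi(\mathcal{A}^\lambda)=\mathcal{A}'^{\theta(\lambda)}$. A tensor product of a $\Lambda'$-graded and a $\Lambda''$-graded algebra with involution has the involution $*'\otimes *''$ and the $(\Lambda'\oplus\Lambda'')$-grading with components $\mathcal{A}'^{\lambda'}\otimes\mathcal{A}''^{\lambda''}$; similarly for several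 factors. Structurable tori. A structurable algebra is an algebra with involution satisfying $\{xy\{zwq\}\}-\{zw\{xyq\}\}=\{\{xyz\}wq\}-\{z\{yxw\}q\}$, where $\{xyz\}=(xy^* )z+(zy^* )x-(zx^* )y$. In a finely $\Lambda$-graded structurable algebra, a homogeneous $x$ is invertible if there is $x^{-1}$ with $xx^{-1}=x^{-1}x=1$ and $[L_x,L_{x^{-1}}]=[R_x,R_{x^{-1}}]=0$. A structurable $\Lambda$-torus is a $\Lambda$-graded structurable algebra which is finely graded, in which every nonzero homogeneous element is invertible, and whose support generates $\Lambda$. It is of class I if $S_-:=\operatorname{supp}(\mathcal{A}_-)\neq\emptyset$ and $\mathcal{A}^{\Lambda_-}=\mathcal{A}$, where $\Lambda_-=\langle S_-\rangle$ is the subgroup generated by $S_-$. The algebras. $\mathcal{P}(n)=F[t_1^{\pm1},\dots,t_n^{\pm1}]$ with trivial involution and $\mathbb{Z}^n$-grading $\deg t_i=\varepsilon_i$ ($\varepsilon_1,\dots,\varepsilon_n$ the standard basis; $\mathcal{P}(0)=F$). Given an algebra $\mathcal{D}$ with involution $\bar{\ }$ and a unit $\mu$ in its centre, the Cayley–Dickson double is $\operatorname{CD}(\mathcal{D},\mu)=\mathcal{D}\oplus u\mathcal{D}$ with $(a+ub)(c+ud)=(ac+\mu d\bar b)+u(\bar a d+cb)$ and $\overline{a+ub}=\bar a-ub$. For a commutative associative algebra $K$ with trivial involution and units $\mu_i$ of $K$, $\operatorname{CD}(K,\mu_1,\dots,\mu_n)$ is obtained by iterating, starting with $K$; the successive elements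 $u$ are called the canonical generators $x_1,\dots,x_n$ (so $x_i^2=\mu_i$). For $n=1,2,3$, $\mathcal{C}(n)=\operatorname{CD}(\mathcal{P}(n),t_1,\dots,t_n)$, with the involution produced by the iterated Cayley–Dickson doubling, $\overline{a+ub}=\bar a-ub$ at each step (satisfying $x_i\mapsto -x_i$), and with the $\mathbb{Z}^n$-grading in which $\deg x_i=\varepsilon_i$ (so $t_i=x_i^2$ has degree $2\varepsilon_i$). $\mathcal{C}(0)=F$ with trivial involution, graded by the trivial group. $\mathcal{C}_*(2)$ is the same $\mathbb{Z}^2$-graded algebra as $\mathcal{C}(2)$ but with the involution that fixes the canonical generators $x_1,x_2$. *)

(* Defs.v *)
From HB Require Import structures.
From mathcomp Require Import all_boot all_order all_algebra.
From mathcomp Require Import boolp classical_sets.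
From mathcomp Require Import finmap.
From mathcomp.multinomials Require Import monalg.

Set Implicit Arguments.
Unset Strict Implicit.
Unset Printing Implicit Defensive.

Import GRing.Theory.

Local Open Scope classical_set_scope.
Local Open Scope ring_scope.

Definition subspace (F : fieldType) (V : lmodType F) (S : set V) : Prop :=
  S 0 /\ forall (c : F) (u v : V), S u -> S v -> S (c *: u + v).

Definition span (F : fieldType) (V : lmodType F) (S : set V) : set V :=
  smallest (@subspace F V) S.

Definition subgroup (L : zmodType) (M : set L) : Prop :=
  M 0 /\ forall a b : L, M a -> M b -> M (a - b).

Definition generated (L : zmodType) (S : set L) : set L :=
  smallest (@subgroup L) S.

Definition free_abelian_finite_rank (L : zmodType) : Prop :=
  exists (n : nat) (f : {additive 'rV[int]_n -> L}), bijective f.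

Record alginv (F : fieldType) := AlgInv {
  carrier :> lmodType F;
  amul : carrier -> carrier -> carrier;
  aone : carrier;
  star : carrier -> carrier;
  amul_linearr : forall x, linear (amul x);
  amul_linearl : forall y, linear (amul^~ y);
  amul1l : left_id aone amul;
  amul1r : right_id aone amul;
  star_linear : linear star;
  star_anti : forall x y, star (amul x y) = amul (star y) (star x);
  starK : involutive star
}.

Arguments amul {F a} x y.
Arguments aone {F a}.
Arguments star {F a} x.

Notation "x *a y" := (amul x y) (at level 40, left associativity).

Definition associative_alg (F : fieldType) (A : alginv F) : Prop :=
  associative (@amul F A).

Section AlgInvTheory.
Variables (F : fieldType) (A : alginv F).
Implicit Types (x y z : A) (c : F).

Lemma amulDl x y z : (x + y) *a z = x *a z + y *a z.
Proof. by have /= := amul_linearl z 1 x y; rewrite !scale1r. Qed.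
Lemma amulDr x y z : x *a (y + z) = x *a y + x *a z.
Proof. by have := amul_linearr x 1 y z; rewrite !scale1r. Qed.
Lemma amul0l x : 0 *a x = 0.
Proof. by apply: (addrI (0 *a x)); rewrite -amulDl !addr0. Qed.
Lemma amul0r x : x *a 0 = 0.
Proof. by apply: (addrI (x *a 0)); rewrite -amulDr !addr0. Qed.
Lemma amulZl c x y : (c *: x) *a y = c *: (x *a y).
Proof. by have /= := amul_linearl y c x 0; rewrite !addr0 amul0l addr0. Qed.
Lemma amulZr c x y : x *a (c *: y) = c *: (x *a y).
Proof. by have := amul_linearr x c y 0; rewrite !addr0 amul0r addr0. Qed.
Lemma amulNl x y : (- x) *a y = - (x *a y).
Proof. by rewrite -scaleN1r amulZl scaleN1r. Qed.
Lemma amulNr x y : x *a (- y) = - (x *a y).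
Proof. by rewrite -scaleN1r amulZr scaleN1r. Qed.
Lemma starD x y : star (x + y) = star x + star y.
Proof. by have := star_linear 1 x y; rewrite !scale1r. Qed.
Lemma star0 : star (0 : A) = 0.
Proof. by apply: (addrI (star 0)); rewrite -starD !addr0. Qed.
Lemma starZ c x : star (c *: x) = c *: star x.
Proof. by have := star_linear c x 0; rewrite !addr0 star0 addr0. Qed.
Lemma starN x : star (- x) = - star x.
Proof. by rewrite -scaleN1r starZ scaleN1r. Qed.
Lemma star1 : star (aone : A) = aone.
Proof. by rewrite -[RHS]starK -[in RHS](amul1l (star aone)) star_anti starK amul1l. Qed.

End AlgInvTheory.

(** The centre: elements commuting and associating with everything. *)
Definition central (F : fieldType) (A : alginv F) (m : A) : Prop :=
  [/\ forall x : A, m *a x = x *a m,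
      forall x y : A, (m *a x) *a y = m *a (x *a y),
      forall x y : A, (x *a m) *a y = x *a (m *a y) &
      forall x y : A, (x *a y) *a m = x *a (y *a m)].

(** [galg] only carries the family of components; that it is a grading is the
    predicate [is_graded] below. *)
Record galg (F : fieldType) := GAlg {
  alg :> alginv F;
  grp : zmodType;
  comp : grp -> set alg
}.

Arguments comp {F} g _.

Section Gradings.
Variables (F : fieldType) (A : galg F).

(** The sum of the components with degree in [M]. *)
Definition part (M : set (grp A)) : set A :=
  span (\bigcup_(l in M) comp A l).

Definition independent_components : Prop :=
  forall (s : seq (grp A)) (x : grp A -> A),
    uniq s -> (forall l, comp A l (x l)) ->
    \sum_(l <- s) x l = 0 -> forall l, l \in s -> x l = 0.

Definition is_graded : Prop :=
  [/\ forall l, subspace (comp A l),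
      part setT = setT,
      independent_components,
      forall l m x y, comp A l x -> comp A m y -> comp A (l + m) (x *a y) &
      forall l, star @` comp A l = comp A l].

Definition supp (S : set A) : set (grp A) :=
  [set l | exists2 x, (comp A l `&` S) x & x <> 0].

Definition skew : set A := [set x | star x = - x].

Definition finely_graded : Prop :=
  is_graded /\
  forall l, supp setT l ->
    exists x, [/\ comp A l x, x <> 0 &
                forall y, comp A l y -> exists c : F, y = c *: x].

End Gradings.

Arguments skew {F} A _.

Section Structurable.
Variables (F : fieldType) (A : alginv F).
Implicit Types x y z w q : A.

Definition triple x y z : A :=
  (x *a star y) *a z + (z *a star y) *a x - (z *a star x) *a y.

Definition structurable : Prop := forall x y z w q,
  triple x y (triple z w q) - triple z w (triple x y q)
  = triple (triple x y z) w q - triple z (triple y x w) q.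

Definition invertible x : Prop := exists y,
  [/\ x *a y = aone, y *a x = aone,
      forall z, x *a (y *a z) - y *a (x *a z) = 0 &
      forall z, (z *a y) *a x - (z *a x) *a y = 0].

End Structurable.

Section Tori.
Variables (F : fieldType) (A : galg F).

Definition structurable_torus : Prop :=
  [/\ structurable A,
      finely_graded A,
      forall l (x : A), comp A l x -> x <> 0 -> invertible x &
      generated (supp (@setT A)) = setT].

Definition class_I : Prop :=
  supp (skew A) !=set0 /\ part (generated (supp (skew A))) = setT.

End Tori.

Definition isograded (F : fieldType) (A B : galg F) : Prop :=
  exists (phi : {linear A -> B}) (theta : {additive grp A -> grp B}),
    (bijective phi /\ bijective theta) /\
    [/\ phi aone = aone,
        forall x y, phi (x *a y) = phi x *a phi y,
        forall x, phi (star x) = star (phi x) &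
        forall l, phi @` comp A l = comp B (theta l)].

HB.lock Definition extend (F : fieldType) (K : choiceType) (V : lmodType F)
    (f : K -> V) (g : {malg F[K]}) : V :=
  \sum_(k <- msupp g) g@_k *: f k.
Canonical extend_unlockable := Unlockable extend.unlock.

Section LinearExtension.
Variables (F : fieldType) (K : choiceType) (V : lmodType F).
Implicit Types (f : K -> V) (g : {malg F[K]}).

Lemma extendEw f g (d : {fset K}) :
  (msupp g `<=` d)%fset -> extend f g = \sum_(k <- d) g@_k *: f k.
Proof.
move=> sgd; rewrite unlock; apply: big_fset_incl => // k _.
by move/mcoeff_outdom => ->; rewrite scale0r.
Qed.

Lemma extend_linear f : linear (extend f).
Proof.
move=> c g h.
rewrite (@extendEw _ g (msupp g `|` msupp h)%fset) ?fsubsetUl //.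
rewrite (@extendEw _ h (msupp g `|` msupp h)%fset) ?fsubsetUr //.
rewrite (@extendEw _ _ (msupp g `|` msupp h)%fset); last first.
  apply: fsubset_trans (msuppD_le _ _) _.
  by apply: fsetSU; apply: msuppZ_le.
rewrite scaler_sumr -big_split; apply: eq_bigr => k _ /=.
by rewrite mcoeffD mcoeffZ scalerDl scalerA.
Qed.

Lemma extendU f k : extend f << k >> = f k.
Proof.
rewrite (@extendEw _ _ [fset k]%fset) ?msuppU_le //.
by rewrite big_seq_fset1 mcoeffUU scale1r.
Qed.

Lemma extend_fun c f1 f2 g :
  extend (fun k => c *: f1 k + f2 k) g = c *: extend f1 g + extend f2 g.
Proof.
rewrite unlock scaler_sumr -big_split; apply: eq_bigr => k _ /=.
by rewrite scalerDr !scalerA mulrC.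
Qed.

Lemma eq_extend f1 f2 g : f1 =1 f2 -> extend f1 g = extend f2 g.
Proof. by move=> e; rewrite unlock; apply: eq_bigr => k _; rewrite e. Qed.

Lemma malg_linear_ext (p q : {malg F[K]} -> V) :
  linear p -> linear q -> (forall k, p << k >> = q << k >>) -> p =1 q.
Proof.
move=> lp lq epq g.
have p0 : p 0 = 0 by have := lp (-1) 0 0; rewrite !scaleN1r !addNr.
have q0 : q 0 = 0 by have := lq (-1) 0 0; rewrite !scaleN1r !addNr.
rewrite [g]monalgE; elim: (X in \sum_(k <- X) _) => [|k s IH].
  by rewrite big_nil p0 q0.
have -> : \sum_(j <- k :: s) << g@_j *g j >>
   = g@_k *: << k >> + \sum_(j <- s) << g@_j *g j >> :> {malg F[K]}.
  rewrite big_cons; congr (_ + _); apply/malgP => j.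
  by rewrite mcoeffZ !mcoeffU mulrnAr mulr1.
by rewrite lp lq IH epq.
Qed.

End LinearExtension.

(** [A (x) B] is the free module on the set [A * B] modulo the subspace
    [tens_null] spanned by the bilinearity relations. *)

Section TensorSpace.
Variables (F : fieldType) (A B : lmodType F).

Definition tens_rel : set {malg F[(A * B)%type]} :=
  [set g | (exists c a a' b,
              g = << (c *: a + a', b) >> - (c *: << (a, b) >> + << (a', b) >>))
        \/ (exists c a b b',
              g = << (a, c *: b + b') >> - (c *: << (a, b) >> + << (a, b') >>))].

Definition tens_null : {pred {malg F[(A * B)%type]}} :=
  fun g => `[< span tens_rel g >].

Lemma tens_null_lin c g h :
  g \in tens_null -> h \in tens_null -> c *: g + h \in tens_null.
Proof.
move=> /asboolP gN /asboolP hN; apply/asboolP => S [Ssub SR].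
by apply: (Ssub.2); [apply: gN | apply: hN].
Qed.

Lemma tens_null0 : 0 \in tens_null.
Proof. by apply/asboolP => S [[]]. Qed.

Lemma tens_null_zmod : zmod_closed tens_null.
Proof.
split; first exact: tens_null0.
by move=> g h gN hN; rewrite addrC -scaleN1r tens_null_lin.
Qed.

HB.instance Definition _ :=
  GRing.isZmodClosed.Build _ tens_null tens_null_zmod.

Definition tens : Type := Quotient.quot tens_null.

HB.instance Definition _ := GRing.Zmodule.on tens.

Let piT (g : {malg F[(A * B)%type]}) : tens :=
  (\pi_(Quotient.quot tens_null) g)%qT.

Let piT_eq g h : (piT g = piT h) <-> (g - h \in tens_null).
Proof. by rewrite Quotient.idealrBE; split=> [/eqP|/eqP]. Qed.

Let repT (t : tens) : {malg F[(A * B)%type]} := generic_quotient.repr t.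

Let repTK : cancel repT piT.
Proof. by move=> t; rewrite /piT /repT generic_quotient.reprK. Qed.

Let piTD g h : piT (g + h) = piT g + piT h.
Proof. exact: (@Quotient.pi_add _ tens_null g h). Qed.

Definition tens_scale (c : F) (t : tens) : tens := piT (c *: repT t).

Let piTZ c g : tens_scale c (piT g) = piT (c *: g).
Proof.
apply/piT_eq; rewrite -scalerBr -[_ *: _]addr0 tens_null_lin ?tens_null0 //.
by apply/piT_eq; rewrite repTK.
Qed.

Fact tens_scaleA a b t : tens_scale a (tens_scale b t) = tens_scale (a * b) t.
Proof. by rewrite -[t]repTK !piTZ scalerA. Qed.
Fact tens_scale1 : left_id 1 tens_scale.
Proof. by move=> t; rewrite -[t]repTK piTZ scale1r. Qed.
Fact tens_scaleDr : right_distributive tens_scale +%R.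
Proof. by move=> c s t; rewrite -[s]repTK -[t]repTK -piTD !piTZ scalerDr piTD. Qed.
Fact tens_scaleDl t : {morph tens_scale^~ t : a b / a + b}.
Proof. by move=> a b; rewrite -[t]repTK !piTZ scalerDl piTD. Qed.

HB.instance Definition _ := GRing.Zmodule_isLmodule.Build F tens
  tens_scaleA tens_scale1 tens_scaleDr tens_scaleDl.

Definition tpure (a : A) (b : B) : tens := piT << (a, b) >>.

Let piT_linear : linear piT.
Proof. by move=> c g h; rewrite piTD -piTZ. Qed.

Lemma tpure_linearl b : linear (tpure^~ b).
Proof.
move=> c a a'; rewrite /tpure -piT_linear; apply/piT_eq/asboolP => S [_ SR].
by apply: SR; left; exists c, a, a', b.
Qed.

Lemma tpure_linearr a : linear (tpure a).
Proof.
move=> c b b'; rewrite /tpure -piT_linear; apply/piT_eq/asboolP => S [_ SR].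
by apply: SR; right; exists c, a, b, b'.
Qed.

Section Lift.
Variable V : lmodType F.
Implicit Type f : A -> B -> V.

Definition uncurry2 f (p : (A * B)%type) : V := f p.1 p.2.

Definition tlift f (t : tens) : V := extend (uncurry2 f) (repT t).

Definition bilinear_map f : Prop :=
  (forall b, linear (f^~ b)) /\ (forall a, linear (f a)).

Lemma tlift_fun c f1 f2 t :
  tlift (fun a b => c *: f1 a b + f2 a b) t = c *: tlift f1 t + tlift f2 t.
Proof. exact: extend_fun. Qed.

Lemma eq_tlift f1 f2 t : f1 =2 f2 -> tlift f1 t = tlift f2 t.
Proof. by move=> e; apply: eq_extend => p; apply: e. Qed.

Let tliftE f g : bilinear_map f ->
  tlift f (piT g) = extend (uncurry2 f) g.
Proof.
move=> [fl fr]; have lE := extend_linear (uncurry2 f).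
have : repT (piT g) - g \in tens_null by apply/piT_eq; rewrite repTK.
move=> /asboolP /(_ [set h | extend (uncurry2 f) h = 0]) /=.
have e0 : extend (uncurry2 f) 0 = 0.
  by have := lE (-1) 0 0; rewrite !scaleN1r !addNr.
have H : extend (uncurry2 f) (repT (piT g) - g)
         = tlift f (piT g) - extend (uncurry2 f) g.
  by rewrite [repT _ - g]addrC -[- g]scaleN1r lE scaleN1r addrC.
rewrite H => /(_ _)/subr0_eq; apply; split; first split=> //.
  by move=> c u v /= u0 v0; rewrite lE u0 v0 scaler0 addr0.
move=> h [[c [a [a' [b ->]]]]|[c [a [b [b' ->]]]]] /=.
  rewrite addrC -scaleN1r !lE. by rewrite !extendU /uncurry2 /= fl scaleN1r addNr.
by rewrite addrC -scaleN1r !lE !extendU /uncurry2 /= fr scaleN1r addNr.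
Qed.

Lemma tlift_pure f a b : bilinear_map f -> tlift f (tpure a b) = f a b.
Proof. by move=> bf; rewrite tliftE // extendU. Qed.

Lemma tlift_linear f : bilinear_map f -> linear (tlift f).
Proof.
move=> bf c s t; rewrite -[s]repTK -[t]repTK -piT_linear !tliftE //.
exact: extend_linear.
Qed.

Lemma tens_linear_ext (p q : tens -> V) : linear p -> linear q ->
  (forall a b, p (tpure a b) = q (tpure a b)) -> p =1 q.
Proof.
move=> lp lq epq t; rewrite -[t]repTK.
apply: (malg_linear_ext (p := p \o piT) (q := q \o piT)) => [c g h|c g h|[a b]].
- by rewrite /= piT_linear lp.
- by rewrite /= piT_linear lq.
- exact: epq.
Qed.

End Lift.
End TensorSpace.

Section TensorAlgebra.
Variables (F : fieldType) (A B : alginv F).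
Local Notation T := (tens A B).

Definition tens_mul (s t : T) : T :=
  tlift (fun a b => tlift (fun c d => tpure (a *a c) (b *a d)) t) s.

Definition tens_one : T := tpure aone aone.

Definition tens_star (t : T) : T := tlift (fun a b => tpure (star a) (star b)) t.

Let bil1 a b : bilinear_map (fun c d => tpure (a *a c) (b *a d) : T).
Proof.
split=> [d|c] k u v /=; first by rewrite amul_linearr tpure_linearl.
by rewrite amul_linearr tpure_linearr.
Qed.

Let bil2 (t : T) : bilinear_map
  (fun a b => tlift (fun c d => tpure (a *a c) (b *a d)) t : T).
Proof.
split=> [b|a] k u v /=; rewrite -tlift_fun; apply: eq_tlift => c d.
  by rewrite -tpure_linearl -[in RHS]amul_linearl.
by rewrite -tpure_linearr -[in RHS]amul_linearl.
Qed.

Let bil3 : bilinear_map (fun a b => tpure (star a) (star b) : T).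
Proof.
split=> [b|a] k u v /=; first by rewrite star_linear tpure_linearl.
by rewrite star_linear tpure_linearr.
Qed.

Lemma tens_mul_pure a b c d :
  tens_mul (tpure a b) (tpure c d) = tpure (a *a c) (b *a d).
Proof. by rewrite /tens_mul (tlift_pure _ _ (bil2 _)) (tlift_pure _ _ (bil1 _ _)). Qed.

Lemma tens_star_pure a b : tens_star (tpure a b) = tpure (star a) (star b).
Proof. exact: tlift_pure. Qed.

Fact tens_mul_linearl t : linear (tens_mul^~ t).
Proof. exact: tlift_linear. Qed.

Fact tens_mul_linearr s : linear (tens_mul s).
Proof.
move=> k u v; rewrite /tens_mul -tlift_fun; apply: eq_tlift => a b.
exact: tlift_linear.
Qed.

Fact tens_star_linear : linear tens_star.
Proof. exact: tlift_linear. Qed.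

Fact tens_mul1l : left_id tens_one tens_mul.
Proof.
apply: (tens_linear_ext (q := id)) => //; first exact: tens_mul_linearr.
by move=> a b; rewrite tens_mul_pure !amul1l.
Qed.

Fact tens_mul1r : right_id tens_one tens_mul.
Proof.
apply: (tens_linear_ext (q := id)) => //; first exact: tens_mul_linearl.
by move=> a b; rewrite tens_mul_pure !amul1r.
Qed.

Fact tens_star_anti s t :
  tens_star (tens_mul s t) = tens_mul (tens_star t) (tens_star s).
Proof.
move: s; apply: tens_linear_ext => [k u v|k u v|a b].
- by rewrite (tens_mul_linearl t) tens_star_linear.
- by rewrite tens_star_linear tens_mul_linearr.
move: t; apply: tens_linear_ext => [k u v|k u v|c d].
- by rewrite tens_mul_linearr tens_star_linear.
- by rewrite tens_star_linear (tens_mul_linearl _).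
by rewrite tens_mul_pure !tens_star_pure tens_mul_pure !star_anti.
Qed.

Fact tens_starK : involutive tens_star.
Proof.
apply: (tens_linear_ext (q := id)) => //.
  by move=> k u v; rewrite !tens_star_linear.
by move=> a b; rewrite !tens_star_pure !starK.
Qed.

Definition tens_alg : alginv F :=
  @AlgInv F T tens_mul tens_one tens_star
    tens_mul_linearr tens_mul_linearl tens_mul1l tens_mul1r
    tens_star_linear tens_star_anti tens_starK.

End TensorAlgebra.

Definition tensor (F : fieldType) (A B : galg F) : galg F :=
  @GAlg F (tens_alg A B) (grp A * grp B)%type
    (fun l => span [set tpure a b | a in comp A l.1 & b in comp B l.2]).

Section Laurent.
Variables (F : fieldType) (n : nat).

(** The Laurent monomial of exponent [k : 'rV[int]_n] is [<< k >>]. *)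
Local Notation laurent := {malg F['rV[int]_n]}.

Definition laurent_mul (g h : laurent) : laurent :=
  extend (fun k => extend (fun l => << k + l >> : laurent) h) g.

Fact laurent_mul_linearl h : linear (laurent_mul^~ h).
Proof. exact: extend_linear. Qed.

Fact laurent_mul_linearr g : linear (laurent_mul g).
Proof.
move=> c u v; set T := fun (h : laurent) (k : 'rV[int]_n) =>
  extend (fun l => << k + l >> : laurent) h.
have -> : laurent_mul g (c *: u + v) = extend (fun k => c *: T u k + T v k) g.
  by apply: eq_extend => k; exact: extend_linear.
exact: extend_fun.
Qed.

Lemma laurent_mulU k l : laurent_mul << k >> << l >> = << k + l >>.
Proof. by rewrite /laurent_mul extendU extendU. Qed.

Fact laurent_mul1l : left_id (<< 0 >> : laurent) laurent_mul.
Proof.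
apply: (malg_linear_ext (q := id)) => //; first exact: laurent_mul_linearr.
by move=> k; rewrite laurent_mulU add0r.
Qed.

Fact laurent_mulC : commutative laurent_mul.
Proof.
move=> g h; move: g; apply: malg_linear_ext => [||k].
- exact: laurent_mul_linearl.
- exact: laurent_mul_linearr.
move: h; apply: malg_linear_ext => [||l].
- exact: laurent_mul_linearr.
- exact: laurent_mul_linearl.
by rewrite !laurent_mulU; congr << _ >>; exact: addrC.
Qed.

Fact laurent_mul1r : right_id (<< 0 >> : laurent) laurent_mul.
Proof. by move=> g; rewrite laurent_mulC laurent_mul1l. Qed.

Fact laurent_mulA : associative laurent_mul.
Proof.
have ll h := laurent_mul_linearl h; have lr g := laurent_mul_linearr g.
move=> x y z; move: x; apply: malg_linear_ext => [||k].
- exact: ll.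
- move=> c u v /=; have -> := ll y c u v; exact: ll.
move: y; apply: malg_linear_ext => [||l].
- move=> c u v /=; have -> := ll z c u v; exact: lr.
- move=> c u v /=; have -> := lr << k >> c u v; exact: ll.
move: z; apply: malg_linear_ext => [||m].
- move=> c u v /=; have -> := lr << l >> c u v; exact: lr.
- exact: lr.
have e1 : laurent_mul << k >> (laurent_mul << l >> << m >>) = << k + (l + m) >>.
  by have -> := laurent_mulU l m; exact: laurent_mulU.
have e2 : laurent_mul (laurent_mul << k >> << l >>) << m >> = << k + l + m >>.
  by have -> := laurent_mulU k l; exact: laurent_mulU.
by apply: (etrans e1); rewrite addrA; exact: esym e2.
Qed.

Definition laurent_alg : alginv F :=
  @AlgInv F laurent laurent_mul << 0 >> id
    laurent_mul_linearr laurent_mul_linearl laurent_mul1l laurent_mul1r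
    (fun _ _ _ => erefl) (fun x y => laurent_mulC x y) (fun x => erefl).

(** The grading with [deg t_i = m eps_i]. *)
Definition laurent_comp (m : nat) (l : 'rV[int]_n) : set laurent :=
  span [set << k >> | k in [set k : 'rV[int]_n | k *+ m = l]].

Definition eps (i : nat) : 'rV[int]_n := \row_(j < n) (j == i :> nat)%:R.

End Laurent.

Definition P (F : fieldType) (r : nat) : galg F :=
  @GAlg F (laurent_alg F r) 'rV[int]_r (@laurent_comp F r 1).

Section Doubling.
Variables (F : fieldType) (D : alginv F) (mu : D).
(** [mu_sym] is needed for [cd_star] to be an involution; invertibility of [mu]
    is not needed for the construction, and holds for the [t_i] used below. *)
Hypotheses (mu_central : central mu) (mu_sym : star mu = mu).

(** The pair [(a, b)] stands for [a + u b]. *)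
Definition cd_mul (x y : (D * D)%type) : (D * D)%type :=
  (x.1 *a y.1 + mu *a (y.2 *a star x.2), star x.1 *a y.2 + y.1 *a x.2).

Definition cd_star (x : (D * D)%type) : (D * D)%type := (star x.1, - x.2).

Fact cd_mul_linearr x : linear (cd_mul x).
Proof.
move=> c [u1 u2] [v1 v2]; rewrite /cd_mul /=.
by congr pair; rewrite /= !(amulDl, amulDr, amulZl, amulZr, scalerDr) addrACA.
Qed.

Fact cd_mul_linearl y : linear (cd_mul^~ y).
Proof.
move=> c [u1 u2] [v1 v2]; rewrite /cd_mul /=.
by congr pair; rewrite /= !(starD, starZ, amulDl, amulDr, amulZl, amulZr, scalerDr) addrACA.
Qed.

Fact cd_mul1l : left_id (aone, 0) cd_mul.
Proof.
by move=> [a b]; rewrite /cd_mul /= star0 !(amul0r, star1, amul1l) !addr0.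
Qed.

Fact cd_mul1r : right_id (aone, 0) cd_mul.
Proof.
by move=> [a b]; rewrite /cd_mul /= !(amul0l, amul0r, amul1r, amul1l) addr0 add0r.
Qed.

Fact cd_star_linear : linear cd_star.
Proof.
move=> c [u1 u2] [v1 v2]; rewrite /cd_star /=.
by congr pair; rewrite /= ?star_linear // scalerN opprD.
Qed.

Fact cd_star_anti x y : cd_star (cd_mul x y) = cd_mul (cd_star y) (cd_star x).
Proof.
case: x y => [a b] [c d]; rewrite /cd_mul /cd_star /=; congr pair.
  rewrite starD !star_anti mu_sym starK starN.
  by case: mu_central => -> _ _ _; rewrite amulNl amulNr opprK.
by rewrite starK amulNr amulNr -opprD addrC.
Qed.

Fact cd_starK : involutive cd_star.
Proof. by move=> [a b]; rewrite /cd_star /= starK opprK. Qed.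

Definition CD : alginv F :=
  @AlgInv F (D * D)%type cd_mul (aone, 0) cd_star
    cd_mul_linearr cd_mul_linearl cd_mul1l cd_mul1r
    cd_star_linear cd_star_anti cd_starK.

Lemma CD_pair a b : (a, b) = ((a, 0) : CD) + ((0, aone) : CD) *a ((b, 0) : CD).
Proof.
rewrite /amul /= /cd_mul /= !(star0, amul0l, amul0r, amul1r, addr0, add0r).
by congr pair; rewrite /= ?addr0 ?add0r.
Qed.

Lemma CD_u_sq : ((0, aone) : CD) *a ((0, aone) : CD) = (mu, 0).
Proof.
by rewrite /amul /= /cd_mul /= !(star0, star1, amul0l, amul0r, amul1r, addr0, add0r).
Qed.

Lemma CD_central (m : D) : central m -> star m = m -> central ((m, 0) : CD).
Proof.
move=> [mC mA1 mA2 mA3] ms.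
have mR x : x *a m = m *a x by rewrite mC.
have mL x y : x *a (m *a y) = m *a (x *a y) by rewrite -mA2 mR mA1.
split=> [[a b]|[a b] [c d]|[a b] [c d]|[a b] [c d]];
  rewrite /amul /= /cd_mul /= !(starD, star_anti, star0, ms);
  by rewrite !(amul0l, amul0r, addr0, add0r, mR, mL, mA1, star_anti, ms, amulDr).
Qed.

(** When [D] is commutative, fixing [D] and [u] also defines an involution. *)
Definition cd_star' (x : (D * D)%type) : (D * D)%type := (x.1, star x.2).

Fact cd_star'_linear : linear cd_star'.
Proof.
move=> c [u1 u2] [v1 v2]; rewrite /cd_star' /=.
by congr pair; rewrite /= star_linear.
Qed.

Fact cd_star'_anti (DC : commutative (@amul F D)) x y :
  cd_star' (cd_mul x y) = cd_mul (cd_star' y) (cd_star' x).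
Proof.
case: x y => [a b] [c d]; rewrite /cd_mul /cd_star' /= starK.
congr pair; first by rewrite (DC a) (DC d).
by rewrite starD !star_anti starK addrC (DC _ a) (DC (star b)).
Qed.

Fact cd_star'K : involutive cd_star'.
Proof. by move=> [a b]; rewrite /cd_star' /= starK. Qed.

Lemma CD_comm : commutative (@amul F D) -> (forall x : D, star x = x) ->
  commutative (@amul F CD).
Proof.
move=> DC Ds [a b] [c d]; rewrite /amul /= /cd_mul /= !Ds.
by congr pair; [rewrite (DC a) (DC d) | rewrite addrC].
Qed.

End Doubling.

(** [CD(K, mu_1, ..., mu_n)] over a commutative associative [K] with trivial
    involution is obtained by iterating [cd_step]; [incl] is the embedding of
    [K] in the centre of the algebra reached so far.  When the algebra is
    graded and [mu] is homogeneous of degree [2 delta], the double is graded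
    with [deg u = delta]: [u b] has degree [l] iff [b] has degree [l - delta]. *)
Record galg_over (F : fieldType) (K : alginv F) (L : zmodType) := GAlgOver {
  over_alg :> alginv F;
  over_comp : L -> set over_alg;
  incl : K -> over_alg;
  incl_central : forall k, central (incl k);
  incl_star : forall k, star (incl k) = incl k
}.

Arguments over_comp {F K L} g _.
Arguments incl {F K L} g _.

Section Iterate.
Variables (F : fieldType) (K : alginv F) (L : zmodType).

Definition cd_step (D : galg_over K L) (mu : K) (delta : L) : galg_over K L :=
  let cmu := @incl_central _ _ _ D mu in
  let smu := @incl_star _ _ _ D mu in
  @GAlgOver F K L (CD cmu smu)
    (fun l => [set x : (D * D)%type |
                 over_comp D l x.1 /\ over_comp D (l - delta) x.2])
    (fun k => (incl D k, 0))
    (fun k => CD_central cmu smu (incl_central D k) (incl_star D k))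
    (fun k => congr2 pair (incl_star D k) (oppr0 _)).

End Iterate.

Section ConcreteAlgebras.
Variable F : fieldType.

Fact scalar_linearr (x : F^o) : linear (GRing.mul x : F^o -> F^o).
Proof. by move=> c u v; rewrite mulrDr -[c *: u]/(c * u) mulrCA. Qed.

Fact scalar_linearl (y : F^o) : linear ((fun x => x * y) : F^o -> F^o).
Proof. by move=> c u v; rewrite mulrDl -[c *: u]/(c * u) -mulrA. Qed.

Definition scalar_alg : alginv F :=
  @AlgInv F F^o GRing.mul 1 id scalar_linearr scalar_linearl
    (@mul1r F) (@mulr1 F) (fun _ _ _ => erefl) (@mulrC F) (fun=> erefl).

(** ['rV[int]_0] is the trivial group. *)
Definition scalar_galg : galg F :=
  @GAlg F scalar_alg 'rV[int]_0 (fun _ => setT).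

Section Standard.
Variable n : nat.

Definition tvar (i : nat) : laurent_alg F n := << eps n i >>.

Fact laurent_central (k : laurent_alg F n) : central k.
Proof.
split=> [x|x y|x y|x y].
- exact: laurent_mulC k x.
- exact: esym (laurent_mulA k x y).
- exact: esym (laurent_mulA x k y).
- exact: esym (laurent_mulA x y k).
Qed.

(** [P(n)] regraded with [deg t_i = 2 eps_i]. *)
Definition laurent_over : galg_over (laurent_alg F n) 'rV[int]_n :=
  @GAlgOver F (laurent_alg F n) 'rV[int]_n (laurent_alg F n)
    (@laurent_comp F n 2) id laurent_central (fun=> erefl).

Definition CDP : galg_over (laurent_alg F n) 'rV[int]_n :=
  foldl (fun D i => cd_step D (tvar i) (eps n i)) laurent_over (seq.iota 0 n).

End Standard.

Definition C (n : nat) : galg F :=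
  if n is 0 then scalar_galg
  else @GAlg F (CDP n) 'rV[int]_n (over_comp (CDP n)).

Let D1 := cd_step (laurent_over 2) (tvar 2 0) (eps 2 0).

Fact D1_comm : commutative (@amul F D1).
Proof. exact: (@CD_comm F (laurent_alg F 2) (tvar 2 0)
  (incl_central (laurent_over 2) _) (incl_star (laurent_over 2) _)
  (@laurent_mulC F 2) (fun=> erefl)). Qed.

(** [C(2)] with the involution [a + x_2 b |-> a + x_2 (bar b)] ([a], [b] in
    [CD(P(2), t_1)]); it fixes both generators by [Cstar2_gen1], [Cstar2_gen2], and
    is the only one to do so since they generate [C(2)] up to inverses. *)
Definition Cstar2 : galg F :=
  @GAlg F
    (@AlgInv F (C 2) amul aone (@cd_star' F D1)
       (@amul_linearr F (C 2)) (@amul_linearl F (C 2))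
       (@amul1l F (C 2)) (@amul1r F (C 2))
       (@cd_star'_linear F D1)
       (@cd_star'_anti F D1 _ D1_comm)
       (@cd_star'K F D1))
    (grp (C 2)) (@comp F (C 2)).

Definition gen1 : C 2 := ((0, aone), (0, 0)).
Definition gen2 : C 2 := ((0, 0), (aone, 0)).

Lemma Cstar2_gen1 : star (gen1 : Cstar2) = gen1.
Proof. by congr pair; apply: (star0 D1). Qed.

Lemma Cstar2_gen2 : star (gen2 : Cstar2) = gen2.
Proof. by congr pair; apply: (star1 D1). Qed.

End ConcreteAlgebras.

Section Models.
Variable F : fieldType.

(** [C(2) (x) ... (x) C(2) (x) B (x) P(r)], with [k] factors [C(2)]. *)
Definition model_a (k : nat) (B : galg F) (r : nat) : galg F :=
  iter k (tensor (C F 2)) (tensor B (P F r)).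

Definition listed_a (T : galg F) : Prop :=
  exists (k r : nat) (B : galg F),
    [/\ [\/ B = scalar_galg F, B = C F 1 | B = Cstar2 F],
        k = 0%N -> B = C F 1 &
        T = model_a k B r].

Definition listed_b (T : galg F) : Prop :=
  exists k r : nat,
    (k <= 3)%N /\ T = tensor (C F 3) (tensor (C F k) (P F r)).

End Models.

(* Main.v *)
(** Over a class I torus the skew homogeneous elements generate, and the
    structurable identity says that they are alternative: an associator with two
    skew entries changes sign when these are swapped. Hence the signs with which
    homogeneous elements commute, and their associators, which are signs as well,
    are dictated by the set of skew degrees. Two tori with the same skew degrees
    therefore have structure constants differing by a symmetric 2-cocycle of the
    free group, which is a coboundary, so they are isograded isomorphic.

    It remains to find the sets of skew degrees.  Their indicator [S] is invariant
    under doubled degrees.  If the torus is associative, [S] is a quadratic form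
    over the field with two elements, and the list (a) is that of the quadratic
    forms: elliptic planes plus a form of rank at most two.  Otherwise [S] contains
    the seven nonzero degrees of an octonion algebra, and the symmetric or skew
    degrees of its centralizer form a group; its quotient by the symmetric ones is an
    elementary abelian 2-group, of rank at most three because the fifteen nonzero
    sums of four skew degrees cannot all be skew.

    The models have bases indexed by degrees, multiplied up to signs.  The
    structurable identity of [C(3) (x) C(k) (x) P(r)] reduces to the cancellation
    of thirty-six signs, which takes few enough patterns on octonions to be
    checked by computation. *)

From HB Require Import structures.
From mathcomp Require Import all_boot all_order all_algebra.
From mathcomp Require Import boolp classical_sets.
From mathcomp Require Import finmap.
From mathcomp.multinomials Require Import monalg.
From mathcomp Require Import ring zify.
Require Import Defs.

Set Implicit Arguments.
Unset Strict Implicit.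
Unset Printing Implicit Defensive.

Import GRing.Theory.

Local Open Scope ring_scope.

(** * Identities in additive groups *)

(** What makes skew degrees decisive is that every degree is skew or the sum of two skew degrees
    whose elements commute. A homogeneous element is then, up to a scalar, skew or a product of two
    commuting skew elements, and the pentagon relation between the associators of four elements,
    together with alternativity and the involution, leads every associator back to those of three
    skew elements. There the sign is -1 exactly if all sums of two and of three of the degrees are
    skew. No octonion subalgebra or centralizer of an abstract torus is ever constructed: the
    classification handles sets of degrees only, so the models must be shown to be tori of class I
    before a torus can be compared with them. Sets of degrees are treated modulo doubled degrees,
    that is by linear algebra over the field with two elements, and the Smith normal form lifts the
    result to the free group. The characteristic enters because the structurable identity with some
    arguments equal to 1 gives alternativity only up to the factors 4 and 12, and a later associator
    only up to 18. *)

Inductive zexpr :=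
  | ZVar of nat
  | ZZero
  | ZAdd of zexpr & zexpr
  | ZOpp of zexpr
  | ZMuln of zexpr & nat.

Section ZExpr.
Variables (V : zmodType) (env : seq V).

Fixpoint zeval (e : zexpr) : V :=
  match e with
  | ZVar i => env`_i
  | ZZero => 0
  | ZAdd e1 e2 => zeval e1 + zeval e2
  | ZOpp e1 => - zeval e1
  | ZMuln e1 n => zeval e1 *+ n
  end.

Fixpoint zcoef (e : zexpr) (i : nat) : int :=
  match e with
  | ZVar j => (i == j)%:Z
  | ZZero => 0
  | ZAdd e1 e2 => zcoef e1 i + zcoef e2 i
  | ZOpp e1 => - zcoef e1 i
  | ZMuln e1 n => zcoef e1 i * n%:Z
  end.

Lemma zevalE e : zeval e = \sum_(i < size env) env`_i *~ zcoef e i.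
Proof.
elim: e => /= [j||e1 -> e2 ->|e ->|e -> n].
- case: (ltnP j (size env)) => jN; last first.
    rewrite nth_default // big1 // => i _.
    by case: eqP => [ij|]; rewrite ?mulr0z //; move: jN; rewrite -ij leqNgt ltn_ord.
  rewrite (bigD1 (Ordinal jN)) //= eqxx big1 ?addr0 // => i.
  by rewrite -val_eqE /= => /negbTE->.
- by rewrite big1 // => i _; rewrite mulr0z.
- by rewrite -big_split; apply: eq_bigr => i _; rewrite mulrzDr.
- by rewrite -sumrN; apply: eq_bigr => i _; rewrite mulrNz.
- by rewrite -sumrMnl; apply: eq_bigr => i _; rewrite mulrzA.
Qed.

Lemma zeval_eq N e1 e2 : size env = N ->
  all (fun i => zcoef e1 i == zcoef e2 i) (iota 0 N) -> zeval e1 = zeval e2.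
Proof.
move=> sN /allP eqc; rewrite !zevalE; apply: eq_bigr => i _.
by rewrite (eqP (eqc i _)) // mem_iota /= -sN ltn_ord.
Qed.

End ZExpr.

Ltac zmod_index x env :=
  match env with
  | x :: _ => constr:(0%N)
  | _ :: ?env' => let n := zmod_index x env' in constr:(S n)
  end.

(** Booleans count as literals because [no_four_octonionic] multiplies degrees by boolean
    coefficients. *)
Ltac nat_literal n :=
  lazymatch n with
  | O => idtac
  | S ?m => nat_literal m
  | nat_of_bool true => idtac
  | nat_of_bool false => idtac
  end.

Ltac zmod_atom env t :=
  match env with
  | _ => let _ := zmod_index t env in env
  | _ => constr:(t :: env)
  end.

Ltac zmod_atoms env t :=
  lazymatch t with
  | ?a + ?b => let env1 := zmod_atoms env a in zmod_atoms env1 b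
  | - ?a => zmod_atoms env a
  | 0 => env
  | ?a *+ ?n => match goal with
                | _ => let _ := match goal with _ => nat_literal n end in
                       zmod_atoms env a
                | _ => zmod_atom env t
                end
  | _ => zmod_atom env t
  end.

Ltac zmod_var env t := let n := zmod_index t env in constr:(ZVar n).

Ltac zmod_reify env t :=
  lazymatch t with
  | ?a + ?b => let u := zmod_reify env a in let v := zmod_reify env b in
               constr:(ZAdd u v)
  | - ?a => let u := zmod_reify env a in constr:(ZOpp u)
  | 0 => constr:(ZZero)
  | ?a *+ ?n => match goal with
                | _ => let _ := match goal with _ => nat_literal n end in
                       let u := zmod_reify env a in constr:(ZMuln u n)
                | _ => zmod_var env t
                end
  | _ => zmod_var env t
  end.

(** [ring] does not apply to a bare [zmodType]; this decides equalities of
    integer combinations there. *)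
Ltac zmod :=
  lazymatch goal with
  | |- ?a = ?b :> ?T =>
    let env0 := zmod_atoms (@nil T) a in
    let env := zmod_atoms env0 b in
    let u := zmod_reify env a in
    let v := zmod_reify env b in
    let N := eval compute in (size env) in
    refine (@zeval_eq _ env N u v erefl _); vm_compute; reflexivity
  end.

Lemma eqD (V : zmodType) (a b c d : V) : a = b -> c = d -> a + c = b + d.
Proof. by move=> -> ->. Qed.

Lemma subr_eq_zero (V : zmodType) (a b : V) : a = b -> a - b = 0.
Proof. by move=> ->; rewrite subrr. Qed.

Lemma eqM (V : zmodType) (n : nat) (a b : V) : a = b -> a *+ n = b *+ n.
Proof. by move=> ->. Qed.

(** Only the factors 1 and -1 are tried; a longer linear combination of hypotheses is first
    assembled with [eqD] and [eqM]. *)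
Ltac zlin H :=
  lazymatch type of H with
  | ?l = ?r =>
    apply: subr0_eq;
    first [transitivity (l - r); [zmod | exact: (subr_eq_zero H)]
          |transitivity (r - l); [zmod | exact: (subr_eq_zero (esym H))]]
  end.

(** * Skew elements of a structurable algebra *)

Section SkewAlternative.
Variables (F : fieldType) (A : alginv F).
Hypotheses (two0 : 2%:R != 0 :> F) (three0 : 3%:R != 0 :> F).
Hypothesis strA : structurable A.
Implicit Types (x y z w s t h k : A).

Definition asso x y z : A := (x *a y) *a z - x *a (y *a z).

Lemma muln_inj2 x : x *+ 2 = 0 -> x = 0.
Proof. by move=> /eqP; rewrite -scaler_nat scaler_eq0 (negbTE two0) => /eqP. Qed.

Lemma muln_inj3 x : x *+ 3 = 0 -> x = 0.
Proof. by move=> /eqP; rewrite -scaler_nat scaler_eq0 (negbTE three0) => /eqP. Qed.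

Definition expandE := (starD, starN, star_anti, starK, star1, amul1l, amul1r,
  amulDl, amulDr, amulNl, amulNr, @opprK A).

Lemma star_asso x y z : star (asso x y z) = - asso (star z) (star y) (star x).
Proof. by rewrite /asso !expandE opprB. Qed.

Lemma assoNl x y z : asso (- x) y z = - asso x y z.
Proof. by rewrite /asso !expandE; zmod. Qed.
Lemma assoNm x y z : asso x (- y) z = - asso x y z.
Proof. by rewrite /asso !expandE; zmod. Qed.
Lemma assoNr x y z : asso x y (- z) = - asso x y z.
Proof. by rewrite /asso !expandE; zmod. Qed.

Lemma asso_sym1 s h w : star s = - s -> star h = h ->
  asso s h w - asso h s w + asso w h s *+ 3 + asso w s h *+ 3 - asso h w s *+ 2 = 0.
Proof.
move=> ss sh; have := strA s aone aone h w.
rewrite /triple /asso !(ss, sh, expandE) => H; zlin H.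
Qed.

Lemma asso_sym2 k h w : star k = - k -> star h = h ->
  asso h k w - asso k h w + asso h w k *+ 2 + asso w k h + asso w h k = 0.
Proof.
move=> sk sh; have := strA h aone aone k w.
rewrite /triple /asso !(sk, sh, expandE) => H; zlin H.
Qed.

Lemma asso_skew s k x : star s = - s -> star k = - k -> star x = - x ->
  - asso s k x + asso k x s *+ 2 - asso x s k *+ 3 + asso k s x - asso x k s *+ 3 = 0.
Proof.
move=> ss sk sx; have := strA s aone x k aone.
rewrite /triple /asso !(ss, sk, sx, expandE) => H; zlin H.
Qed.

(** In the sum of [asso_sym1] and [asso_sym2] all other associators cancel, and what is left is four
    times the relation. *)
Lemma asso_sym_r w h k : star k = - k -> star h = h -> asso w h k = - asso w k h.
Proof.
move=> sk sh; apply: subr0_eq; apply: muln_inj2; apply: muln_inj2.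
have H1 := asso_sym1 w sk sh; have H2 := asso_sym2 w sk sh.
have H := eqD H1 H2; zlin H.
Qed.

Lemma asso_sym_l k h w : star k = - k -> star h = h -> asso k h w = - asso h k w.
Proof.
move=> sk sh; apply: (can_inj (@starK F A)).
rewrite starN !star_asso sk sh assoNm !assoNr !opprK.
by rewrite asso_sym_r // opprK.
Qed.

Lemma asso_sym_m h w k : star k = - k -> star h = h -> asso h w k = asso k h w.
Proof.
move=> sk sh; apply: subr0_eq; apply: muln_inj2.
have H := eqD (eqD (asso_sym2 w sk sh) (esym (asso_sym_l w sk sh)))
  (esym (asso_sym_r w sk sh)).
zlin H.
Qed.

(** The involution reverses an associator of three skew elements, so [asso_skew], its permutations
    and their images are linear relations among only six associators. *)
Lemma asso_alt_skew s k x : star s = - s -> star k = - k -> star x = - x ->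
  asso s k x = - asso k s x.
Proof.
move=> ss sk sx.
have E := asso_skew.
have st a b c : star a = - a -> star b = - b -> star c = - c ->
    star (asso a b c) = asso c b a.
  by move=> sa sb sc; rewrite star_asso sa sb sc assoNl assoNm assoNr !opprK.
have e1 := E _ _ _ ss sk sx.
have f1 := congr1 star e1; have f2 := congr1 star (E _ _ _ sk sx ss).
have f3 := congr1 star (E _ _ _ sk ss sx).
rewrite !(mulr2n, mulrS, mulr0n, starD, starN, star0, st) // in f1 f2 f3.
apply: subr0_eq; do 2 apply: muln_inj2; apply: muln_inj3.
(* The weights 1, -1, -2, -4 eliminate the other four associators and leave twelve times the
   claim. *)
have H := eqD (eqD e1 (esym f1)) (eqD (eqM 2 (esym f2)) (eqM 4 (esym f3))); zlin H.
Qed.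

Lemma assoDm x y z w : asso x (y + z) w = asso x y w + asso x z w.
Proof. by rewrite /asso !expandE; zmod. Qed.
Lemma assoDr x y z w : asso x y (z + w) = asso x y z + asso x y w.
Proof. by rewrite /asso !expandE; zmod. Qed.
Lemma assoDl x y z w : asso (x + y) z w = asso x z w + asso y z w.
Proof. by rewrite /asso !expandE; zmod. Qed.

Lemma assoZm c x y z : asso x (c *: y) z = c *: asso x y z.
Proof. by rewrite /asso !(amulZl, amulZr) scalerBr. Qed.
Lemma assoZr c x y z : asso x y (c *: z) = c *: asso x y z.
Proof. by rewrite /asso !(amulZl, amulZr) scalerBr. Qed.
Lemma assoZl c x y z : asso (c *: x) y z = c *: asso x y z.
Proof. by rewrite /asso !(amulZl, amulZr) scalerBr. Qed.

(** Twice any element is the sum of a symmetric and a skew one; the second hypothesis stands for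
    division by 2. *)
Lemma sym_skew_ind (P : A -> Prop) :
  (forall x y, P x -> P y -> P (x + y)) -> (forall x, P (x *+ 2) -> P x) ->
  (forall x, star x = x -> P x) -> (forall x, star x = - x -> P x) -> forall x, P x.
Proof.
move=> PD P2 Ph Ps x; apply: P2.
have -> : x *+ 2 = (x + star x) + (x - star x) by zmod.
apply: PD; first by apply: Ph; rewrite starD starK addrC.
by apply: Ps; rewrite starD starN starK opprB addrC.
Qed.

Lemma asso_swap12 s x y : star s = - s -> asso s x y = - asso x s y.
Proof.
move=> ss; elim/sym_skew_ind: x => [x x'|x|h sh|k sk].
- move=> H1 H2; rewrite assoDm assoDl; have H := eqD H1 H2; zlin H.
- rewrite !mulr2n assoDm assoDl => H; apply: subr0_eq; apply: muln_inj2.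
  zlin H.
- exact: asso_sym_l.
elim/sym_skew_ind: y => [y y'|y|h sh|x sx].
- move=> H1 H2; rewrite !assoDr; have H := eqD H1 H2; zlin H.
- rewrite !mulr2n !assoDr => H; apply: subr0_eq; apply: muln_inj2.
  zlin H.
(* The chain is (s, k, h) = -(s, h, k) = (h, s, k) = (k, h, s) = -(k, s, h). *)
- have H := eqD (eqD (asso_sym_r s sk sh) (esym (asso_sym_l k ss sh)))
    (eqD (asso_sym_m s sk sh) (asso_sym_r k ss sh)).
  zlin H.
- exact: asso_alt_skew.
Qed.

Lemma asso_swap23 s x y : star s = - s -> asso x s y = - asso x y s.
Proof.
move=> ss; apply: (can_inj (@starK F A)).
rewrite starN !star_asso ss assoNm assoNl !opprK.
by rewrite [in RHS]asso_swap12 // opprK.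
Qed.

(** For skew [s] this is the operator [triple s aone]. As [triple aone s] is its negative, the
    structurable identity makes it a derivation of the triple product. *)
Definition Tskew s x : A := s *a x + x *a s *+ 2.

Lemma Tskew_derivation s x y w : star s = - s ->
  Tskew s (triple x y w) =
  triple (Tskew s x) y w + triple x (Tskew s y) w + triple x y (Tskew s w).
Proof.
move=> ss; have := strA s aone x y w; rewrite /Tskew /triple.
rewrite !(mulr2n, ss, expandE) => H; zlin H.
Qed.

Lemma tripleBl x x' y z : triple (x - x') y z = triple x y z - triple x' y z.
Proof. by rewrite /triple !expandE; zmod. Qed.
Lemma tripleBm x y y' z : triple x (y - y') z = triple x y z - triple x y' z.
Proof. by rewrite /triple !expandE; zmod. Qed.
Lemma tripleBr x y z z' : triple x y (z - z') = triple x y z - triple x y z'.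
Proof. by rewrite /triple !expandE; zmod. Qed.

(** The commutator [E] of the derivations [Tskew s] and [Tskew t] is a derivation equal to
    [-6 asso s t]. It kills 1, [u] and [v], hence also [triple u aone v], which is three times
    [u *a v] because [u] and [v] commute. *)
Lemma asso_commuting s t u v :
  star s = - s -> star t = - t -> s *a t = t *a s ->
  star u = - u -> star v = - v -> u *a v = v *a u ->
  asso s t u = 0 -> asso s t v = 0 -> asso s t (u *a v) = 0.
Proof.
move=> ss st cst su sv cuv au av.
pose E x := Tskew s (Tskew t x) - Tskew t (Tskew s x).
have EE x : E x = - asso s t x *+ 6.
  have e1 := asso_swap12 t x ss; have e2 := asso_swap23 s x st.
  have e3 := asso_swap23 t x ss; have e4 := asso_swap12 x t ss.
  have e5 := asso_swap12 x s st.
  transitivity (- asso s t x + asso t s x - asso s x t *+ 2 + asso t x s *+ 2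
     + asso x t s *+ 4 - asso x s t *+ 4).
    rewrite /E /Tskew /asso !(mulr2n, expandE) cst; zmod.
  have {}e5 : asso x t s = - asso t x s by rewrite e5 opprK.
  have {}e4 : asso x s t = - asso s x t by rewrite e4 opprK.
  have {}e3 : asso t x s = - asso t s x by rewrite e3 opprK.
  have {}e2 : asso s x t = - asso s t x by rewrite e2 opprK.
  have {}e1 : asso t s x = - asso s t x by rewrite e1 opprK.
  rewrite e5 e4 e3 e2 e1; zmod.
have E1 : E aone = 0 by rewrite /E /Tskew !(mulr2n, expandE) cst; zmod.
have ED x y w : E (triple x y w) = triple (E x) y w + triple x (E y) w + triple x y (E w).
  have TD a b c d : star a = - a ->
      Tskew a (b + c + d) = Tskew a b + Tskew a c + Tskew a d.
    by rewrite /Tskew !(mulr2n, expandE) => _; zmod.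
  rewrite /E (Tskew_derivation _ _ _ st) (Tskew_derivation _ _ _ ss).
  rewrite (TD s) // (TD t) //.
  rewrite 3!(Tskew_derivation _ _ _ st) 3!(Tskew_derivation _ _ _ ss).
  rewrite tripleBl tripleBm tripleBr; zmod.
have := ED u aone v; rewrite EE E1 (EE u) (EE v) au av oppr0 mul0rn.
rewrite /triple !(su, sv, star0, oppr0, amul0l, amul0r, addr0, subrr, expandE) cuv.
rewrite !(assoDr, assoNr, oppr0, addr0) -?cuv => H.
apply: muln_inj2; do 2 apply: muln_inj3; zlin H.
Qed.

End SkewAlternative.

(** * Gradings *)

Section Span.
Variables (F : fieldType) (V : lmodType F).
Implicit Types (S P : set V).

Lemma subspace_span S : subspace (span S).
Proof.
split=> [P [[]]//|c u v uS vS P PP].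
by case: (PP) => sP _; apply: sP.2; [exact: uS | exact: vS].
Qed.

Lemma span_ind S P : subspace P -> (S `<=` P)%classic -> (span S `<=` P)%classic.
Proof. by move=> sP SP x; apply. Qed.

Lemma sub_span S : (S `<=` span S)%classic.
Proof. by move=> x Sx P [_]; apply. Qed.

Lemma subspaceD P x y : subspace P -> P x -> P y -> P (x + y).
Proof. by move=> [_ PZ] Px Py; rewrite -[x]scale1r; apply: PZ. Qed.

Lemma subspaceZ P c x : subspace P -> P x -> P (c *: x).
Proof. by move=> [P0 PZ] Px; rewrite -[_ *: _]addr0; apply: PZ. Qed.

Lemma subspace_sum P (I : Type) (r : seq I) (G : I -> V) :
  subspace P -> (forall i, P (G i)) -> P (\sum_(i <- r) G i).
Proof.
move=> sP PG; elim: r => [|i r IH]; first by rewrite big_nil; case: sP.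
by rewrite big_cons; apply: subspaceD.
Qed.

Lemma subspace_eq (W : lmodType F) (p q : V -> W) :
  linear p -> linear q -> subspace [set x | p x = q x]%classic.
Proof.
move=> lp lq; have lin0 (r : V -> W) : linear r -> r 0 = 0.
  by move=> lr; have := lr (-1) 0 0; rewrite !scaleN1r !addNr.
split; first by rewrite /= !lin0.
by move=> c u v /= eu ev; rewrite lp lq eu ev.
Qed.

End Span.

Lemma extendZ (F : fieldType) (K : choiceType) (V : lmodType F) (f : K -> V)
    (c : F) (k : K) : extend f (c *: << k >>) = c *: f k.
Proof.
have := extend_linear f (-1) 0 0; rewrite !scaleN1r !addNr => e0.
by rewrite -[_ *: << k >>]addr0 extend_linear e0 extendU addr0.
Qed.

Section Graded.
Variables (F : fieldType) (A : galg F).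
Hypothesis fineA : finely_graded A.
Local Notation L := (grp A).
Implicit Types (x y z : A) (l m : L).

Let grA : is_graded A := fineA.1.

Lemma comp_subspace l : subspace (comp A l).
Proof. by case: grA. Qed.

Lemma comp0 l : comp A l 0.
Proof. by case: (comp_subspace l). Qed.

Lemma compZ l c x : comp A l x -> comp A l (c *: x).
Proof. exact: (subspaceZ c (comp_subspace l)). Qed.

Lemma compM l m x y : comp A l x -> comp A m y -> comp A (l + m) (x *a y).
Proof. by case: grA => _ _ _ H _; apply: H. Qed.

Lemma comp_star l x : comp A l x -> comp A l (star x).
Proof. by case: grA => _ _ _ _ H xl; rewrite -(H l); exists x. Qed.

(** Degrees outside the support receive the generator 0, so that all components have the same
    description. *)
Lemma exists_generators :
  exists e : L -> A, forall l x, comp A l x <-> exists k, x = k *: e l.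
Proof.
have H l : exists e : A, forall x, comp A l x <-> exists k, x = k *: e.
  have [sl|nsl] := pselect (supp (@setT A) l).
    have [e [el e0 He]] := fineA.2 _ sl; exists e => x; split; first exact: He.
    by case=> k ->; apply: compZ.
  exists 0 => x; split=> [xl|[k ->]]; last by rewrite scaler0; apply: comp0.
  exists 0; rewrite scaler0; apply/eqP/negP => /negP/eqP x0; apply: nsl.
  by exists x.
by exists (fun l => projT1 (cid (H l))) => l; case: (cid (H l)).
Qed.

Variable e : L -> A.
Hypothesis eP : forall l x, comp A l x <-> exists k, x = k *: e l.

Lemma comp_gen l : comp A l (e l).
Proof. by apply/eP; exists 1; rewrite scale1r. Qed.

Lemma part_extend (M : set L) x : part M x ->
  exists g : {malg F[L]}, x = extend e g /\ forall k, k \in msupp g -> M k.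
Proof.
move: x; apply: span_ind; first split.
- exists 0; split; last by move=> k; rewrite msupp0 inE.
  by have := extend_linear e (-1) 0 0; rewrite !scaleN1r !addNr.
- move=> c u v [g [-> gM]] [h [-> hM]]; exists (c *: g + h).
  split; first by rewrite extend_linear.
  move=> k /(fsubsetP (msuppD_le _ _)); rewrite in_fsetU => /orP[|/hM//].
  by move/(fsubsetP (msuppZ_le _ _))/gM.
move=> x [l Ml /eP[k ->]]; exists (k *: << l >>); split.
  by rewrite extendZ.
move=> j /(fsubsetP (msuppZ_le _ _)) /(fsubsetP (msuppU_le)).
by rewrite in_fset1 => /eqP->.
Qed.

Lemma extend_surj x : exists g : {malg F[L]}, x = extend e g.
Proof.
have : part (@setT L) x by case: grA => _ ->.
by case/part_extend => g []; exists g.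
Qed.

Lemma extend_eq0 (g : {malg F[L]}) : extend e g = 0 -> forall k, g@_k *: e k = 0.
Proof.
move=> eg0 k; case: (boolP (k \in msupp g)) => [kg|]; last first.
  by move/mcoeff_outdom => ->; rewrite scale0r.
case: grA => _ _ ind _ _.
apply: (ind (msupp g : seq L) (fun l => g@_l *: e l)) => //.
- exact: fset_uniq.
- by move=> l; apply/eP; exists g@_l.
by move: eg0; rewrite unlock.
Qed.

Definition coord x : {malg F[L]} := projT1 (cid (extend_surj x)).

Lemma coordK x : extend e (coord x) = x.
Proof. by rewrite /coord; case: cid. Qed.

(** The coefficients in [coord] are a choice, ambiguous where [e l] is 0; their products with [e l]
    are determined. *)
Definition proj l x : A := (coord x)@_l *: e l.

Lemma proj_extend (g : {malg F[L]}) l : proj l (extend e g) = g@_l *: e l.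
Proof.
apply/eqP; rewrite -subr_eq0 -scalerBl -mcoeffB; apply/eqP.
apply: extend_eq0; have := extend_linear e (-1) g (coord (extend e g)).
by rewrite coordK !scaleN1r addNr addrC => ->.
Qed.

Lemma proj_linear l : linear (proj l).
Proof.
move=> c x y; rewrite -[in LHS](coordK x) -[in LHS](coordK y) -extend_linear.
by rewrite proj_extend mcoeffD mcoeffZ scalerDl -scalerA.
Qed.

Lemma proj_comp l x : comp A l (proj l x).
Proof. exact/compZ/comp_gen. Qed.

Lemma proj_id l m x : comp A l x -> proj m x = if m == l then x else 0.
Proof.
case/eP=> k ->.
rewrite -(extendZ e k l) proj_extend mcoeffZ mcoeffU eq_sym extendZ.
by case: eqP => [->|_]; rewrite ?mulr1 // mulr0 scale0r.
Qed.

Lemma comp_ind (P : set A) : subspace P -> (forall l x, comp A l x -> P x) ->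
  forall x, P x.
Proof.
move=> sP HP x; rewrite -(coordK x) unlock; apply: subspace_sum => // k.
by apply: (HP k); apply/compZ/comp_gen.
Qed.

Lemma proj_mull l m x y : comp A l x -> proj (l + m) (x *a y) = x *a proj m y.
Proof.
move=> xl; move: y; apply: comp_ind.
  apply: subspace_eq => c u v; first by rewrite amulDr amulZr proj_linear.
  by rewrite proj_linear amulDr amulZr.
move=> k y yk; rewrite (proj_id _ (compM xl yk)) (proj_id _ yk).
by rewrite (inj_eq (addrI l)); case: eqP => // _; rewrite amul0r.
Qed.

(** The degree 0 part of 1 is a right unit: for homogeneous [x], project [x *a aone = x] to the
    degree of [x]. *)
Lemma comp_one : comp A 0 (aone : A).
Proof.
suff <- : proj 0 (aone : A) = aone by apply: proj_comp.
rewrite -[LHS]amul1l.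
have H : forall x, x *a proj 0 (aone : A) = x.
  apply: comp_ind; first by apply: subspace_eq => c u v //; rewrite amulDl amulZl.
  move=> l x xl; have := proj_mull 0 aone xl; rewrite addr0 => <-.
  by rewrite amul1r (proj_id _ xl) eqxx.
exact: H.
Qed.

End Graded.

(** * Tori of class I *)

Section Torus.
Variables (F : fieldType) (A : galg F).
Hypotheses (two0 : 2%:R != 0 :> F) (three0 : 3%:R != 0 :> F).
Hypothesis torA : structurable_torus A.
Hypothesis clA : class_I A.
Local Notation L := (grp A).
Implicit Types (x y z s t u v : A) (l m n : L).

Let strA : structurable A. Proof. by case: torA. Qed.
Let fineA : finely_graded A. Proof. by case: torA. Qed.

Definition sk l : bool := `[< supp (skew A) l >].

Definition hskew l s : Prop := [/\ comp A l s, s <> 0 & star s = - s].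

Let comp1 : comp A 0 (aone : A).
Proof. by have [e eP] := exists_generators fineA; apply: comp_one eP. Qed.
Let swap12 := asso_swap12 two0 three0 strA.
Let swap23 := asso_swap23 two0 three0 strA.

Lemma comp_line l x y : comp A l x -> x <> 0 -> comp A l y -> exists k, y = k *: x.
Proof.
have [e eP] := exists_generators fineA.
move=> /eP[k ->] x0 /eP[j ->]; exists (j / k).
rewrite scalerA divfK //; apply/eqP => k0; by apply: x0; rewrite k0 scale0r.
Qed.

Lemma star_comp l x : comp A l x -> star x = if sk l then - x else x.
Proof.
move=> xl; rewrite /sk; case: asboolP => [[y [yl ys] y0]|nsk].
  have [k ->] := comp_line yl y0 xl.
  by rewrite starZ ys scalerN.
have [->|/eqP x0] := eqVneq x 0; first by rewrite star0.
have [k ek] := comp_line xl x0 (comp_star fineA xl).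
have : star (star x) = x by rewrite starK.
rewrite ek starZ ek scalerA => /eqP.
rewrite -subr_eq0 -{2}[x]scale1r -scalerBl scaler_eq0 => /orP[|/eqP//].
rewrite -expr2 subr_eq0 sqrf_eq1 => /orP[/eqP->|/eqP k1]; first by rewrite scale1r.
case: nsk; exists x => //; split=> //.
by rewrite /skew /= ek k1 scaleN1r.
Qed.

Lemma sk_ex l : sk l -> exists s, hskew l s.
Proof. by move/asboolP => [s [sl ss] s0]; exists s. Qed.

Lemma hskew_sk l s : hskew l s -> sk l.
Proof. by case=> sl s0 ss; apply/asboolP; exists s. Qed.

Lemma comp_hskew l s : comp A l s -> s <> 0 -> sk l -> hskew l s.
Proof. by move=> sl s0 lS; split=> //; rewrite (star_comp sl) lS. Qed.

Lemma aone_neq0 : (aone : A) <> 0.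
Proof.
move=> e10; case: clA => [[l [x _ x0]] _]; apply: x0.
by rewrite -[x]amul1l e10 amul0l.
Qed.

Lemma sk0 : sk 0 = false.
Proof.
apply/negP => s0; have := star_comp comp1; rewrite s0 star1 => /eqP.
rewrite -subr_eq0 opprK -mulr2n => /eqP /(muln_inj2 two0).
exact: aone_neq0.
Qed.

(** The inverse [y] given by the definition of a torus is not known to be skew or homogeneous. Since
    [- star y] inverts the skew [s] as well, the mean [t] of both is a skew inverse. Alternativity
    turns [s *a t = aone] into the cancellation rules, and these identify [t] with its component of
    degree [- l]. *)
Lemma hskew_inv l s : hskew l s -> exists t, hskew (- l) t /\
  forall x, [/\ s *a (t *a x) = x, t *a (s *a x) = x, (x *a s) *a t = x & (x *a t) *a s = x].
Proof.
case=> sl s0 ss; have [_ _ /(_ _ _ sl s0) [y [sy ys Lsy Rsy]] _] := torA.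
have Lsy' z : s *a (star y *a z) = star y *a (s *a z).
  have /(congr1 star) := Rsy (star z).
  rewrite starD starN !star_anti starK star0 ss !(amulNl, amulNr) => H.
  by apply: subr0_eq; zlin H.
have ys' : star y *a s = - aone.
  have /(congr1 star) := sy; rewrite star_anti ss star1 amulNr => H; zlin H.
have sy' : s *a star y = - aone.
  have /(congr1 star) := ys; rewrite star_anti ss star1 amulNl => H; zlin H.
pose t := 2%:R^-1 *: (y - star y).
have ts : star t = - t by rewrite starZ starD starN starK -scalerN opprB addrC.
have half (z : A) : 2%:R^-1 *: (z + z) = z.
  by rewrite -mulr2n -scaler_nat scalerA mulVf // scale1r.
have st1 : s *a t = aone by rewrite amulZr amulDr amulNr sy sy' opprK half.
have ts1 : t *a s = aone by rewrite amulZl amulDl amulNl ys ys' opprK half.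
have Lst z : s *a (t *a z) = t *a (s *a z).
  rewrite !(amulZl, amulZr, amulDl, amulDr, amulNl, amulNr) Lsy'.
  by congr (_ *: (_ - _)); apply/eqP; rewrite -subr_eq0 Lsy.
have K1 z : s *a (t *a z) = z.
  have := swap12 t z ss; rewrite /asso st1 ts1 amul1l -Lst => H.
  apply: subr0_eq; apply: (muln_inj2 two0); zlin H.
have K2 z : t *a (s *a z) = z by rewrite -Lst.
have [e eP] := exists_generators fineA.
have tl : comp A (- l) t.
  have := proj_mull fineA eP (- l) t sl.
  rewrite subrr st1 (proj_id fineA eP _ comp1) eqxx => /(congr1 (amul t)).
  by rewrite K2 amul1r => ->; apply: proj_comp.
exists t; split.
  split=> // t0; apply: aone_neq0; by rewrite -st1 t0 amul0r.
move=> x; split=> //; apply: (can_inj (@starK F A)).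
  by rewrite !star_anti ss ts !(amulNl, amulNr) opprK K2.
by rewrite !star_anti ss ts !(amulNl, amulNr) opprK K1.
Qed.

Lemma hskew_mulI l s x : hskew l s -> s *a x = 0 -> x = 0.
Proof. by move=> /hskew_inv[t [_ K]] sx0; have [_ <- _ _] := K x; rewrite sx0 amul0r. Qed.

Lemma hskew_mulIr l s x : hskew l s -> x *a s = 0 -> x = 0.
Proof. by move=> /hskew_inv[t [_ K]] xs0; have [_ _ <- _] := K x; rewrite xs0 amul0l. Qed.

Lemma skN l : sk l -> sk (- l).
Proof. by move/sk_ex => [s /hskew_inv[t [/hskew_sk]]]. Qed.

Lemma supp_generated l : supp (@setT A) l -> generated (supp (skew A)) l.
Proof.
move=> [x [xl _] x0]; have [e eP] := exists_generators fineA.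
have : part (generated (supp (skew A))) x by case: clA => _ ->.
case/(part_extend eP) => g [xg gM]; apply: gM.
apply/negP => /negP/mcoeff_outdom gl0; apply: x0.
have := proj_extend fineA eP g l; rewrite -xg gl0 scale0r.
by rewrite (proj_id fineA eP _ xl) eqxx.
Qed.

Lemma generated_skew {l} : generated (supp (skew A)) l.
Proof.
have gl : generated (supp (@setT A)) l by case: torA => _ _ _ ->.
apply: gl; split; last exact: supp_generated.
split; first by move=> P [[]].
move=> a b ga gb P PP; case: (PP) => [[_ Pg] _].
by apply: Pg; [apply: ga | apply: gb].
Qed.

(** Multiplication by an invertible skew element translates the support. The translations [K]
    preserving it, taken in both directions to form a subgroup, contain the skew degrees and hence
    everything. *)
Lemma full_support l : exists x, comp A l x /\ x <> 0.
Proof.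
pose N : set L := [set a | supp (@setT A) a]%classic.
pose K : set L := [set a | forall m, N m -> N (m + a) /\ N (m - a)]%classic.
have N0 : N 0 by exists (aone : A); [split=> //; apply: comp1 | apply: aone_neq0].
suff KP : subgroup K /\ (supp (skew A) `<=` K)%classic.
  have [+ _] := @generated_skew l K KP 0 N0; rewrite add0r => -[x [xl _] x0].
  by exists x.
split; first split; first by move=> m; rewrite subr0 addr0.
  move=> a b Ka Kb m Nm; split.
    by rewrite addrA addrAC; case: (Kb m Nm) => _ /Ka[].
  by rewrite opprB addrA; have [/Ka[]] := Kb _ Nm.
move=> a /asboolP aS m [x [xm _] x0].
have [s hs] := sk_ex aS; have [t ht] := sk_ex (skN aS).
split; rewrite addrC.
  exists (s *a x); last by move/(hskew_mulI hs).
  by split=> //; case: hs => sa _ _; apply: compM.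
exists (t *a x); last by move/(hskew_mulI ht).
by split=> //; case: ht => ta _ _; apply: compM.
Qed.

Lemma commE l m x y : comp A l x -> comp A m y ->
  y *a x = (-1) ^+ (sk l (+) sk m (+) sk (l + m)) *: (x *a y).
Proof.
move=> xl ym; have sxy := star_comp (compM fineA xl ym).
have <- : star (star (y *a x)) = y *a x by rewrite starK.
rewrite star_anti (star_comp xl) (star_comp ym).
by case: (sk l) (sk m) (sk (l + m)) sxy => [] [] [] /= sxy;
  rewrite !(amulNl, amulNr, starN, sxy, opprK, scale1r, scaleN1r).
Qed.

Lemma skew_commE l m s t : hskew l s -> hskew m t ->
  t *a s = if sk (l + m) then - (s *a t) else s *a t.
Proof.
move=> hs ht; case: (hs) (ht) => sl _ _ [tm _ _]; rewrite (commE sl tm).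
by rewrite (hskew_sk hs) (hskew_sk ht); case: sk; rewrite ?scaleN1r ?scale1r.
Qed.

Lemma hskewM l m s t : hskew l s -> hskew m t -> sk (l + m) -> hskew (l + m) (s *a t).
Proof.
move=> hs ht; apply: comp_hskew; last by move/(hskew_mulI hs); case: ht.
by case: hs ht => ? _ _ [? _ _]; apply: compM.
Qed.

(** * Associators of skew homogeneous elements *)

Lemma asso_comp l m n x y z : comp A l x -> comp A m y -> comp A n z ->
  comp A (l + m + n) (asso x y z).
Proof.
move=> xl ym zn; apply: subspaceD; first exact: comp_subspace.
  by do 2 apply: compM => //.
rewrite -scaleN1r; apply: compZ => //; rewrite -addrA.
by do 2 apply: compM => //.
Qed.

Lemma asso_perm s t u : star s = - s -> star t = - t ->
  [/\ asso t s u = - asso s t u, asso t u s = asso s t u, asso s u t = - asso s t u,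
      asso u s t = asso s t u & asso u t s = - asso s t u].
Proof.
move=> ss st; have e1 := swap12 s u st.
have e2 : asso t u s = asso s t u.
  by apply: oppr_inj; rewrite -e1 -(swap23 t u ss).
have e3 : asso s u t = - asso s t u by rewrite (swap23 s u st) opprK.
have e4 : asso u s t = asso s t u by apply: oppr_inj; rewrite -e3 -(swap12 u t ss).
by split=> //; rewrite -e2 (swap12 u s st) opprK.
Qed.

Lemma asso_star s t u : star s = - s -> star t = - t -> star u = - u ->
  star (asso s t u) = - asso s t u.
Proof.
move=> ss st su; rewrite star_asso ss st su assoNl assoNm assoNr !opprK.
by case: (asso_perm u ss st).
Qed.

(** The involution reverses the three skew entries of an alternating associator, an odd permutation,
    so the associator is itself skew. *)
Lemma asso_neq0_sk l m n s t u : hskew l s -> hskew m t -> hskew n u ->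
  asso s t u <> 0 -> sk (l + m + n).
Proof.
case=> sl _ ss [tm _ st] [un _ su] a0; apply/asboolP; exists (asso s t u) => //.
by split; [apply: asso_comp | apply: asso_star].
Qed.

(** Alternativity gives 3(s, t, u) = (s, t, u) - (s, u, t) + (u, s, t), and in any algebra the right
    side is this expression in commutators. *)
Lemma asso3 s t u : star s = - s -> star t = - t -> star u = - u ->
  asso s t u *+ 3 = (s *a t *a u - u *a (s *a t)) - s *a (t *a u - u *a t)
                    - (s *a u - u *a s) *a t.
Proof.
move=> ss st su.
have [_ _ e1 e2 _] := asso_perm u ss st.
have -> : asso s t u *+ 3 = asso s t u - asso s u t + asso u s t.
  by rewrite e1 e2; zmod.
rewrite /asso !(amulDr, amulDl, amulNr, amulNl); zmod.
Qed.

(** [(s t) u] is skew, because the degree of a nonzero [(s, t, u)] is. *)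
Lemma asso_neq0_flip l m n s t u : hskew l s -> hskew m t -> hskew n u ->
  asso s t u <> 0 -> u *a (t *a s) = s *a t *a u.
Proof.
move=> hs ht hu a0; have slmn := asso_neq0_sk hs ht hu a0.
case: hs ht hu => sl _ ss [tm _ st] [un _ su].
have := star_comp (compM fineA (compM fineA sl tm) un); rewrite slmn.
rewrite !star_anti ss st su !(amulNl, amulNr) opprK => H; zlin H.
Qed.

(** Suppose the associator is not 0; then [u] commutes with [s *a t]. If [u] commutes with [s] and
    [t], all commutators in [asso3] vanish; if it anticommutes with both, [asso3] becomes 3(s, t, u)
    = 4(s, t, u). *)
Lemma asso_comm_same l m n s t u : hskew l s -> hskew m t -> hskew n u ->
  sk (l + m) = false -> sk (l + n) = sk (m + n) -> asso s t u = 0.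
Proof.
move=> hs ht hu lm lmn.
have := skew_commE hs ht; have := skew_commE hs hu; have := skew_commE ht hu.
rewrite lm lmn => cut cus cts.
apply/eqP/negP => /negP/eqP a0.
have fl := asso_neq0_flip hs ht hu a0.
case: (hs) (ht) (hu) => _ _ ss [_ _ st] [_ _ su].
apply: a0; have a3 := asso3 ss st su.
have [_ _ _ e4 _] := asso_perm u ss st.
rewrite cts in fl; rewrite fl in a3.
case: (sk (m + n)) cut cus a3 => cut cus; rewrite cut cus ?(subrr, amul0r, amul0l) => a3.
  have us : u *a s *a t = asso s t u + s *a t *a u.
    by rewrite -fl -e4 /asso; zmod.
  rewrite !(amulDr, amulDl, amulNr, amulNl, opprK) in a3 us.
  rewrite cus amulNl in us.
  have d : asso s t u = s *a t *a u - s *a (t *a u) by [].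
  zlin (eqD (eqD a3 (eqM 2 us)) (esym (eqM 2 d))).
by apply: (muln_inj3 three0); rewrite a3; zmod.
Qed.

Lemma teichmuller x y z w :
  x *a asso y z w + asso x y z *a w
  = asso (x *a y) z w - asso x (y *a z) w + asso x y (z *a w).
Proof. by rewrite /asso !(amulDr, amulDl, amulNr, amulNl); zmod. Qed.

Lemma asso_ss s u : star s = - s -> asso s s u = 0.
Proof.
move=> ss; apply: (muln_inj2 two0); have H := swap12 s u ss; zlin H.
Qed.

(** If the associator is not 0, the skew element [t *a u] anticommutes with both [s] and [t], so
    [asso_comm_same] gives (s, t, tu) = 0. The Teichmüller identity at (s, t, t, u) and (t, t, s, u)
    then yields t(s, t, u) = 0. *)
Lemma asso_comm_mixed l m n s t u : hskew l s -> hskew m t -> hskew n u ->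
  sk (l + m) = false -> sk (l + n) = false -> sk (m + n) -> asso s t u = 0.
Proof.
move=> hs ht hu lm ln mn.
have := skew_commE hs ht; have := skew_commE hs hu; have := skew_commE ht hu.
rewrite lm ln mn => cut cus cts.
apply/eqP/negP => /negP/eqP a0.
have hv := hskewM ht hu mn.
case: (hs) (ht) (hu) => _ _ ss [_ _ st] [_ _ su].
have [p1 p2 p3 p4 p5] := asso_perm u ss st.
have sv : sk (l + (m + n)).
  by rewrite addrA; apply: asso_neq0_sk hs ht hu a0.
(* By flexibility (tu)t = t(ut) = -t(tu), so [t] cannot commute with [t *a u]. *)
have tv : sk (m + (m + n)).
  have := skew_commE ht hv; case: sk => // H; exfalso.
  have [_ _ q3 _ _] := asso_perm u st st; rewrite asso_ss // /asso in q3.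
  have q : t *a u *a t = - (t *a (t *a u)) by rewrite -amulNr -cut; zlin q3.
  case: hu => _ u0 _; apply: u0; do 2 apply: (hskew_mulI ht).
  by apply: (muln_inj2 two0); zlin (eqD H (esym q)).
have W : asso s t (t *a u) = 0.
  by apply: (asso_comm_same hs ht hv lm); rewrite sv tv.
apply: a0; apply: (hskew_mulI ht).
have [_ _ _ r4 _] := asso_perm s st st; rewrite asso_ss // in r4.
have T1 := teichmuller s t t u; have T3 := teichmuller t t s u.
rewrite !(asso_ss, r4, amul0l, amul0r, W) // in T1 T3.
rewrite p1 amulNr (swap12 (t *a s) u st) cts in T3; rewrite (swap12 (t *a t) u ss) in T1.
zlin (eqD T1 (esym T3)).
Qed.

(** As soon as two of the elements commute, the associator vanishes by the preceding cases and
    alternation; it also vanishes if its degree is not skew. In the remaining case [u] anticommutes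
    with [s *a t], and [asso3] reads (s, t, u) = -2 s(tu). *)
Lemma skew_assoE l m n s t u : hskew l s -> hskew m t -> hskew n u ->
  s *a t *a u =
  if [&& sk (l + m), sk (l + n), sk (m + n) & sk (l + m + n)]
  then - (s *a (t *a u)) else s *a (t *a u).
Proof.
move=> hs ht hu; case: (hs) (ht) (hu) => _ _ ss [_ _ st] [_ _ su].
have [_ _ p3 _ p5] := asso_perm u ss st.
have E0 : asso s t u = 0 -> s *a t *a u = s *a (t *a u) by move/subr0_eq.
have comm l1 l2 l3 x y z : hskew l1 x -> hskew l2 y -> hskew l3 z ->
    sk (l1 + l2) = false -> asso x y z = 0.
  move=> hx hy hz l12; case l13: (sk (l1 + l3)); case l23: (sk (l2 + l3)).
  - by apply: (asso_comm_same hx hy hz); rewrite // l13 l23.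
  - case: (hx) (hy) => _ _ sx [_ _ sy].
    have [p1 _ _ _ _] := asso_perm z sx sy.
    apply: oppr_inj; rewrite -p1 oppr0.
    by apply: (asso_comm_mixed hy hx hz); rewrite // addrC.
  - exact: (asso_comm_mixed hx hy hz).
  - by apply: (asso_comm_same hx hy hz); rewrite // l13 l23.
case lm: (sk (l + m)) => /=; last exact/E0/(comm _ _ _ _ _ _ hs ht hu).
case ln: (sk (l + n)) => /=; last first.
  apply: E0; apply: oppr_inj; rewrite -p3 oppr0.
  exact: (comm _ _ _ _ _ _ hs hu ht).
case mn: (sk (m + n)) => /=; last first.
  apply: E0; apply: oppr_inj; rewrite -p5 oppr0.
  by apply: (comm _ _ _ _ _ _ hu ht hs); rewrite addrC.
case lmn: (sk (l + m + n)); last first.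
  apply: E0; apply/eqP/negP => /negP/eqP /(asso_neq0_sk hs ht hu).
  by rewrite lmn.
have := skew_commE hs ht; have := skew_commE hs hu; have := skew_commE ht hu.
rewrite lm ln mn => cut cus cts.
have := skew_commE (hskewM hs ht lm) hu; rewrite lmn => custt.
have := asso3 ss st su; have [_ _ _ p4 _] := asso_perm u ss st.
rewrite custt cut cus !(amulDr, amulDl, amulNr, amulNl, opprK) => a3.
have us : - (s *a u *a t) = asso s t u - s *a t *a u.
  by rewrite -amulNl -cus -custt -p4 /asso; zmod.
have d : asso s t u = s *a t *a u - s *a (t *a u) by [].
zlin (eqD (eqD a3 (eqM 2 us)) (esym d)).
Qed.

(** The involution sends (st)u to -u(st). As [s] and [t] commute, no associator intervenes, and
    moving [u] across [s *a t] costs the product of its signs with [s] and [t]. *)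
Lemma sk_add3 l m n : sk l -> sk m -> sk n -> sk (l + m) = false ->
  sk (l + m + n) = ~~ (sk (l + n) (+) sk (m + n)).
Proof.
move=> /sk_ex[s hs] /sk_ex[t ht] /sk_ex[u hu] lm.
case: (hs) (ht) (hu) => sl _ ss [tm t0 st] [un _ su].
have := skew_commE hs ht; have := skew_commE hs hu; have := skew_commE ht hu.
rewrite lm => cut cus cts.
have P0 : s *a t *a u <> 0 by move/(hskew_mulIr hu)/(hskew_mulI hs).
have := star_comp (compM fineA (compM fineA sl tm) un).
rewrite !star_anti ss st su !(amulNl, amulNr) opprK cts.
have -> : u *a (s *a t) = (-1) ^+ (sk (l + n) (+) sk (m + n)) *: (s *a t *a u).
  have := skew_assoE hu hs ht; rewrite lm !andbF => <-.
  have -> : s *a t *a u = s *a (t *a u).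
    by have := skew_assoE hs ht hu; rewrite lm.
  have := skew_assoE hs hu ht; rewrite lm !andbF /=.
  rewrite cus cut; case: (sk (l + n)); case: (sk (m + n)) => /= H;
  by rewrite ?(amulNl, amulNr) ?H ?(amulNl, amulNr) ?opprK ?scaleN1r ?scale1r.
have contra : s *a t *a u <> - (s *a t *a u).
  move=> H; apply: P0; apply: (muln_inj2 two0); zlin H.
case: (sk (l + m + n)); case: (_ (+) _); rewrite ?scaleN1r ?scale1r ?opprK // => H;
  by case: contra; zlin H.
Qed.

(** The set [M] of such degrees is stable under adding a skew [b]. For commuting [m], [n], the sum
    is skew by [sk_add3] if [b] has the same sign with both; otherwise [b] is added to the summand
    with which it anticommutes, and the new pair commutes. *)
Lemma sk_span l : sk l \/ exists m n, [/\ sk m, sk n, sk (m + n) = false & l = m + n].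
Proof.
pose M := [set l | sk l \/ exists m n, [/\ sk m, sk n, sk (m + n) = false & l = m + n]]%classic.
have MD a b : M a -> sk b -> M (a + b).
  case=> [sa|[m [n [sm sn mn ->]]]] sb.
    by case ab: (sk (a + b)); [left | right; exists a, b].
  have := sk_add3 sm sn sb mn.
  case mb: (sk (m + b)) => /=.
    case nb: (sk (n + b)) => /= H; first by left.
    by right; exists (m + b), n; split; rewrite // addrAC.
  case nb: (sk (n + b)) => /= H; last by left.
  by right; exists m, (n + b); split; rewrite // addrA.
have M0 : M 0.
  have [[a aS] _] := clA; have {aS}sa : sk a by apply/asboolP.
  by right; exists a, (- a); rewrite subrr sk0; split=> //; apply: skN.
pose K : set L := [set a | forall m, M m -> M (m + a) /\ M (m - a)]%classic.
suff : generated (supp (skew A)) l.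
  suff KP : subgroup K /\ (supp (skew A) `<=` K)%classic.
    by move=> gl; have /= [] := gl _ KP 0 M0; rewrite add0r.
  split; last first.
    move=> a aS m Mm; have sa : sk a by apply/asboolP.
    by split; [apply: MD Mm sa | apply: MD Mm (skN sa)].
  split; first by move=> m; rewrite subr0 addr0.
  move=> a b Ka Kb m Mm; split.
    by rewrite addrA addrAC; case: (Kb m Mm) => _ /Ka[].
  by rewrite opprB addrA; have [/Ka[]] := Kb _ Mm.
exact: (@generated_skew l).
Qed.

(** By [sk_span] a homogeneous [x] is a multiple of a skew element or of a product of two commuting
    ones; the latter is the case of [asso_commuting]. *)
Lemma asso_comm l m s t x : hskew l s -> hskew m t -> sk (l + m) = false ->
  asso s t x = 0.
Proof.
move=> hs ht lm; case: (hs) (ht) => _ _ ss [_ _ st].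
have cts := skew_commE hs ht; rewrite lm in cts.
have skew0 n u : hskew n u -> asso s t u = 0.
  by move=> hu; have := skew_assoE hs ht hu; rewrite lm /asso => ->; rewrite subrr.
have [e eP] := exists_generators fineA.
move: x; apply: (comp_ind fineA eP).
  apply: (@subspace_eq F A A (asso s t) (fun => 0)) => c u v.
    by rewrite assoDr assoZr.
  by rewrite scaler0 addr0.
move=> n x xn; have [->|/eqP x0] := eqVneq x 0.
  by rewrite /asso !amul0r subrr.
have [sn|[a [b [sa sb ab nab]]]] := sk_span n.
  exact/skew0/(comp_hskew xn).
have [u hu] := sk_ex sa; have [v hv] := sk_ex sb.
case: (hu) (hv) => ua u0 su [vb _ sv].
have uv0 : u *a v <> 0 by move/(hskew_mulIr hv).
rewrite nab in xn; have [k ->] := comp_line (compM fineA ua vb) uv0 xn.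
have cvu := skew_commE hu hv; rewrite ab in cvu.
have := asso_commuting two0 three0 strA ss st (esym cts) su sv (esym cvu).
move=> /(_ (skew0 _ _ hu) (skew0 _ _ hv)) e0.
by rewrite /asso !amulZr -scalerBr -/(asso s t (u *a v)) e0 scaler0.
Qed.

Lemma amul_neq0 l m x y : comp A l x -> comp A m y -> x <> 0 -> y <> 0 -> x *a y <> 0.
Proof.
move=> xl ym x0 y0; have [sl|[a [b [sa sb ab lab]]]] := sk_span l.
  by move/(hskew_mulI (comp_hskew xl x0 sl)).
have [u hu] := sk_ex sa; have [v hv] := sk_ex sb.
have [ua _ _] := hu; have [vb _ _] := hv.
have uv0 : u *a v <> 0 by move/(hskew_mulIr hv); case: hu.
rewrite lab in xl; have [k kx] := comp_line xl x0 (compM fineA ua vb).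
move=> xy0; apply: y0; apply: (hskew_mulI hv); apply: (hskew_mulI hu).
have := asso_comm y hu hv ab; rewrite /asso => /subr0_eq <-.
by rewrite kx amulZl xy0 scaler0.
Qed.

End Torus.

(** * A torus is determined by its skew degrees *)

Section Coboundary.
Variables (F : fieldType) (L : zmodType) (d : L -> L -> F).
Hypotheses (freeL : free_abelian_finite_rank L) (d0 : forall l m, d l m != 0)
  (dC : forall l m, d l m = d m l)
  (dA : forall l m n, d l m * d (l + m) n = d m n * d l (m + n)).

(** The group of homogeneous units of the commutative twisted group algebra of
    [L] defined by [d]; as [L] is free, its projection onto [L] splits. *)
Let E := {p : F * L | p.1 != 0}.
#[local] HB.instance Definition _ := Choice.copy E {p : F * L | p.1 != 0}.

Let addE_subproof (x y : E) :
  ((val x).1 * (val y).1 * d (val x).2 (val y).2, (val x).2 + (val y).2).1 != 0.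
Proof. by rewrite /= !mulf_neq0 ?(valP x) ?(valP y). Qed.

(** The cocycle is not normalized, so the neutral element has first component [(d 0 0)^-1]. *)
Let zeroE_subproof : ((d 0 0)^-1, 0 : L).1 != 0.
Proof. by rewrite /= invr_neq0. Qed.

Let oppE_subproof (x : E) :
  (((val x).1 * d (val x).2 (- (val x).2) * d 0 0)^-1, - (val x).2).1 != 0.
Proof. by rewrite /= invr_neq0 // !mulf_neq0 ?(valP x). Qed.

Let addE x y : E := exist (fun p : F * L => p.1 != 0) _ (addE_subproof x y).
Let zeroE : E := exist (fun p : F * L => p.1 != 0) _ zeroE_subproof.
Let oppE x : E := exist (fun p : F * L => p.1 != 0) _ (oppE_subproof x).

Let addEA : associative addE.
Proof.
move=> [[a l] /= a0] [[b m] /= b0] [[c n] /= c0]; apply: val_inj => /=.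
congr pair; last exact: addrA.
by transitivity (a * b * c * (d m n * d l (m + n))); [ring | rewrite -dA; ring].
Qed.

Let addEC : commutative addE.
Proof.
move=> [[a l] /= a0] [[b m] /= b0]; apply: val_inj => /=.
by rewrite dC [a * b]mulrC addrC.
Qed.

Let d0l l : d 0 l = d 0 0.
Proof. by have := dA 0 0 l; rewrite !add0r => /(mulIf (d0 0 l))/esym. Qed.

Let add0E : left_id zeroE addE.
Proof.
move=> [[b m] /= b0]; apply: val_inj => /=.
by rewrite add0r d0l mulrAC mulVf // mul1r.
Qed.

Let addNE : left_inverse zeroE oppE addE.
Proof.
move=> [[b m] /= b0]; apply: val_inj => /=; rewrite addNr; congr pair.
by rewrite dC; field; rewrite b0 !d0.
Qed.

Lemma symmetric_cocycle_coboundary : exists2 f : L -> F, forall l, f l != 0 &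
  forall l m, f (l + m) = f l * f m * d l m.
Proof.
pose G : zmodType := HB.pack E (GRing.isZmodule.Build E addEA addEC add0E addNE).
have pi2D (x y : G) : (val (x + y : G)).2 = (val x).2 + (val y).2 by [].
pose pi2 : G -> L := fun x => (val x).2.
have pi2_zmod : zmod_morphism pi2.
  by move=> x y; apply: (addIr (pi2 y)); rewrite -[LHS]pi2D !subrK.
pose pi2a : {additive G -> L} := HB.pack pi2 (GRing.isZmodMorphism.Build G L pi2 pi2_zmod).
have [n [th [th' thK thK']]] := freeL.
have one0 (l : L) : ((1, l) : F * L).1 != 0 by exact: oner_neq0.
(* The basis vectors of the free group are lifted with coefficient 1 and the lift is extended
   additively; [f] is its first component. *)
pose g i : G := exist (fun p : F * L => p.1 != 0) _ (one0 (th (delta_mx 0 i))).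
pose H (k : 'rV[int]_n) : G := \sum_i g i *~ k 0 i.
have HD k k' : H (k + k') = H k + H k'.
  by rewrite /H -big_split; apply: eq_bigr => i _; rewrite mxE mulrzDr.
have pi2H k : pi2 (H k) = th k.
  rewrite -[pi2 _]/(pi2a _) raddf_sum [in RHS](row_sum_delta k) raddf_sum.
  apply: eq_bigr => i _; rewrite raddfMz /= -[pi2 _]/(th (delta_mx 0 i)).
  by rewrite -raddfMz; congr (th _); rewrite -[in RHS](intz (k 0 i)) scaler_int.
pose s l := H (th' l).
have s2 l : (val (s l)).2 = l by rewrite -[LHS]/(pi2 (s l)) pi2H thK'.
exists (fun l => (val (s l)).1); first by move=> l; exact: valP (s l).
move=> l m; have -> : s (l + m) = s l + s m.
  by rewrite /s -HD; congr H; apply: (can_inj thK); rewrite raddfD /= !thK'.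
have -> : (val (s l + s m)).1 =
  (val (s l)).1 * (val (s m)).1 * d (val (s l)).2 (val (s m)).2 by [].
by rewrite !s2.
Qed.

End Coboundary.

(** By [commE] this is the exponent of the sign with which homogeneous elements commute. If [sk] is
    a quadratic form it is the polar form. *)
Definition comm_sign (L : zmodType) (sk : L -> bool) (l m : L) : bool :=
  sk l (+) sk m (+) sk (l + m).

Definition octonionic (L : zmodType) (sk : L -> bool) (l m n : L) : bool :=
  [&& sk (l + m), sk (l + n), sk (m + n) & sk (l + m + n)].

(** Properties of the function [al] defined by [(x y) z = al x (y z)] for
    homogeneous [x], [y], [z], given the set [sk] of skew degrees. *)
Record associator_laws (F : fieldType) (L : zmodType) (sk : L -> bool)
    (al : L -> L -> L -> F) : Prop := AssociatorLaws {
  al_neq0 : forall l m n, al l m n != 0;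
  al_cocycle : forall l m n p,
    al (l + m) n p * al l m (n + p) = al l m n * al l (m + n) p * al m n p;
  al_comm : forall s t l, sk s -> sk t -> sk (s + t) = false ->
    [/\ al s t l = 1, al s l t = 1 & al l s t = 1];
  al_anti : forall s t l, sk s -> sk t -> sk (s + t) -> al s t l = al t s l;
  al_skew : forall s t u, sk s -> sk t -> sk u ->
    al s t u = (-1) ^+ octonionic sk s t u;
  al_swap : forall s t l, sk s -> sk t ->
    al s l t - 1 = (-1) ^+ comm_sign sk t l * (1 - al s t l);
  al_rev : forall l m n, al l m n * al n m l = 1
}.

Definition skew_spanning (L : zmodType) (sk : L -> bool) : Prop :=
  forall l, sk l \/ exists m n, [/\ sk m, sk n, sk (m + n) = false & l = m + n].

(** In the cocycle law an associator with two commuting skew degrees in neighbouring places is 1, so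
    an argument that is a sum of two such degrees can be split. The arguments are thus freed from
    being skew one after another; [al_swap] and [al_rev] carry the free argument to the other
    places. *)
Lemma associator_unique (F : fieldType) (L : zmodType) (sk : L -> bool)
    (al al' : L -> L -> L -> F) : skew_spanning sk ->
  associator_laws sk al -> associator_laws sk al' ->
  forall l m n, al l m n = al' l m n.
Proof.
move=> span H H'.
have inj a b c : a * b = 1 -> a * c = 1 -> b = c :> F.
  move=> ab ac; have a0 : a != 0.
    by apply/eqP => a0; move: ab; rewrite a0 mul0r => /esym/eqP; rewrite oner_eq0.
  by apply: (mulfI a0); rewrite ab ac.
have ll_sum (be : L -> L -> L -> F) s t u v : associator_laws sk be ->
    sk s -> sk t -> sk u -> sk v -> sk (u + v) = false ->
    be s t (u + v) = be s t u * be s (t + u) v.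
  move=> B ss st su sv uv; have := al_cocycle B s t u v.
  have [_ _ ->] := al_comm B (s + t) su sv uv.
  by have [_ _ ->] := al_comm B t su sv uv; rewrite mul1r mulr1.
have E1 s t l : sk s -> sk t -> al s t l = al' s t l.
  move=> ss st; case: (span l) => [sl|[u [v [su sv uv ->]]]].
    by rewrite (al_skew H) // (al_skew H').
  case stE: (sk (s + t)); last first.
    have [-> _ _] := al_comm H (u + v) ss st stE.
    by have [-> _ _] := al_comm H' (u + v) ss st stE.
  (* After splitting, the factor with middle argument [b + u] is known in two cases: it is 1 if [a]
     and [v] commute, and it is given by [al_skew] if [b + u] is skew. *)
  have main a b : sk a -> sk b -> sk (a + v) = false \/ sk (b + u) ->
      al a b (u + v) = al' a b (u + v).
    move=> sa sb ab; rewrite !ll_sum // (al_skew H) // (al_skew H') //.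
    congr (_ * _); case: ab => [av|bu]; last by rewrite (al_skew H) // (al_skew H').
    have [_ -> _] := al_comm H (b + u) sa sv av.
    by have [_ -> _] := al_comm H' (b + u) sa sv av.
  have main' a b : sk a -> sk b -> sk (a + u) = false \/ sk (b + v) ->
      al a b (u + v) = al' a b (u + v).
    move=> sa sb ab; rewrite [u + v]addrC !ll_sum //; [|by rewrite addrC..].
    rewrite (al_skew H) // (al_skew H') //.
    congr (_ * _); case: ab => [av|bu]; last by rewrite (al_skew H) // (al_skew H').
    have [_ -> _] := al_comm H (b + v) sa su av.
    by have [_ -> _] := al_comm H' (b + v) sa su av.
  (* If [s] and [v] do not commute, [s + v] is skew; exchanging [s] and [t] brings it to the
     middle. *)
  case sv': (sk (s + v)); last by apply: main => //; left.
  rewrite (al_anti H) // (al_anti H') //.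
  by apply: main' => //; right.
have E2 s t l : sk s -> sk t -> al s l t = al' s l t.
  move=> ss st; apply: (addIr (-1)); rewrite (al_swap H) // (al_swap H') //.
  by rewrite E1.
have E1' s t l : sk s -> sk t -> al l s t = al' l s t.
  move=> ss st; apply: (inj (al t s l)); first exact: al_rev H _ _ _.
  by rewrite E1 //; apply: al_rev H' _ _ _.
have E3 s l n : sk s -> al s l n = al' s l n.
  move=> ss; case: (span n) => [sn|[w [r [sw sr wr ->]]]]; first exact: E2.
  have F3 (be : L -> L -> L -> F) : associator_laws sk be ->
      be s l (w + r) = be s l w * be s (l + w) r.
    move=> B; have := al_cocycle B s l w r.
    have [_ _ ->] := al_comm B (s + l) sw sr wr.
    by have [_ _ ->] := al_comm B l sw sr wr; rewrite mul1r mulr1.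
  by rewrite (F3 _ H) (F3 _ H') !E2.
move=> l m n; case: (span l) => [sl|[s [t [ss st stE ->]]]]; first exact: E3.
apply: (mulIf (al_neq0 H s t (m + n))); rewrite (al_cocycle H) !E3 //.
by rewrite -(al_cocycle H').
Qed.

(** * Structure constants of a torus *)

Definition al_of (F : fieldType) (L : zmodType) (c : L -> L -> F) (l m n : L) : F :=
  c l m * c (l + m) n / (c m n * c l (m + n)).

Section StructureConstants.
Variables (F : fieldType) (A : galg F).
Hypotheses (two0 : 2%:R != 0 :> F) (three0 : 3%:R != 0 :> F).
Hypothesis torA : structurable_torus A.
Hypothesis clA : class_I A.
Local Notation L := (grp A).
Local Notation skA := (@sk F A).

Let fineA : finely_graded A. Proof. by case: torA. Qed.
Let comp_line := comp_line torA.

Lemma structure_constants : exists (b : L -> A) (c : L -> L -> F),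
  [/\ forall l x, comp A l x <-> exists k, x = k *: b l, forall l, b l <> 0,
      forall l m, b l *a b m = c l m *: b (l + m) & forall l m, c l m != 0].
Proof.
pose b l := projT1 (cid (full_support two0 three0 torA clA l)).
have [bc b0] : (forall l, comp A l (b l)) /\ (forall l, b l <> 0).
  by split=> l; rewrite /b; case: cid => ? [].
have cP l m : exists k, b l *a b m = k *: b (l + m).
  by apply: comp_line (bc _) (b0 _) _; apply: compM.
exists b, (fun l m => projT1 (cid (cP l m))); split=> //.
- move=> l x; split; first exact: comp_line (bc l) (b0 l).
  by case=> k ->; apply: compZ.
- by move=> l m; case: cid.
move=> l m; case: cid => k /= ek; apply/eqP => k0.
have := amul_neq0 two0 three0 torA clA (bc l) (bc m) (b0 l) (b0 m).
by rewrite ek k0 scale0r.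
Qed.

Variables (b : L -> A) (c : L -> L -> F).
Hypotheses (bP : forall l x, comp A l x <-> exists k, x = k *: b l)
  (b0 : forall l, b l <> 0)
  (bM : forall l m, b l *a b m = c l m *: b (l + m))
  (c0 : forall l m, c l m != 0).

Let al := al_of c.

Let bc l : comp A l (b l).
Proof. by apply/bP; exists 1; rewrite scale1r. Qed.

Let scale_inj (k k' : F) (x : A) : x <> 0 -> k *: x = k' *: x -> k = k'.
Proof.
move=> x0 /eqP; rewrite -subr_eq0 -scalerBl scaler_eq0 subr_eq0.
by case/orP => [/eqP|/eqP].
Qed.

Let bbb0 l m n : b l *a (b m *a b n) <> 0.
Proof.
rewrite bM amulZr bM scalerA => /eqP; rewrite scaler_eq0 !mulf_eq0.
by rewrite !(negbTE (c0 _ _)) /= => /eqP/b0.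
Qed.

Lemma al_ofE l m n : b l *a b m *a b n = al l m n *: (b l *a (b m *a b n)).
Proof.
rewrite !(bM, amulZl, amulZr) !scalerA addrA; congr (_ *: _).
rewrite /al /al_of; field; by rewrite !c0.
Qed.

Lemma star_b l : star (b l) = (-1) ^+ sk l *: b l.
Proof.
by rewrite (star_comp torA (bc l)); case: sk; rewrite ?scaleN1r ?scale1r.
Qed.

Lemma c_comm l m : c m l = (-1) ^+ comm_sign skA l m * c l m.
Proof.
apply: (scale_inj (@b0 (l + m))); rewrite -scalerA -bM addrC -bM.
exact: commE.
Qed.

Let skew_b l : sk l -> hskew l (b l).
Proof. by move=> sl; apply: comp_hskew. Qed.

Let asso_b l m n : asso (b l) (b m) (b n) = (al l m n - 1) *: (b l *a (b m *a b n)).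
Proof. by rewrite /asso al_ofE scalerBl scale1r. Qed.

Lemma torus_associator_laws : associator_laws skA al.
Proof.
have al1 l m n : asso (b l) (b m) (b n) = 0 -> al l m n = 1.
  by rewrite asso_b => /eqP; rewrite scaler_eq0 subr_eq0 => /orP[/eqP|/eqP/bbb0].
have strA : structurable A by case: torA.
have starb l : sk l -> star (b l) = - b l by case/skew_b.
split.
- by move=> l m n; rewrite !mulf_neq0 ?invr_neq0 // mulf_neq0.
- by move=> l m n p; rewrite /al /al_of !addrA; field; rewrite !c0.
- move=> s t l ss st stE; have hs := skew_b ss; have ht := skew_b st.
  have e := asso_comm two0 three0 torA clA (b l) hs ht stE.
  have [_ _ e1 e2 _] := asso_perm two0 three0 torA (b l) (starb _ ss) (starb _ st).
  by split; apply: al1 => //; rewrite ?e1 ?e2 e ?oppr0.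
- move=> s t l ss st stE; have hs := skew_b ss; have ht := skew_b st.
  have cts := skew_commE torA hs ht; rewrite stE in cts.
  have e1 := asso_swap12 two0 three0 strA (b t) (b l) (starb _ ss).
  have e2 : b t *a b s *a b l = - (b s *a b t *a b l) by rewrite cts amulNl.
  have e3 : b t *a (b s *a b l) = - (b s *a (b t *a b l)).
    by rewrite /asso in e1; zlin (eqD e1 (esym e2)).
  apply: (scale_inj (@bbb0 s t l)); rewrite -al_ofE.
  by apply: oppr_inj; rewrite -e2 al_ofE e3 scalerN.
- move=> s t u ss st su.
  have := skew_assoE two0 three0 torA clA (skew_b ss) (skew_b st) (skew_b su).
  rewrite -/(octonionic skA s t u) al_ofE => H.
  apply: (scale_inj (@bbb0 s t u)); rewrite H; case: octonionic;
  by rewrite ?scaleN1r ?scale1r.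
- move=> s t l ss st.
  have := asso_swap23 two0 three0 strA (b s) (b l) (starb _ st).
  rewrite !asso_b (commE torA (bc t) (bc l)) -/(comm_sign skA t l) amulZr scalerA.
  rewrite -scaleNr => /(scale_inj (@bbb0 s t l)) e.
  by rewrite -[1 - al s t l]opprB e opprK mulrC -mulrA -signr_addb addbb mulr1.
(* The involution reverses the factors in the equation that defines [al l m n], and the signs it
   puts on the three elements cancel. *)
move=> l m n; have /(congr1 star) := al_ofE l m n; rewrite starZ !star_anti !star_b.
rewrite !(amulZl, amulZr) !scalerA al_ofE scalerA => H.
pose k : F := (-1) ^+ sk l * (-1) ^+ sk m * (-1) ^+ sk n.
have k0 : k != 0 by rewrite !mulf_neq0 ?signr_eq0.
move/(scale_inj (@bbb0 n m l)): H => H.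
apply: (mulfI k0); rewrite mulr1 /k.
transitivity (al l m n * (-1) ^+ sk l * (-1) ^+ sk n * (-1) ^+ sk m * al n m l).
  by ring.
by rewrite -H; ring.
Qed.

End StructureConstants.

(** * The isomorphism between tori with the same skew degrees *)

Section Isomorphism.
Variables (F : fieldType) (A B : galg F).
Hypotheses (two0 : 2%:R != 0 :> F) (three0 : 3%:R != 0 :> F).
Hypotheses (torA : structurable_torus A) (clA : class_I A).
Hypotheses (torB : structurable_torus B) (clB : class_I B).
Variables (th : {additive grp A -> grp B}) (th' : grp B -> grp A).
Hypotheses (thK : cancel th th') (thK' : cancel th' th).
Hypothesis skE : forall l, sk l = sk (th l).
Hypothesis freeA : free_abelian_finite_rank (grp A).

Let fineA : finely_graded A. Proof. by case: torA. Qed.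
Let fineB : finely_graded B. Proof. by case: torB. Qed.

Lemma span_torus : skew_spanning (@sk F A).
Proof. by move=> l; apply: (sk_span two0 three0 torA clA). Qed.

Theorem isograded_of_skew : isograded A B.
Proof.
have [b [c [bP b0 bM c0]]] := structure_constants two0 three0 torA clA.
have [b' [c' [bP' b0' bM' c0']]] := structure_constants two0 three0 torB clB.
have lawA := torus_associator_laws two0 three0 torA clA bP b0 bM c0.
have lawB := torus_associator_laws two0 three0 torB clB bP' b0' bM' c0'.
pose cB l m := c' (th l) (th m).
have lawB' : associator_laws (@sk F A) (al_of cB).
  have E l m n : al_of cB l m n = al_of c' (th l) (th m) (th n).
    by rewrite /al_of /cB !raddfD.
  split.
  - by move=> l m n; rewrite E; apply: al_neq0 lawB _ _ _.
  - by move=> l m n p; rewrite !E !raddfD; apply: al_cocycle lawB _ _ _ _.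
  - by move=> s t l; rewrite !skE !E raddfD; apply: al_comm lawB _ _ _.
  - by move=> s t l; rewrite !skE !E raddfD; apply: al_anti lawB _ _ _.
  - move=> s t u; rewrite !skE !E /octonionic !skE !raddfD; exact: al_skew lawB _ _ _.
  - move=> s t l; rewrite !skE !E /comm_sign !skE !raddfD; exact: al_swap lawB _ _ _.
  - by move=> l m n; rewrite !E; apply: al_rev lawB _ _ _.
have alE := associator_unique span_torus lawA lawB'.
(* Equal commutation signs make [d] symmetric; equal associators make it a cocycle. *)
pose d l m := cB l m / c l m.
have cB0 l m : cB l m != 0 by apply: c0'.
have d0 l m : d l m != 0 by rewrite mulf_neq0 ?invr_neq0.
have dC l m : d l m = d m l.
  rewrite /d /cB (c_comm torA bP b0 bM m l) (c_comm torB bP' b0' bM' (th m) (th l)).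
  rewrite /comm_sign !skE raddfD.
  by set e := (-1) ^+ _; field; rewrite c0 signr_eq0.
have dA l m n : d l m * d (l + m) n = d m n * d l (m + n).
  have /eqP := alE l m n; rewrite /al_of eqr_div ?mulf_neq0 //.
  move=> /eqP e; rewrite /d !mulf_div; apply/eqP; rewrite eqr_div ?mulf_neq0 //.
  by apply/eqP; rewrite -e mulrC.
have [f f0 fM] := symmetric_cocycle_coboundary freeA d0 dC dA.
have coordE (C : galg F) (fineC : finely_graded C) (e : grp C -> C)
    (eP : forall l x, comp C l x <-> exists k, x = k *: e l) (e0 : forall l, e l <> 0) g :
    coord fineC eP (extend e g) = g.
  apply/malgP => l; have := proj_extend fineC eP g l; rewrite /proj => /eqP.
  by rewrite -subr_eq0 -scalerBl scaler_eq0 subr_eq0 => /orP[/eqP|/eqP/e0].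
pose phi x := extend (fun l => f l *: b' (th l)) (coord fineA bP x).
pose psi y := extend (fun m => (f (th' m))^-1 *: b (th' m)) (coord fineB bP' y).
have phi_lin : linear phi.
  move=> k x y; rewrite /phi -extend_linear; congr extend.
  by rewrite -[in LHS](coordK fineA bP x) -[in LHS](coordK fineA bP y) -extend_linear coordE.
have psi_lin : linear psi.
  move=> k x y; rewrite /psi -extend_linear; congr extend.
  by rewrite -[in LHS](coordK fineB bP' x) -[in LHS](coordK fineB bP' y) -extend_linear coordE.
pose phiL : {linear A -> B} := HB.pack phi (GRing.isLinear.Build F A B *:%R phi phi_lin).
have phi_b l : phi (b l) = f l *: b' (th l).
  by rewrite /phi -[b l](extendU b) coordE // extendU.
have psi_b m : psi (b' m) = (f (th' m))^-1 *: b (th' m).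
  by rewrite /psi -[b' m](extendU b') coordE // extendU.
have phiZ k x : phi (k *: x) = k *: phi x by rewrite -[phi]/(phiL : _ -> _) linearZ.
have psiZ k y : psi (k *: y) = k *: psi y.
  have p0 : psi 0 = 0 by have := psi_lin (-1) 0 0; rewrite !scaleN1r !addNr.
  by rewrite -[k *: y]addr0 psi_lin p0 addr0.
have phiK : cancel phi psi.
  apply: (comp_ind fineA bP).
    by apply: subspace_eq => k u v //; rewrite phi_lin psi_lin.
  move=> l x /bP[k ->]; rewrite phiZ phi_b !psiZ psi_b thK !scalerA.
  by rewrite mulfK.
have psiK : cancel psi phi.
  apply: (comp_ind fineB bP').
    by apply: subspace_eq => k u v //; rewrite psi_lin phi_lin.
  move=> m y /bP'[k ->]; rewrite psiZ psi_b !phiZ phi_b thK' !scalerA.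
  by rewrite mulfVK.
have phiM x y : phi (x *a y) = phi x *a phi y.
  move: x; apply: (comp_ind fineA bP).
    apply: subspace_eq => k u v; first by rewrite amulDl amulZl phi_lin.
    by rewrite phi_lin amulDl amulZl.
  move=> l x /bP[k ->]; move: y; apply: (comp_ind fineA bP).
    apply: subspace_eq => j u v; first by rewrite amulDr amulZr phi_lin.
    by rewrite phi_lin amulDr amulZr.
  move=> m y /bP[j ->].
  rewrite !(amulZl, amulZr, phiZ, bM, phi_b, bM') !scalerA raddfD; congr (_ *: _).
  rewrite fM /d /cB; field; exact: c0.
have phi_star x : phi (star x) = star (phi x).
  move: x; apply: (comp_ind fineA bP).
    apply: subspace_eq => k u v; first by rewrite starD starZ phi_lin.
    by rewrite phi_lin starD starZ.
  move=> l x /bP[k ->] /=; rewrite !(starZ, phiZ) (star_b torA bP) phi_b.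
  by rewrite starZ (star_b torB bP') ?(phiZ, phi_b) skE !scalerA; congr (_ *: _); ring.
exists phiL, th; split; first by split; [exists psi | exists th'].
split=> //.
- have e x : x *a phi aone = x by rewrite -[in LHS](psiK x) -phiM amul1r psiK.
  by rewrite -[LHS]amul1l; apply: e.
move=> l; rewrite eqEsubset; split=> y.
  by case=> x /bP[k ->] <- /=; rewrite phiZ phi_b; apply/bP'; exists (k * f l); rewrite scalerA.
case/bP' => k ->; exists ((k / f l) *: b l); first by apply/bP; exists (k / f l).
by rewrite /= phiZ phi_b scalerA divfK.
Qed.

End Isomorphism.

(** * The possible sets of skew degrees *)

Section SkewDegrees.
Variables (F : fieldType) (A : galg F).
Hypotheses (two0 : 2%:R != 0 :> F) (three0 : 3%:R != 0 :> F).
Hypotheses (torA : structurable_torus A) (clA : class_I A).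
Local Notation L := (grp A).
Local Notation skA := (@sk F A).

Let fineA : finely_graded A. Proof. by case: torA. Qed.

Lemma sign_scale_inj (x : A) (i j : bool) :
  x <> 0 -> (-1) ^+ i *: x = (-1) ^+ j *: x -> i = j.
Proof.
move=> x0; have nx : x <> - x.
  by move=> H; apply: x0; apply: (muln_inj2 two0); zlin H.
case: i j => [] [] //=; rewrite scaleN1r scale1r => H; case: nx; first by rewrite H.
by [].
Qed.

(** For skew [s] of degree [a], the involution sends s(sx) to (xs)s up to the sign of [x], and (xs)s
    = s(sx). So [x] and s(sx) have the same sign, and skew degrees generate the group. *)
Lemma sk_add2 (l m : L) : skA (l + m + m) = skA l.
Proof.
pose K : set L := [set a | forall m, skA (m + a + a) = skA m]%classic.
suff KP : subgroup K /\ (supp (skew A) `<=` K)%classic.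
  exact: (@generated_skew F A torA clA m K KP l).
split; first split; first by move=> a; rewrite !addr0.
  move=> x y Kx Ky a; rewrite -(Ky (a + (x - y) + (x - y))).
  have -> : a + (x - y) + (x - y) + y + y = a + x + x by zmod.
  exact: Kx.
move=> a aS {}l; have /sk_ex[s hs] : sk a by apply/asboolP.
case: (hs) => sl _ ss.
have [x [xl x0]] := full_support two0 three0 torA clA l.
have y0 : s *a (s *a x) <> 0.
  by move/(hskew_mulI two0 three0 torA clA hs)/(hskew_mulI two0 three0 torA clA hs).
have yl : comp A (l + a + a) (s *a (s *a x)).
  by rewrite (_ : l + a + a = a + (a + l)); [exact: (compM fineA sl (compM fineA sl xl)) | zmod].
have sE z k : comp A k z -> star z = (-1) ^+ sk k *: z.
  by move/(star_comp torA) ->; case: sk; rewrite ?scaleN1r ?scale1r.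
(* As [s] commutes with itself, a skew degree [a + a] would force the square of [s] to be 0. *)
have saa : sk (a + a) = false.
  apply/negP => aa; have := skew_commE torA hs hs; rewrite aa => H.
  have [t [_ tK]] := hskew_inv two0 three0 torA clA hs.
  have ss0 : s *a s = 0 by apply: (muln_inj2 two0); zlin H.
  have [_ s0 _] := hs; by apply: s0; apply: (hskew_mulI two0 three0 torA clA hs).
have a0 := asso_comm two0 three0 torA clA x hs hs saa.
have [_ _ a1 _ _] := asso_perm two0 three0 torA x ss ss; rewrite a0 oppr0 in a1.
have e : (x *a s) *a s = s *a (s *a x).
  rewrite (commE torA sl xl) amulZl.
  have -> : s *a x *a s = s *a (x *a s) by apply: subr0_eq.
  by rewrite (commE torA sl xl) amulZr scalerA -signr_addb addbb scale1r.
apply: (sign_scale_inj y0); rewrite -(sE _ _ yl) !star_anti ss.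
by rewrite (sE _ _ xl) !(amulNl, amulNr, amulZl, amulZr) opprK e.
Qed.

(** All five associators in the cocycle law would be -1, but two stand on one side and three on the
    other. *)
Lemma no_four_octonionic (a b c d : L) :
  ~ forall i j k m : bool, [|| i, j, k | m] -> skA (a *+ i + b *+ j + c *+ k + d *+ m).
Proof.
move=> H; have [e [g [eP e0 eM g0]]] := structure_constants two0 three0 torA clA.
have law := torus_associator_laws two0 three0 torA clA eP e0 eM g0.
have S x i j k m : [|| i, j, k | m] -> x = a *+ i + b *+ j + c *+ k + d *+ m -> skA x = true.
  by move=> ? ->; apply: H.
have S0001 : skA (d) = true by apply: (S _ false false false true) => //; zmod.
have S0010 : skA (c) = true by apply: (S _ false false true false) => //; zmod.
have S0011 : skA (c + d) = true by apply: (S _ false false true true) => //; zmod.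
have S0100 : skA (b) = true by apply: (S _ false true false false) => //; zmod.
have S0101 : skA (b + d) = true by apply: (S _ false true false true) => //; zmod.
have S0110 : skA (b + c) = true by apply: (S _ false true true false) => //; zmod.
have S0111 : skA (b + c + d) = true by apply: (S _ false true true true) => //; zmod.
have S1000 : skA (a) = true by apply: (S _ true false false false) => //; zmod.
have S1001 : skA (a + d) = true by apply: (S _ true false false true) => //; zmod.
have S1010 : skA (a + c) = true by apply: (S _ true false true false) => //; zmod.
have S1011 : skA (a + c + d) = true by apply: (S _ true false true true) => //; zmod.
have S1100 : skA (a + b) = true by apply: (S _ true true false false) => //; zmod.
have S1101 : skA (a + b + d) = true by apply: (S _ true true false true) => //; zmod.
have S1110 : skA (a + b + c) = true by apply: (S _ true true true false) => //; zmod.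
have S1111 : skA (a + b + c + d) = true by apply: (S _ true true true true) => //; zmod.
have := al_cocycle law a b c d; rewrite !(al_skew law) /octonionic; rewrite ?addrA //.
rewrite !(S0001, S0010, S0011, S0100, S0101, S0110, S0111, S1000,
  S1001, S1010, S1011, S1100, S1101, S1110, S1111) /=.
rewrite !(mulrNN, mulr1, mulrN1) => /eqP.
by rewrite -subr_eq0 opprK -mulr2n (negbTE two0).
Qed.

(** Without an octonionic triple the constant 1 satisfies the associator laws, so by uniqueness it
    is the associator. *)
Lemma octonionic_of_nonassociative : ~ associative_alg A ->
  exists s t u, [/\ skA s, skA t, skA u & octonionic skA s t u].
Proof.
move=> nA; have [//|none] := pselect (exists s t u, [/\ skA s, skA t, skA u & octonionic skA s t u]).
case: nA; have [e [g [eP e0 eM g0]]] := structure_constants two0 three0 torA clA.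
have law := torus_associator_laws two0 three0 torA clA eP e0 eM g0.
have law1 : associator_laws skA (fun _ _ _ => 1 : F).
  split=> //.
  - by move=> *; rewrite oner_neq0.
  - by move=> *; rewrite !mulr1.
  - move=> s t u ss st su; case o: (octonionic skA s t u) => //.
    by case: none; exists s, t, u.
  - by move=> *; rewrite subrr mulr0.
  - by move=> *; rewrite mulr1.
have al1 := associator_unique (span_torus two0 three0 torA clA) law law1.
have E (x y z : A) : asso x y z = 0.
  move: x; apply: (comp_ind fineA eP).
    apply: (@subspace_eq F A A (fun x => asso x y z) (fun => 0)) => c u v.
      by rewrite assoDl assoZl.
    by rewrite scaler0 addr0.
  move=> l x /eP[k ->]; move: y; apply: (comp_ind fineA eP).
    apply: (@subspace_eq F A A (fun y => asso (k *: e l) y z) (fun => 0)) => c u v.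
      by rewrite assoDm assoZm.
    by rewrite scaler0 addr0.
  move=> m y /eP[j ->]; move: z; apply: (comp_ind fineA eP).
    apply: (@subspace_eq F A A (asso (k *: e l) (j *: e m)) (fun => 0)) => c u v.
      by rewrite assoDr assoZr.
    by rewrite scaler0 addr0.
  move=> n z /eP[i ->].
  by rewrite assoZl assoZm assoZr /asso (al_ofE eM g0) al1 scale1r subrr !scaler0.
by move=> x y z; apply: subr0_eq; rewrite -opprB -[X in - X]/(asso x y z) E oppr0.
Qed.

Lemma comm_sign_additive (l m n : L) : associative_alg A ->
  comm_sign skA (l + m) n = comm_sign skA l n (+) comm_sign skA m n.
Proof.
move=> assA; have [x [xl x0]] := full_support two0 three0 torA clA l.
have [y [ym y0]] := full_support two0 three0 torA clA m.
have [z [zn z0]] := full_support two0 three0 torA clA n.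
have xy0 := amul_neq0 two0 three0 torA clA xl ym x0 y0.
have w0 := amul_neq0 two0 three0 torA clA (compM fineA xl ym) zn xy0 z0.
apply: (sign_scale_inj w0); rewrite -(commE torA (compM fineA xl ym) zn).
rewrite assA (commE torA xl zn) amulZl -assA (commE torA ym zn) amulZr assA scalerA.
by rewrite -signr_addb.
Qed.

End SkewDegrees.

(** * Parities and splittings of free abelian groups *)

Definition oddz (k : int) : bool := odd `|k|%N.

Lemma oddzE k : (k%:~R : 'F_2) = (oddz k)%:R.
Proof.
have natE n : (n%:R : 'F_2) = (odd n)%:R.
  elim: n => // n IH; rewrite -natr1 IH /=.
  by case: odd; apply: val_inj.
case: (intP k) => [|n|n]; rewrite /oddz.
- by [].
- exact: (natE n.+1).
rewrite mulrNz abszN [n.+1%:~R](natE n.+1).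
by case: odd; apply: val_inj.
Qed.

Lemma F2_bool_inj (i j : bool) : (i%:R : 'F_2) = j%:R -> i = j.
Proof. by case: i j => [] []. Qed.

Lemma oddzD k l : oddz (k + l) = oddz k (+) oddz l.
Proof.
apply: F2_bool_inj; rewrite -oddzE rmorphD /= !oddzE.
by case: (oddz k); case: (oddz l); apply: val_inj.
Qed.

Lemma oddzM k l : oddz (k * l) = oddz k && oddz l.
Proof. by rewrite /oddz abszM oddM. Qed.

Lemma oddzN k : oddz (- k) = oddz k.
Proof. by rewrite /oddz abszN. Qed.

Lemma oddz_even k : oddz k = false -> exists l, k = l *+ 2.
Proof.
move=> ke; have /dvdzP[q ->] : (2 %| k)%Z by rewrite dvdzE dvdn2 -[odd _]/(oddz k) ke.
by exists q; rewrite mulr2n; ring.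
Qed.

(** The inverse is kept as data so that coordinate changes can be given by explicit formulas and
    composed. *)
Record ziso (L M : zmodType) := Ziso {
  zfun :> L -> M;
  zinv : M -> L;
  zfunD : forall x y, zfun (x + y) = zfun x + zfun y;
  zfunK : cancel zfun zinv;
  zinvK : cancel zinv zfun
}.

Section Ziso.
Variables L M N P : zmodType.

Lemma zfun0 (f : ziso L M) : f 0 = 0.
Proof. by apply: (addrI (f 0)); rewrite -zfunD !addr0. Qed.

Lemma zfunB (f : ziso L M) : zmod_morphism f.
Proof. by move=> x y; apply: (addIr (f y)); rewrite -zfunD !subrK. Qed.

Lemma zinvD (f : ziso L M) x y : zinv f (x + y) = zinv f x + zinv f y.
Proof. by apply: (can_inj (zfunK f)); rewrite zfunD !zinvK. Qed.

Definition ziso_additive (f : ziso L M) : {additive L -> M} :=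
  HB.pack (zfun f) (GRing.isZmodMorphism.Build L M (zfun f) (zfunB f)).

Lemma zfunMz (f : ziso L M) x k : f (x *~ k) = f x *~ k.
Proof. exact: (raddfMz (ziso_additive f)). Qed.

Definition ziso_refl : ziso L L := @Ziso L L id id (fun _ _ => erefl) (fun=> erefl) (fun=> erefl).

Definition ziso_sym (f : ziso L M) : ziso M L := Ziso (zinvD f) (zinvK f) (zfunK f).

Lemma ziso_trans_subproof (f : ziso L M) (g : ziso M N) x y :
  g (f (x + y)) = g (f x) + g (f y).
Proof. by rewrite !zfunD. Qed.

Definition ziso_trans (f : ziso L M) (g : ziso M N) : ziso L N :=
  @Ziso L N (g \o f) (zinv f \o zinv g) (ziso_trans_subproof f g)
    (can_comp (zfunK g) (zfunK f)) (can_comp (zinvK f) (zinvK g)).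

Lemma ziso_pair_subproof (f : ziso L M) (g : ziso N P) :
  let h (x : L * N) := (f x.1, g x.2) in forall x y : L * N, h (x + y) = h x + h y.
Proof. by move=> h x y; rewrite /h /= !zfunD. Qed.

Definition ziso_pair (f : ziso L M) (g : ziso N P) : ziso (L * N)%type (M * P)%type.
Proof.
apply: (@Ziso _ _ (fun x => (f x.1, g x.2)) (fun y => (zinv f y.1, zinv g y.2))
  (ziso_pair_subproof f g)) => [[x y]|[x y]] /=; by rewrite ?zfunK ?zinvK.
Defined.

End Ziso.

(** Write the matrix of the parities in Smith normal form [K D R]. Joint surjectivity makes the
    diagonal of [D] odd, so modulo 2 it is the projection to the first [m] coordinates. As [R] is
    invertible over the integers, it is absorbed into these coordinates. *)
Lemma parity_splitting n m (L : zmodType) (f : ziso 'rV[int]_n L)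
    (p : L -> 'I_m -> bool) :
  (forall x y i, p (x + y) i = p x i (+) p y i) ->
  (forall v : 'I_m -> bool, exists x, p x =1 v) ->
  exists (r : nat) (g : ziso L ('rV[int]_m * 'rV[int]_r)%type),
    n = (m + r)%N /\ forall x i, p x i = oddz ((g x).1 0 i).
Proof.
move=> pD psurj.
pose M : 'M[int]_(n, m) := \matrix_(i, j) (p (f (delta_mx 0 i)) j)%:R.
pose red k l (X : 'M[int]_(k, l)) : 'M['F_2]_(k, l) := map_mx intr X.
have redM k l q (X : 'M[int]_(k, l)) (Y : 'M[int]_(l, q)) :
  red _ _ (X *m Y) = red _ _ X *m red _ _ Y by apply: map_mxM.
have p0 i : p 0 i = false by have := pD 0 0 i; rewrite addr0; case: (p 0 i).
have pZ x (k : int) i : p (x *~ k) i = oddz k && p x i.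
  have pn (j : nat) y : p (y *+ j) i = odd j && p y i.
    elim: j => [|j IH]; first by rewrite mulr0n p0.
    by rewrite mulrS pD IH /=; case: (odd j) (p y i) => [] [].
  have pN y : p (- y) i = p y i.
    by have := pD y (- y) i; rewrite subrr p0; case: (p y i) (p (- y) i) => [] [].
  case: (intP k) => [|j|j]; rewrite /oddz ?mulr0z ?p0 //.
    by rewrite -pmulrn pn.
  by rewrite mulrNz -pmulrn pN pn abszN.
have pE x i : p (f x) i = oddz ((x *m M) 0 i).
  rewrite [in LHS](row_sum_delta x) -[zfun f]/(ziso_additive f : _ -> _) raddf_sum.
  have psum (I : Type) (s : seq I) (G : I -> L) :
      (p (\sum_(j <- s) G j) i)%:R = \sum_(j <- s) (p (G j) i)%:R :> 'F_2.
    elim: s => [|j s IH]; first by rewrite !big_nil p0.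
    by rewrite !big_cons pD -IH; case: (p _ i) (p _ i) => [] []; apply: val_inj.
  apply: F2_bool_inj; rewrite psum -oddzE mxE rmorph_sum; apply: eq_bigr => j _ /=.
  rewrite -[x 0 j in LHS]intz scaler_int zfunMz pZ rmorphM /= [_%:~R]oddzE mxE.
  by case: (oddz _) (p _ i) => [] []; apply: val_inj.
have [K KU [R RU [d _ MKR]]] := int_Smith_normal_form M.
pose D : 'M[int]_(n, m) := \matrix_(i, j) (d`_i *+ (i == j :> nat)).
have redE x i : (p (f x) i)%:R = red _ _ (x *m M) 0 i by rewrite mxE oddzE pE.
have redR : red _ _ R \in unitmx.
  by rewrite unitmxE det_map_mx rmorph_unit // -unitmxE.
have dodd (i : 'I_m) : (i < n)%N /\ oddz d`_i.
  (* With the parities of row [i] of [R], the vector [x K D] is the [i]-th unit vector modulo 2;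
     this forces [i < n] and an odd entry. *)
  have [x px] := psurj (fun j => oddz (R i j)).
  have : red _ _ (zinv f x *m K *m D) = delta_mx 0 i.
    apply: (can_inj (mulmxK redR)); rewrite -redM -rowE -!mulmxA [K *m _]mulmxA -MKR;
    apply/rowP => j; rewrite -redE zinvK px -oddzE.
    by rewrite !mxE.
  move/rowP/(_ i); rewrite !mxE eqxx /= rmorph_sum /= => e.
  have lt_in : (i < n)%N.
    rewrite ltnNge; apply/negP => ni; move/eqP: e; rewrite big1 => [|j _].
      by rewrite eqxx.
    rewrite !mxE; case: eqP => [ji|_]; last by rewrite mulr0.
    by have := ltn_ord j; rewrite ji ltnNge ni.
  split=> //; move/eqP: e; rewrite (bigD1 (Ordinal lt_in)) //= big1 ?addr0.
    rewrite [D _ _]mxE !eqxx rmorphM /= !oddzE.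
    by case: (oddz d`_i) => //; rewrite mulr0.
  by move=> j; rewrite -val_eqE /= [D _ _]mxE => /negbTE->; rewrite mulr0.
have [r nE] : exists r, n = (m + r)%N.
  exists (n - m)%N; rewrite subnKC // leqNgt; apply/negP => nm.
  by have [] := dodd (Ordinal nm); rewrite /= ltnn.
subst n; exists r.
pose gf x : 'rV[int]_m * 'rV[int]_r :=
  (lsubmx (zinv f x *m K) *m R, rsubmx (zinv f x *m K)).
pose gi (y : 'rV[int]_m * 'rV[int]_r) : L := f (row_mx (y.1 *m invmx R) y.2 *m invmx K).
have gD x y : gf (x + y) = gf x + gf y.
  by rewrite /gf zinvD mulmxDl linearD mulmxDl linearD.
have gK : cancel gf gi.
  by move=> x; rewrite /gi /= mulmxK // hsubmxK mulmxK // zinvK.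
have Kg : cancel gi gf.
  by move=> [y z]; rewrite /gf /gi /= zfunK mulmxKV // row_mxKl row_mxKr mulmxKV.
exists (Ziso gD gK Kg); split=> // x i.
rewrite -[in LHS](zinvK f x); apply: F2_bool_inj; rewrite redE -oddzE MKR !mulmxA redM.
have -> : red _ _ (zinv f x *m K *m D) = red _ _ (lsubmx (zinv f x *m K)).
  apply/rowP => j; rewrite !mxE rmorph_sum (bigD1 (lshift r j)) //= big1 ?addr0.
    have [_ dj] := dodd j.
    by rewrite [D _ _]mxE eqxx rmorphM /= [(d`_ _)%:~R]oddzE dj mulr1 mxE.
  by move=> k; rewrite -val_eqE /= [D _ _]mxE => /negbTE->; rewrite mulr0.
by rewrite -redM mxE.
Qed.

(** Indexed by [nat] and false beyond [n], so that degrees of all [C(n)] are compared through the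
    same functions. *)
Definition bits n (l : 'rV[int]_n) (i : nat) : bool :=
  if insub i is Some j then oddz (l 0 j) else false.

Lemma bits_ord n (l : 'rV[int]_n) (i : 'I_n) : bits l i = oddz (l 0 i).
Proof. by rewrite /bits valK. Qed.

Lemma bitsD n (l m : 'rV[int]_n) i : bits (l + m) i = bits l i (+) bits m i.
Proof. by rewrite /bits; case: insub => // j; rewrite mxE oddzD. Qed.

Lemma bits0 n i : bits (0 : 'rV[int]_n) i = false.
Proof. by rewrite /bits; case: insub => // j; rewrite mxE. Qed.

(** A basis element of [C(i)] is symmetric only if all its exponents are even. For [i = 2] this is
    the form x + y + xy of an elliptic plane. *)
Fixpoint cd_norm (i : nat) (a : nat -> bool) : bool :=
  if i is j.+1 then a j || cd_norm j a else false.

Inductive base := BaseF | BaseC1 | BaseCstar2.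

Definition base_galg (F : fieldType) (b : base) : galg F :=
  match b with BaseF => scalar_galg F | BaseC1 => C F 1 | BaseCstar2 => Cstar2 F end.

(** As quadratic forms: zero, a form of rank one, and a hyperbolic plane. *)
Definition base_norm (F : fieldType) (b : base) : grp (base_galg F b) -> bool :=
  match b with
  | BaseF => fun=> false
  | BaseC1 => fun l : 'rV[int]_1 => bits l 0
  | BaseCstar2 => fun l : 'rV[int]_2 => bits l 0 && bits l 1
  end.

Fixpoint model_norm (F : fieldType) (k : nat) (b : base) (r : nat) :
    grp (model_a k (base_galg F b) r) -> bool :=
  match k with
  | 0 => fun l => base_norm l.1
  | k'.+1 => fun l => cd_norm 2 (bits (l.1 : 'rV[int]_2)) (+) @model_norm F k' b r l.2
  end.

(** * Classification of quadratic forms over the field with two elements *)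

Section QuadraticForms.
Variable F : fieldType.

Definition classified (L : zmodType) (q : L -> bool) : Prop :=
  exists k b r (g : ziso L (grp (model_a k (base_galg F b) r))),
  forall x, q x = model_norm (g x).

Lemma classified_ziso (L M : zmodType) (g : ziso L M) q q' :
  (forall x, q x = q' (g x)) -> classified q' -> classified q.
Proof.
move=> qE [k [b [r [h hE]]]]; exists k, b, r, (ziso_trans g h) => x.
by rewrite qE hE.
Qed.

Lemma classified_elliptic (L : zmodType) (q : L -> bool) : classified q ->
  classified (fun x : 'rV[int]_2 * L => cd_norm 2 (bits x.1) (+) q x.2).
Proof.
move=> [k [b [r [h hE]]]]; exists k.+1, b, r.
exists (ziso_pair (ziso_refl 'rV[int]_2) h : ziso _ (grp (model_a k.+1 (base_galg F b) r))).
by move=> x /=; rewrite hE.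
Qed.

Definition hyperbolic (l : 'rV[int]_2) : bool := bits l 0 && bits l 1.

Definition ziso_swap (L M N : zmodType) : ziso (L * (M * N))%type (M * (L * N))%type.
Proof.
by apply: (@Ziso (L * (M * N))%type (M * (L * N))%type (fun x => (x.2.1, (x.1, x.2.2)))
  (fun x => (x.2.1, (x.1, x.2.2)))) =>
  [x y|[x [y z]]|[x [y z]]].
Defined.

Definition ziso_triv (L M : zmodType) :
  ziso (L * ('rV[int]_0 * M))%type (L * M)%type.
Proof.
apply: (@Ziso (L * ('rV[int]_0 * M))%type (L * M)%type (fun x => (x.1, x.2.2)) (fun x => (x.1, (0, x.2)))) =>
  [x y|[x [y z]]|[x y]] //=.
by rewrite [y]thinmx0.
Defined.

Definition entry_sum (a : 'rV[int]_2) : 'rV[int]_1 := const_mx (a 0 0 + a 0 1).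

Lemma entry_sumD a b : entry_sum (a + b) = entry_sum a + entry_sum b.
Proof. by apply/rowP => i; rewrite /entry_sum !mxE; ring. Qed.

(** [xy + z = (x + y + xy) + (x + y + z)] over the field with two elements. *)
Definition ziso_hyp_C1 (M : zmodType) :
  ziso ('rV[int]_2 * ('rV[int]_1 * M))%type ('rV[int]_2 * ('rV[int]_1 * M))%type.
Proof.
apply: (@Ziso ('rV[int]_2 * ('rV[int]_1 * M))%type ('rV[int]_2 * ('rV[int]_1 * M))%type
  (fun x => (x.1, (x.2.1 + entry_sum x.1, x.2.2))) (fun x => (x.1, (x.2.1 - entry_sum x.1, x.2.2)))) =>
  [x y|[x [y z]]|[x [y z]]] /=.
- by rewrite entry_sumD addrACA.
- by rewrite addrK.
- by rewrite subrK.
Defined.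

Definition mkrow2 (a b : int) : 'rV[int]_2 := \row_i (if i == 0 then a else b).

Lemma mkrow2_eta (l : 'rV[int]_2) : mkrow2 (l 0 0) (l 0 1) = l.
Proof.
apply/rowP => i; rewrite mxE; case: eqP => [->//|/eqP i0]; congr (l 0 _).
by apply: val_inj; case: i i0 => [[|[|]]].
Qed.

(** Two hyperbolic planes are the sum of the elliptic planes with bases
    [e1 + f1, e1 + e2 + f2] and [e2 + f2, e1 + f1 + e2]. *)
Definition ziso_hyp_hyp (M : zmodType) :
  ziso ('rV[int]_2 * ('rV[int]_2 * M))%type ('rV[int]_2 * ('rV[int]_2 * ('rV[int]_0 * M)))%type.
Proof.
apply: (@Ziso ('rV[int]_2 * ('rV[int]_2 * M))%type ('rV[int]_2 * ('rV[int]_2 * ('rV[int]_0 * M)))%type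
  (fun x => let: (a, (b, c)) := x in
    (mkrow2 (a 0 1 - b 0 0 + b 0 1) (a 0 0 - a 0 1),
    (mkrow2 (b 0 1 - a 0 0 + a 0 1) (b 0 0 - b 0 1), (0, c))))
  (fun y => let: (a, (b, (_, c))) := y in
    (mkrow2 (a 0 0 + a 0 1 + b 0 1) (a 0 0 + b 0 1),
    (mkrow2 (a 0 1 + b 0 0 + b 0 1) (a 0 1 + b 0 0), c)))) =>
  [[a [b c]] [a' [b' c']]|[a [b c]]|[a [b [z c]]]] /=.
- congr (_, (_, (_, _))); last by rewrite addr0.
    by apply/rowP => i; rewrite /mkrow2 !mxE; case: ifP => _; ring.
  by apply/rowP => i; rewrite /mkrow2 !mxE; case: ifP => _; ring.
- by congr (_, (_, _)); rewrite -[RHS]mkrow2_eta; apply/rowP => i; rewrite /mkrow2 !mxE /=;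
    case: ifP => _; ring.
- rewrite [z]thinmx0; congr (_, (_, (_, _)));
  rewrite -[RHS]mkrow2_eta; apply/rowP => i; rewrite /mkrow2 !mxE /=;
    case: ifP => _; ring.
Defined.

(** The new plane is moved past the elliptic ones to the base and absorbed there: zero becomes
    hyperbolic, a rank one form turns the plane into an elliptic one, and two hyperbolic planes turn
    into two elliptic ones. *)
Lemma classified_hyperbolic (L : zmodType) (q : L -> bool) : classified q ->
  classified (fun x : 'rV[int]_2 * L => hyperbolic x.1 (+) q x.2).
Proof.
have b20 (l : 'rV[int]_2) : bits l 0 = oddz (l 0 0) by exact: (bits_ord l (0 : 'I_2)).
have b21 (l : 'rV[int]_2) : bits l 1 = oddz (l 0 1) by exact: (bits_ord l (1 : 'I_2)).
have b10 (l : 'rV[int]_1) : bits l 0 = oddz (l 0 0) by exact: (bits_ord l (0 : 'I_1)).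
suff H k b r : classified (fun x : 'rV[int]_2 * grp (model_a k (base_galg F b) r) =>
    hyperbolic x.1 (+) model_norm x.2).
  move=> [k [b [r [h hE]]]].
  by apply: (classified_ziso (g := ziso_pair (ziso_refl 'rV[int]_2) h) _ (H k b r)) => x /=; rewrite hE.
elim: k => [|k IH].
  case: b => /=.
  - exists 0%N, BaseCstar2, r, (ziso_triv 'rV[int]_2 'rV[int]_r) => -[x [y z]] /=.
    by rewrite addbF.
  - exists 1%N, BaseC1, r, (ziso_hyp_C1 'rV[int]_r) => -[x [y z]] /=.
    rewrite /hyperbolic !(b20, b21, b10) !mxE !oddzD.
    by case: (oddz _) (oddz _) (oddz _) => [] [] [].
  exists 2%N, BaseF, r, (ziso_hyp_hyp 'rV[int]_r) => -[x [y z]] /=.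
  rewrite /hyperbolic /ziso_hyp_hyp /= !(b20, b21) /mkrow2 !mxE /= !(oddzD, oddzN).
  by case: (oddz (x 0 0)) (oddz (x 0 1)) (oddz (y 0 0)) (oddz (y 0 1)) => [] [] [] [].
apply: (classified_ziso (g := ziso_swap 'rV[int]_2 'rV[int]_2 _) _ (classified_elliptic IH)).
by move=> [x [y z]] /=; rewrite addbCA.
Qed.

(** The two conditions together make [q] a quadratic form on the group modulo doubles, see
    [quadratic_shift]. *)
Record quadratic (L : zmodType) (q : L -> bool) : Prop := Quadratic {
  quadratic_add : forall x y z,
    comm_sign q (x + y) z = comm_sign q x z (+) comm_sign q y z;
  quadratic_double : forall x, q (x + x) = false
}.

Section QuadraticTheory.
Variables (L : zmodType) (q : L -> bool) (qQ : quadratic q).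
Local Notation be := (comm_sign q).

Lemma quadraticD x y : q (x + y) = q x (+) q y (+) be x y.
Proof. by rewrite /comm_sign; case: (q x) (q y) (q (x + y)) => [] [] []. Qed.

Lemma comm_signC x y : be x y = be y x.
Proof. by rewrite /comm_sign [x + y]addrC [q x (+) _]addbC. Qed.

Lemma comm_sign_self x : be x x = false.
Proof. by rewrite /comm_sign (quadratic_double qQ); case: (q x). Qed.

Lemma comm_sign0 y : be 0 y = false.
Proof. by have := quadratic_add qQ 0 0 y; rewrite addr0; case: (be 0 y). Qed.

Lemma comm_signMz x y k : be (x *~ k) y = oddz k && be x y.
Proof.
have pn (j : nat) z : be (z *+ j) y = odd j && be z y.
  elim: j => [|j IH]; first by rewrite mulr0n comm_sign0.
  by rewrite mulrS (quadratic_add qQ) IH /=; case: (odd j) (be z y) => [] [].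
have pN z : be (- z) y = be z y.
  have := quadratic_add qQ z (- z) y; rewrite subrr comm_sign0.
  by case: (be z y) (be (- z) y) => [] [].
case: (intP k) => [|j|j]; rewrite /oddz ?mulr0z ?comm_sign0 //.
  by rewrite -pmulrn pn.
by rewrite mulrNz -pmulrn pN pn abszN.
Qed.

Lemma quadratic0 : q 0 = false.
Proof. by have := quadratic_double qQ 0; rewrite addr0. Qed.

Lemma quadratic_shift x u : q (x + u *+ 2) = q x.
Proof.
rewrite quadraticD comm_signC mulr2n (quadratic_double qQ) (quadratic_add qQ).
by rewrite addbb !addbF.
Qed.

Lemma quadraticMz x k : q (x *~ k) = oddz k && q x.
Proof.
have M2 l : x *~ (l *+ 2) = x *~ l *+ 2 by rewrite !mulr2n mulrzDr.
case ko: (oddz k); last first.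
  have [l ->] := oddz_even ko.
  by rewrite M2 -[_ *+ 2]add0r quadratic_shift quadratic0.
have [l kl] : exists l, k - 1 = l *+ 2 by apply: oddz_even; rewrite oddzD oddzN ko.
rewrite (_ : k = 1 + l *+ 2); last by rewrite -kl; ring.
by rewrite mulrzDr mulr1z M2 quadratic_shift.
Qed.

End QuadraticTheory.

Definition ziso_shear (m r : nat) (u : 'I_m -> 'rV[int]_r) :
  ziso ('rV[int]_m * 'rV[int]_r)%type ('rV[int]_m * 'rV[int]_r)%type.
Proof.
apply: (@Ziso ('rV[int]_m * 'rV[int]_r)%type ('rV[int]_m * 'rV[int]_r)%type
  (fun x => (x.1, x.2 - \sum_i u i *~ x.1 0 i)) (fun x => (x.1, x.2 + \sum_i u i *~ x.1 0 i))) =>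
  [[x y] [x' y']|[x y]|[x y]] /=.
- congr pair; rewrite /= (eq_bigr (fun i => u i *~ x 0 i + u i *~ x' 0 i)) => [|i _].
    by rewrite big_split /= opprD addrACA.
  by rewrite mxE mulrzDr.
- by rewrite subrK.
- by rewrite addrK.
Defined.

(** Induction on the rank. If the polar form vanishes, [q] is additive: zero or a single parity.
    Otherwise a plane splits off. Two of its three nonzero vectors have the same value; with these
    as [a] and [b] it is elliptic for value 1 and hyperbolic for value 0. *)
Lemma quadratic_classified n (q : 'rV[int]_n -> bool) : quadratic q -> classified q.
Proof.
have [N] := ubnP n; elim: N n q => // N IH n q nN qQ.
pose be := comm_sign q.
have [[a0 [b0 ab0]]|nbe] := pselect (exists a b, be a b); last first.
  have qD x y : q (x + y) = q x (+) q y.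
    rewrite quadraticD; case e: (comm_sign q x y); last by rewrite addbF.
    by case: nbe; exists x, y.
  have [[x0 qx0]|nq] := pselect (exists x, q x); last first.
    have triv : ziso 'rV[int]_n ('rV[int]_0 * 'rV[int]_n)%type.
      apply: (@Ziso _ ('rV[int]_0 * 'rV[int]_n)%type (fun x => (0, x)) (fun x => x.2)) => [x y|x|[x y]] //=.
        by congr pair; rewrite addr0.
      by rewrite [x]thinmx0.
    exists 0%N, BaseF, n, triv => x /=; apply/negP => qx; apply: nq; by exists x.
  have [||r [g [_ gE]]] := @parity_splitting n 1 _ (ziso_refl _) (fun x _ => q x).
  - by move=> x y _; apply: qD.
  - move=> v; exists (if v 0 then x0 else 0) => i; rewrite [i]ord1.
    by case: (v 0); rewrite ?qx0 ?(quadratic0 qQ).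
  exists 0%N, BaseC1, r, g => x /=.
  by rewrite (gE x 0) -(bits_ord (g x).1 (0 : 'I_1)).
have [a [b [ab qab]]] : exists a b, be a b /\ q a = q b.
  have bxx := comm_sign_self qQ; have bC := comm_signC q.
  case qa: (q a0); case qb: (q b0).
  - by exists a0, b0; rewrite qa qb.
  - exists (a0 + b0), b0; split; first by rewrite /be (quadratic_add qQ) bxx addbF.
    by rewrite (quadraticD q a0 b0) qa qb [comm_sign q a0 b0]ab0.
  - exists a0, (a0 + b0); split; first by rewrite /be bC (quadratic_add qQ) bxx addFb bC.
    by rewrite (quadraticD q a0 b0) qa qb [comm_sign q a0 b0]ab0.
  - by exists a0, b0; rewrite qa qb.
have baa : be a a = false := comm_sign_self qQ a.
have bbb : be b b = false := comm_sign_self qQ b.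
have bba : be b a by rewrite /be comm_signC.
(* The polar form with [b] reads off the coefficient of [a], and conversely; hence the exchanged
   order. *)
pose v (i : 'I_2) := if i == 0 then b else a.
have [||r [g [nE gE]]] := @parity_splitting n 2 _ (ziso_refl _) (fun x i => be x (v i)).
- by move=> x y i; apply: quadratic_add qQ _ _ _.
- move=> w; exists (a *~ (w 0 : nat) + b *~ (w 1 : nat)) => i.
  rewrite /be (quadratic_add qQ) !(comm_signMz qQ) /v /oddz /=.
  case: eqP => [->|/eqP i0]; first by rewrite [comm_sign q a b]ab [comm_sign q b b]bbb; case: (w 0) (w 1) => [] [].
  have -> : i = 1 by apply: val_inj; case: i i0 => [[|[|]]].
  by rewrite [comm_sign q a a]baa [comm_sign q b a]bba; case: (w 0) (w 1) => [] [].
pose u (i : 'I_2) := if i == 0 then a else b.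
(* The first two coordinates are, modulo 2, the coefficients of [a] and [b]; the shear removes what
   these contribute to the other coordinates. *)
pose h := ziso_trans g (ziso_shear (fun i => (g (u i)).2)).
pose q' z := q (zinv g (0, z)).
have q'E z : be (zinv g (0, z)) a = false /\ be (zinv g (0, z)) b = false.
  split; first by rewrite (gE _ (1 : 'I_2)) zinvK mxE.
  by rewrite (gE _ (0 : 'I_2)) zinvK mxE.
have q'Q : quadratic q'.
  have D x y : zinv g (0, x + y) = zinv g (0, x) + zinv g (0, y).
    by rewrite -zinvD; congr (zinv g _); congr pair; rewrite /= addr0.
  split=> [x y z|x]; last by rewrite /q' D; apply: quadratic_double qQ _.
  by rewrite /comm_sign /q' !D; apply: quadratic_add qQ _ _ _.
have cq' : classified q' by apply: IH q'Q; rewrite nE in nN; lia.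
have fstMz (p : 'rV[int]_2 * 'rV[int]_r) k : (p *~ k).1 = p.1 *~ k by apply: raddfMz.
have sndMz (p : 'rV[int]_2 * 'rV[int]_r) k : (p *~ k).2 = p.2 *~ k by apply: raddfMz.
have main x : q x = (if q a then cd_norm 2 (bits (h x).1) else hyperbolic (h x).1) (+) q' (h x).2.
  set y := (h x).1; set z := (h x).2.
  (* The first two coordinates of [a] and [b] are known by parity only; [w] absorbs the even
     difference, which [q] does not see. *)
  have [w xw] : exists w, x = a *~ y 0 0 + b *~ y 0 1 + zinv g (0, z) + w *+ 2.
    have [c cE] : exists c : 'I_2 -> int,
        forall i, y 0 i - (g a).1 0 i * y 0 0 - (g b).1 0 i * y 0 1 = c i *+ 2.
      suff H i : exists c, y 0 i - (g a).1 0 i * y 0 0 - (g b).1 0 i * y 0 1 = c *+ 2.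
        by exists (fun i => projT1 (cid (H i))) => i; case: (cid (H i)).
      apply: oddz_even; rewrite !(oddzD, oddzN, oddzM) -!gE /v.
      by case: ifP => _; rewrite /= ?(ab, bba, baa, bbb) ?addbF /=; case: (be x _).
    exists (zinv g (\row_i c i, 0)); apply: (can_inj (zfunK g)).
    rewrite pmulrn !(zfunD, zfunMz) !zinvK; apply: injective_projections => /=.
      apply/rowP => i; rewrite !fstMz -!scaler_int !intz !mxE.
      have H := cE i; rewrite [(g a).1 0 i * _]mulrC [(g b).1 0 i * _]mulrC in H.
      move: H; rewrite -[(g x).1 0 i]/(y 0 i).
      move: (y 0 0 * _) (y 0 1 * _) (y 0 i) (c i) => s t w d; lia.
    rewrite !sndMz /z /= !big_ord_recl big_ord0 /u /= -/y.
    have -> : lift ord0 ord0 = 1 :> 'I_2 by apply: val_inj.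
    have -> : ord0 = 0 :> 'I_2 by apply: val_inj.
    rewrite -[(g x).1]/y; move: ((g a).2 *~ _) ((g b).2 *~ _) (g x).2 => s t w; zmod.
  rewrite xw (quadratic_shift qQ).
  rewrite (quadraticD q (a *~ y 0 0 + b *~ y 0 1)) (quadraticD q (a *~ y 0 0)) !(quadraticMz qQ).
  have [za zb] := q'E z.
  rewrite (quadratic_add qQ) !(comm_signMz qQ) [comm_sign q a (_ *~ _)]comm_signC.
  rewrite (comm_signMz qQ) [comm_sign q a (zinv _ _)]comm_signC.
  rewrite [comm_sign q b (zinv _ _)]comm_signC [comm_sign q (zinv _ _) a]za
    [comm_sign q (zinv _ _) b]zb [comm_sign q b a]bba -qab.
  have b20 (l : 'rV[int]_2) : bits l 0 = oddz (l 0 0) by exact: (bits_ord l (0 : 'I_2)).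
  have b21 (l : 'rV[int]_2) : bits l 1 = oddz (l 0 1) by exact: (bits_ord l (1 : 'I_2)).
  rewrite /hyperbolic /= b20 b21 /q'; by case: (q (zinv _ _)) (q a) (oddz _) (oddz _) => [] [] [] [].
case qa: (q a) main => main.
  exact: (classified_ziso (g := h) main (classified_elliptic cq')).
exact: (classified_ziso (g := h) main (classified_hyperbolic cq')).
Qed.

End QuadraticForms.

(** * Boolean functions on three bits *)

Definition bits3 := (bool * bool * bool)%type.

Definition addb3 (p q : bits3) : bits3 :=
  (p.1.1 (+) q.1.1, p.1.2 (+) q.1.2, p.2 (+) q.2).

Lemma addb3A : associative addb3.
Proof. by move=> p q r; rewrite /addb3 /= !addbA. Qed.

Definition nz3 (p : bits3) : bool := [|| p.1.1, p.1.2 | p.2].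

Definition all3 (P : bits3 -> bool) : bool :=
  let Pb b := [&& P (false, false, b), P (false, true, b), P (true, false, b)
                & P (true, true, b)] in
  Pb false && Pb true.

Lemma all3P (P : bits3 -> bool) : reflect (forall e, P e) (all3 P).
Proof.
apply: (iffP idP) => [|H]; last by rewrite /all3 !H.
by case/andP => /and4P[? ? ? ?] /and4P[? ? ? ?] [[[] []] []].
Qed.

(** Replacing a function by its eight values turns a statement about all such functions into a
    finite computation. *)
Definition table3 (t0 t1 t2 t3 t4 t5 t6 t7 : bool) (e : bits3) : bool :=
  match e with
  | (false, false, false) => t0 | (false, false, true) => t1
  | (false, true, false) => t2 | (false, true, true) => t3
  | (true, false, false) => t4 | (true, false, true) => t5
  | (true, true, false) => t6 | (true, true, true) => t7
  end.

Lemma table3E (g : bits3 -> bool) :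
  g =1 table3 (g (false, false, false)) (g (false, false, true)) (g (false, true, false))
    (g (false, true, true)) (g (true, false, false)) (g (true, false, true))
    (g (true, true, false)) (g (true, true, true)).
Proof. by case=> [[[] []] []]. Qed.

(** * Classification of the skew degrees, nonassociative case *)

Section OctonionicDegrees.
Variables (L : zmodType) (S : L -> bool).
Hypotheses (S0 : S 0 = false) (S2 : forall l m, S (l + m + m) = S l).
Hypothesis S3 : forall l m n, S l -> S m -> S n -> S (l + m) = false ->
  S (l + m + n) = ~~ (S (l + n) (+) S (m + n)).
Hypothesis S4 : forall a b c d : L, ~ forall i j k m : bool,
  [|| i, j, k | m] -> S (a *+ i + b *+ j + c *+ k + d *+ m).
Hypothesis Sgen : forall P : set L, subgroup P -> (forall l, S l -> P l) -> forall l, P l.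
Variables a b c : L.
Hypotheses (Sa : S a) (Sb : S b) (Sc : S c) (Sabc : octonionic S a b c).

Definition octw (e : bits3) : L := a *+ e.1.1 + b *+ e.1.2 + c *+ e.2.

Lemma octwD e f : exists u, octw e + octw f = octw (addb3 e f) + u + u.
Proof.
have D (x : L) (i j : bool) : x *+ i + x *+ j = x *+ (i (+) j) + x *+ (i && j) + x *+ (i && j).
  by case: i j => [] []; rewrite /= ?addr0 ?add0r.
case: e f => [[i j] k] [[i' j'] k']; exists (octw (i && i', j && j', k && k')).
rewrite /octw /addb3 /=; transitivity ((a *+ i + a *+ i') + (b *+ j + b *+ j') + (c *+ k + c *+ k')).
  by zmod.
rewrite (D a i i') (D b j j') (D c k k'); zmod.
Qed.

Lemma S_octw e : S (octw e) = nz3 e.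
Proof.
case/and4P: Sabc => Sab Sac Sbc Sabc'.
by case: e => [[[] []] []]; rewrite /octw /= ?mulr1n ?mulr0n ?addr0 ?add0r.
Qed.

(** The pattern of skew degrees on the translate by [x] of the eight octonion degrees. *)
Definition octg (x : L) (e : bits3) : bool := S (x + octw e).

Lemma octg_shift x e f : octg (x + octw e) f = octg x (addb3 e f).
Proof.
rewrite /octg -addrA; have [u ->] := octwD e f.
by rewrite !addrA S2.
Qed.

Lemma S_add_octw x e f : S (x + octw e + octw f) = octg x (addb3 e f).
Proof. exact: octg_shift. Qed.

Lemma S_add_octw3 x e f h :
  S (x + octw e + octw f + octw h) = octg x (addb3 (addb3 e f) h).
Proof. by rewrite S_add_octw octg_shift addb3A. Qed.

Lemma S_octwD e f : S (octw e + octw f) = nz3 (addb3 e f).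
Proof. by have [u ->] := octwD e f; rewrite S2 S_octw. Qed.

Lemma octg_double x u e : octg (x + u + u) e = octg x e.
Proof. by rewrite /octg addrAC [x + u + _]addrAC S2. Qed.

Lemma octg_add x y e f : S (x + octw e + (y + octw f)) = octg (x + y) (addb3 e f).
Proof. by rewrite -S_add_octw; congr S; zmod. Qed.

(** The first conjunct is [S4] for [a], [b], [c], [x]; the second is [S3] with one degree in the
    translate and two among the octonion degrees. *)
Definition octg_law1 (g : bits3 -> bool) : bool :=
  ~~ all3 g && all3 (fun e => all3 (fun f => all3 (fun h =>
    [&& g e, nz3 f, ~~ g (addb3 e f) & nz3 h] ==>
    (g (addb3 (addb3 e f) h) == ~~ (g (addb3 e h) (+) nz3 (addb3 f h)))))).

(** [S3] for one degree in each of two translates and one octonion degree, each pair in turn being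
    the commuting one. *)
Definition octg_law2 (g h k : bits3 -> bool) : bool :=
  all3 (fun e => all3 (fun f => all3 (fun d => nz3 d ==>
    [&& [&& g e, h f & ~~ k (addb3 e f)] ==>
          (k (addb3 (addb3 e f) d) == ~~ (g (addb3 e d) (+) h (addb3 f d))),
        [&& g e, h f & ~~ g (addb3 e d)] ==>
          (k (addb3 (addb3 e f) d) == ~~ (k (addb3 e f) (+) h (addb3 f d))) &
        [&& g e, h f & ~~ h (addb3 f d)] ==>
          (k (addb3 (addb3 e f) d) == ~~ (k (addb3 e f) (+) g (addb3 e d)))]))).

Lemma octg_law1P x : octg_law1 (octg x).
Proof.
apply/andP; split.
  apply/negP => /all3P H; apply: (S4 (a := a) (b := b) (c := c) (d := x)).
  move=> i j k [] ijk; first by rewrite mulr1n addrC; apply: (H (i, j, k)).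
  by rewrite mulr0n addr0 (S_octw (i, j, k)) /nz3 /= -(orbF (i || _)) -!orbA.
apply/all3P => e; apply/all3P => f; apply/all3P => h; apply/implyP => /and4P[ge nf /negbTE gf nh].
rewrite -S_add_octw3 -[octg x (addb3 e h)]S_add_octw -S_octwD; apply/eqP.
by apply: S3; rewrite ?S_octw ?S_add_octw.
Qed.

Lemma octg_law2P x y : octg_law2 (octg x) (octg y) (octg (x + y)).
Proof.
have A e f d : octg (x + y) (addb3 (addb3 e f) d) = S (x + octw e + (y + octw f) + octw d).
  by rewrite -S_add_octw3; congr S; zmod.
apply/all3P => e; apply/all3P => f; apply/all3P => d; apply/implyP => nd.
have Sd : S (octw d) by rewrite S_octw.
apply/and3P; split; apply/implyP => /and3P[ge hf /negbTE kf]; rewrite A; apply/eqP.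
- by rewrite S3 // ?S_add_octw // octg_add.
- rewrite addrAC S3 // ?S_add_octw // octg_add.
  by rewrite [octw d + _]addrC S_add_octw.
rewrite [x + _ + _]addrC addrAC S3 // ?S_add_octw //.
by rewrite [y + octw f + _]addrC octg_add [octw d + _]addrC S_add_octw.
Qed.

(** Applied to the pattern of a skew degree, this says that the degree lies in the centralizer up to
    an octonion degree. All tables of eight values are checked. *)
Lemma octg_law1_classify (g : bits3 -> bool) : octg_law1 g -> g (false, false, false) ->
  exists e i, forall f, g (addb3 e f) = nz3 f (+) i.
Proof.
have -> : g = _ := funext (table3E g).
move: (g (false, false, false)) (g (false, false, true)) (g (false, true, false))
  (g (false, true, true)) (g (true, false, false)) (g (true, false, true))
  (g (true, true, false)) (g (true, true, true)) => t0 t1 t2 t3 t4 t5 t6 t7 law t0T.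
pose P e i := all3 (fun f => table3 t0 t1 t2 t3 t4 t5 t6 t7 (addb3 e f) == nz3 f (+) i).
suff : ~~ all3 (fun e => ~~ P e false && ~~ P e true).
  move/negP => H; apply/not_existsP => H'; apply: H; apply/all3P => e.
  apply/andP; split; apply/negP => /all3P Pe; apply: (H' e).
    by exists false => f; exact: (eqP (Pe f)).
  by exists true => f; exact: (eqP (Pe f)).
by move: law t0T; rewrite {}/P; move: t0 t1 t2 t3 t4 t5 t6 t7; do 8! case.
Qed.

(** Used to add degrees of the centralizer; [l ==> i || j] records that the symmetric ones are
    closed under addition. *)
Lemma octg_law2_classify (i j : bool) (k : bits3 -> bool) :
  octg_law2 (fun e => nz3 e (+) i) (fun e => nz3 e (+) j) k ->
  exists2 l, l ==> i || j & forall e, k e = nz3 e (+) l.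
Proof.
have -> : k = _ := funext (table3E k).
move: (k (false, false, false)) (k (false, false, true)) (k (false, true, false))
  (k (false, true, true)) (k (true, false, false)) (k (true, false, true))
  (k (true, true, false)) (k (true, true, true)) => t0 t1 t2 t3 t4 t5 t6 t7 law2.
suff /andP[il /all3P H] : (t0 ==> i || j) &&
    all3 (fun e => table3 t0 t1 t2 t3 t4 t5 t6 t7 e == nz3 e (+) t0).
  by exists t0 => // e; exact: (eqP (H e)).
by move: i j law2; move: t0 t1 t2 t3 t4 t5 t6 t7; do 10! case.
Qed.

(** [octU false] and [octU true] are the degrees of the symmetric and of the
    skew homogeneous elements of the centralizer of the octonion subalgebra. *)
Definition octU (i : bool) (x : L) : Prop := forall e, octg x e = nz3 e (+) i.

Lemma octUD i j x y : octU i x -> octU j y ->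
  exists2 l, l ==> i || j & octU l (x + y).
Proof.
move=> /funext Ux /funext Uy; have := octg_law2P x y; rewrite Ux Uy.
exact: octg_law2_classify.
Qed.

Lemma octU_double i x u : octU i x -> octU i (x + u + u).
Proof. by move=> Ux e; rewrite octg_double. Qed.

Lemma octU0 : octU false 0.
Proof. by move=> e; rewrite /octg add0r S_octw addbF. Qed.

Lemma octU_inj i j x e : octU i x -> octU j (x + octw e) ->
  e = (false, false, false) /\ i = j.
Proof.
move=> Ux Uxe; have H f : nz3 (addb3 e f) (+) i = nz3 f (+) j.
  by rewrite -Ux -octg_shift Uxe.
have := H (true, false, false); have := H (false, true, false).
have := H (false, false, true); have := H (true, true, false).
have := H (false, false, false).
by case: e i j {H Ux Uxe} => [[[] []] []] [] [].
Qed.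

Lemma octU_cover x : exists e i, octU i (x + octw e).
Proof.
pose K : set L := [set x | exists e i, octU i (x + octw e)]%classic.
suff KP : subgroup K.
  apply: (Sgen KP) => s Ss.
  have g0 : octg s (false, false, false) by rewrite /octg /octw /= !mulr0n !addr0.
  have [e [i H]] := octg_law1_classify (octg_law1P s) g0.
  by exists e, i => f; rewrite octg_shift.
split; first by exists (false, false, false), false; rewrite /octw /= !mulr0n !addr0; apply: octU0.
move=> y z [e [i Uy]] [f [j Uz]]; have [u ef] := octwD e f.
have [l _ Uyz] := octUD Uy Uz; exists (addb3 e f), l.
have := octU_double (- z - u) Uyz.
have -> // : y + octw e + (z + octw f) + (- z - u) + (- z - u)
   = y - z + (octw e + octw f) - u - u by zmod.
by rewrite ef; congr (octU _ _); zmod.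
Qed.

Lemma S_octU x e i : octU i (x + octw e) -> S x = nz3 e (+) i.
Proof.
move/(_ e); rewrite octg_shift => <-; rewrite /octg.
have -> : addb3 e e = (false, false, false) by case: e => [[[] []] []].
by rewrite /octw /= !mulr0n !addr0.
Qed.

Definition comb k (u : 'I_k -> L) (ep : 'I_k -> bool) : L := \sum_i u i *+ ep i.

Lemma combD k (u : 'I_k -> L) ep ep' :
  exists v, comb u ep + comb u ep' = comb u (fun i => ep i (+) ep' i) + v + v.
Proof.
exists (comb u (fun i => ep i && ep' i)); rewrite /comb -!big_split.
apply: eq_bigr => i _; case: (ep i) (ep' i) => [] [];
by rewrite /= ?mulr0n ?mulr1n ?addr0 ?add0r.
Qed.

(** Independence modulo the symmetric degrees of the centralizer. These include all doubles, so
    boolean coefficients suffice. *)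
Definition octU_family k (u : 'I_k -> L) : Prop := (forall j, exists i, octU i (u j)) /\
  forall ep, octU false (comb u ep) -> forall j, ep j = false.

Lemma octU_comb k (u : 'I_k -> L) ep :
  (forall j, exists i, octU i (u j)) -> exists i, octU i (comb u ep).
Proof.
move=> Uu; rewrite /comb.
elim: (index_enum _) => [|j s [i IH]].
  by exists false; rewrite big_nil; apply: octU0.
rewrite big_cons; have [i' Uj] := Uu j; case: (ep j).
  by have [l _ ?] := octUD Uj IH; exists l.
by exists i; rewrite mulr0n add0r.
Qed.

(** A nontrivial combination of an independent family is a degree of the centralizer that is not
    symmetric, hence skew; for four members this contradicts [S4]. *)
Lemma octU_family4 (u : 'I_4 -> L) : ~ octU_family u.
Proof.
move=> [Uu ind]; apply: (S4 (a := u 0) (b := u 1) (c := u (inord 2)) (d := u (inord 3))).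
move=> i j k m nz; pose ep (l : 'I_4) := nth false [:: i; j; k; m] l.
have <- : comb u ep = u 0 *+ i + u 1 *+ j + u (inord 2) *+ k + u (inord 3) *+ m.
  rewrite /comb !big_ord_recl big_ord0 addr0 !addrA /ep /=.
  have -> : lift ord0 (lift ord0 (lift ord0 ord0)) = inord 3 :> 'I_4.
    by apply: val_inj; rewrite /= inordK.
  have -> : lift ord0 (lift ord0 ord0) = inord 2 :> 'I_4.
    by apply: val_inj; rewrite /= inordK.
  have -> : lift ord0 ord0 = 1 :> 'I_4 by apply: val_inj.
  by have -> : ord0 = 0 :> 'I_4 by apply: val_inj.
have [[] Uc] := octU_comb ep Uu.
  have := Uc (false, false, false).
  by rewrite /octg /octw /= !mulr0n !addr0 => ->.
have e0 := ind _ Uc.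
have := e0 0; have := e0 1; have := e0 (inord 2); have := e0 (inord 3).
by rewrite /ep !inordK //= => m0 k0 j0 i0; rewrite i0 j0 k0 m0 in nz.
Qed.

Lemma octU_maximal_family : exists k (u : 'I_k -> L), [/\ (k <= 3)%N, octU_family u &
  forall x i, octU i x -> exists ep, octU false (x + comb u ep)].
Proof.
have step k (u : 'I_k -> L) : octU_family u ->
    (exists u' : 'I_k.+1 -> L, octU_family u') \/
    forall x i, octU i x -> exists ep, octU false (x + comb u ep).
  move=> [Uu ind]; have [|none] := pselect (exists u' : 'I_k.+1 -> L, octU_family u').
    by left.
  right=> x i Ux; apply/not_existsP => nx; apply: none.
  exists (fun l => if unlift ord0 l is Some j then u j else x); split.
    by move=> l; case: unliftP => [j _|_]; [apply: Uu | exists i].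
  move=> ep; rewrite /comb big_ord_recl unlift_none.
  rewrite (eq_bigr (fun j => u j *+ ep (lift ord0 j))) => [|j _]; last by rewrite liftK.
  rewrite -/(comb u (fun j => ep (lift ord0 j))).
  case ep0: (ep ord0); first by rewrite mulr1n => /nx.
  rewrite mulr0n add0r => /ind e0 l.
  by case: (unliftP ord0 l) => [j ->|->].
have F0 : octU_family (fun _ : 'I_0 => 0 : L) by split=> [[]//|ep _ []].
case: (step _ _ F0) => [[u1 F1]|m]; last by exists 0%N, (fun _ => 0).
case: (step _ _ F1) => [[u2 F2]|m]; last by exists 1%N, u1.
case: (step _ _ F2) => [[u3 F3]|m]; last by exists 2%N, u2.
case: (step _ _ F3) => [[u4 /octU_family4//]|m]; by exists 3%N, u3.
Qed.

Lemma cd_norm_bits k (l : 'rV[int]_k) : cd_norm k (bits l) = [exists i, oddz (l 0 i)].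
Proof.
have H j : cd_norm j (bits l) = has (bits l) (iota 0 j).
  by elim: j => // j IH; rewrite -[in RHS]addn1 iotaD has_cat -IH /= orbF orbC.
rewrite H; apply/hasP/existsP => [[i]|[i li]].
  by rewrite mem_iota => /= ik; rewrite (bits_ord l (Ordinal ik)); exists (Ordinal ik).
by exists (val i); rewrite ?bits_ord // mem_iota /=.
Qed.

Definition bit3 (e : bits3) (i : 'I_3) : bool := nth false [:: e.1.1; e.1.2; e.2] i.

Lemma nz3_exists e : nz3 e = [exists i, bit3 e i].
Proof.
apply/idP/existsP => [|[[[|[|[|//]]] i3]]]; rewrite /nz3 /bit3 /=; last 3 first.
- by move=> ->.
- by move=> ->; rewrite orbT.
- by move=> ->; rewrite !orbT.
by case/or3P => e1; [exists (@Ordinal 3 0 isT) | exists (@Ordinal 3 1 isT) | exists (@Ordinal 3 2 isT)].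
Qed.

(** Each [x] is moved into the symmetric degrees of the centralizer by a unique octonion degree [e]
    and a unique combination [ep] of a maximal independent family. Both are additive in [x], which
    gives [3 + k] independent parities for [parity_splitting]. The centralizer part of [x] is skew
    exactly if [ep] is not zero. *)
Theorem octonionic_classified n (f : ziso 'rV[int]_n L) :
  exists k r (g : ziso L ('rV[int]_3 * ('rV[int]_k * 'rV[int]_r))%type),
  (k <= 3)%N /\ forall x, S x = cd_norm 3 (bits (g x).1) (+) cd_norm k (bits (g x).2.1).
Proof.
have [k [u [k3 [Uu ind] span]]] := octU_maximal_family.
have cover x : exists p : bits3 * ('I_k -> bool), octU false (x + octw p.1 + comb u p.2).
  have [e [i Ux]] := octU_cover x; have [ep Uxe] := span _ _ Ux.
  by exists (e, ep).
have addU x y (q q' : bits3 * ('I_k -> bool)) :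
    octU false (x + octw q.1 + comb u q.2) -> octU false (y + octw q'.1 + comb u q'.2) ->
    octU false (x + y + octw (addb3 q.1 q'.1) + comb u (fun i => q.2 i (+) q'.2 i)).
  move=> U1 U2; have [l lf U12] := octUD U1 U2.
  have [v ev] := octwD q.1 q'.1; have [w cw] := combD u q.2 q'.2.
  case: l lf U12 => // _ /(octU_double (- v - w)).
  congr (octU _ _); transitivity (x + y + (octw q.1 + octw q'.1) - v - v
    + (comb u q.2 + comb u q'.2) - w - w); first by zmod.
  by rewrite ev cw; zmod.
have uniq x q q' : octU false (x + octw q.1 + comb u q.2) ->
    octU false (x + octw q'.1 + comb u q'.2) -> q.1 = q'.1 /\ q.2 =1 q'.2.
  move=> U1 U2; have /(octU_double (- x)) U3 := addU _ _ _ _ U1 U2.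
  have [i Ui] := octU_comb (fun i => q.2 i (+) q'.2 i) Uu.
  have [ee i0] : addb3 q.1 q'.1 = (false, false, false) /\ i = false.
    by apply: (octU_inj Ui); move: U3; congr (octU _ _); zmod.
  rewrite i0 in Ui; have ep := ind _ Ui; split; last first.
    by move=> j; have := ep j; case: (q.2 j) (q'.2 j) => [] [].
  by case: q.1 q'.1 ee => [[[] []] []] [[[] []] []].
pose p x i : bool := match split i with
  | inl j => bit3 (projT1 (cid (cover x))).1 j
  | inr j => (projT1 (cid (cover x))).2 j end.
have pE x q : octU false (x + octw q.1 + comb u q.2) ->
    forall i, p x i = match split i with inl j => bit3 q.1 j | inr j => q.2 j end.
  move=> Uq i; rewrite /p; case: cid => q' /= Uq'.
  by have [-> e2] := uniq _ _ _ Uq' Uq; case: split.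
have [||r [g [_ gE]]] := @parity_splitting n (3 + k) L f p.
- move=> x y i; rewrite {2 3}/p.
  case: (cid (cover x)) => q Uq /=; case: (cid (cover y)) => q' Uq' /=.
  rewrite (pE _ (addb3 q.1 q'.1, fun i => q.2 i (+) q'.2 i)).
    by case: split => //= j; rewrite /bit3; case: j => [[|[|[|]]]].
  exact: addU Uq Uq'.
- move=> v; pose e : bits3 := (v (lshift k 0), v (lshift k 1), v (lshift k (inord 2))).
  exists (octw e + comb u (fun i => v (rshift 3 i))) => i.
  rewrite (pE _ (e, fun i => v (rshift 3 i))) /=; last first.
    have := octU_double (octw e + comb u (fun i => v (rshift 3 i))) octU0.
    by congr (octU _ _); zmod.
  rewrite -[in RHS](splitK i); case: (split i) => [[[|[|[|//]]] j3]|j] //=;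
    by congr (v (lshift _ _)); apply: val_inj; rewrite /= ?inordK.
pose s (x : 'rV[int]_(3 + k) * 'rV[int]_r) : 'rV[int]_3 * ('rV[int]_k * 'rV[int]_r) :=
  (lsubmx x.1, (rsubmx x.1, x.2)).
have sD x y : s (x + y) = s x + s y by rewrite /s !linearD.
pose s' (x : 'rV[int]_3 * ('rV[int]_k * 'rV[int]_r)) : 'rV[int]_(3 + k) * 'rV[int]_r :=
  (row_mx x.1 x.2.1, x.2.2).
have sK : cancel s s' by case=> x y; rewrite /s /s' /= hsubmxK.
have Ks : cancel s' s by case=> x [y z]; rewrite /s /s' /= row_mxKl row_mxKr.
exists k, r, (ziso_trans g (Ziso sD sK Ks)); split=> // x.
rewrite !cd_norm_bits /=.
have [[e ep] /= Ux] := cover x.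
have -> : [exists i, oddz (lsubmx (g x).1 0 i)] = nz3 e.
  rewrite nz3_exists; apply: eq_existsb => i; rewrite mxE -gE (pE x (e, ep) Ux).
  by rewrite -[lshift k i]/(unsplit (inl i)) unsplitK.
have -> : [exists i, oddz (rsubmx (g x).1 0 i)] = [exists i, ep i].
  apply: eq_existsb => i; rewrite mxE -gE (pE x (e, ep) Ux).
  by rewrite -[rshift 3 i]/(unsplit (inr i)) unsplitK.
have [i Ui] := octU_comb ep Uu.
have [l _ Ul] := octUD Ux Ui.
have {}Ul : octU l (x + octw e).
  by have := octU_double (- comb u ep) Ul; congr (octU _ _); zmod.
rewrite (S_octU Ul); congr (_ (+) _); apply/idP/existsP => [l1|[j epj]].
  apply/not_existsP => nep; have : comb u ep = 0.
    by rewrite /comb big1 // => j _; case epj: (ep j); [case: (nep j) | rewrite mulr0n].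
  move=> c0; rewrite c0 addr0 in Ux.
  have x0 : octU l (x + octw e + octw (false, false, false)).
    by move: Ul; congr (octU _ _); rewrite /octw /= !mulr0n !addr0.
  by have [_ l0] := octU_inj Ux x0; rewrite -l0 in l1.
case: l Ul => // Ul; have [m mf Um] := octUD Ul Ux.
case: m mf Um => // _ /(octU_double (- (x + octw e))) Um.
have : octU false (comb u ep) by move: Um; congr (octU _ _); zmod.
by move/ind/(_ j); rewrite epj.
Qed.

End OctonionicDegrees.

(** * The models *)

Section TwistedBasis.
Variables (F : fieldType) (A : galg F).
Local Notation L := (grp A).

(** [A] is a twisted group algebra of [L] over [F] with signs as structure
    constants, [psi] being the dual family of the basis [b]. *)
Record twisted_basis (chi : L -> L -> bool) (tau : L -> bool) (b : L -> A)
    (psi : L -> A -> F^o) : Prop := TwistedBasis {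
  tb_comp : forall l x, comp A l x <-> exists k, x = k *: b l;
  tb_lin : forall l, linear (psi l);
  tb_dual : forall l m, psi l (b m) = (l == m)%:R;
  tb_span : forall P : set A, subspace P -> (forall l, P (b l)) -> forall x, P x;
  tb_one : b 0 = aone;
  tb_mul : forall l m, b l *a b m = (-1) ^+ chi l m *: b (l + m);
  tb_star : forall l, star (b l) = (-1) ^+ tau l *: b l;
  tb_perl : forall l m k, chi (l + k + k) m = chi l m;
  tb_perr : forall l m k, chi l (m + k + k) = chi l m
}.

Hypothesis two0 : 2%:R != 0 :> F.
Variables (chi : L -> L -> bool) (tau : L -> bool) (b : L -> A) (psi : L -> A -> F^o).
Hypothesis tb : twisted_basis chi tau b psi.

Lemma tb_neq0 l : b l <> 0.
Proof.
have p0 : psi l 0 = 0 by have := tb_lin tb l (-1) 0 0; rewrite !scaleN1r !addNr.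
move=> b0; have := tb_dual tb l l; rewrite b0 p0 eqxx => /esym/eqP.
by rewrite oner_eq0.
Qed.

Lemma tb_psiZ l k x : psi l (k *: x) = k * psi l x.
Proof.
have p0 : psi l 0 = 0 by have := tb_lin tb l (-1) 0 0; rewrite !scaleN1r !addNr.
by rewrite -[k *: x]addr0 (tb_lin tb) p0 addr0.
Qed.

Lemma tb_graded : is_graded A.
Proof.
have subC l : subspace (comp A l).
  split; first by apply/(tb_comp tb); exists 0; rewrite scale0r.
  move=> k u v /(tb_comp tb)[i ->] /(tb_comp tb)[j ->]; apply/(tb_comp tb).
  by exists (k * i + j); rewrite scalerA scalerDl.
have bC l : comp A l (b l) by apply/(tb_comp tb); exists 1; rewrite scale1r.
split=> //.
- apply/seteqP; split=> // x _; apply: (tb_span tb); first exact: subspace_span.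
  by move=> l; apply: sub_span; exists l.
- move=> s x us xC s0 l ls.
  have [k xl] := (tb_comp tb l (x l)).1 (xC l).
  have psi_sum (r : seq L) : psi l (\sum_(m <- r) x m) = \sum_(m <- r) psi l (x m).
    elim: r => [|m r IH]; first by rewrite !big_nil -(scale0r 0) tb_psiZ mul0r.
    by rewrite !big_cons -[x m]scale1r (tb_lin tb) IH !scale1r.
  have := psi_sum s; rewrite s0 (bigD1_seq l) //= big1 => [|m ml].
    rewrite addr0 xl tb_psiZ (tb_dual tb) eqxx mulr1 -(scale0r 0) tb_psiZ mul0r => k0.
    by rewrite -k0 !scale0r.
  have [j ->] := (tb_comp tb m (x m)).1 (xC m).
  by rewrite tb_psiZ (tb_dual tb) eq_sym (negbTE ml) mulr0.
- move=> l m x y /(tb_comp tb)[i ->] /(tb_comp tb)[j ->]; apply/(tb_comp tb).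
  rewrite amulZl amulZr (tb_mul tb) !scalerA; by eexists.
move=> l; apply/seteqP; split=> [y [x /(tb_comp tb)[k ->] <-]|x /(tb_comp tb)[k ->]].
  by apply/(tb_comp tb); rewrite starZ (tb_star tb) scalerA; eexists.
exists ((k * (-1) ^+ tau l) *: b l); first by apply/(tb_comp tb); eexists.
by rewrite starZ (tb_star tb) scalerA -mulrA -signr_addb addbb mulr1.
Qed.

Lemma tb_fine : finely_graded A.
Proof.
split; first exact: tb_graded.
move=> l _; exists (b l); split; last by move=> y /(tb_comp tb).
  by apply/(tb_comp tb); exists 1; rewrite scale1r.
exact: tb_neq0.
Qed.

Lemma tb_ext (V : lmodType F) (p q : A -> V) : linear p -> linear q ->
  (forall l, p (b l) = q (b l)) -> p =1 q.
Proof. by move=> lp lq pq; apply: (tb_span tb) => //; apply: subspace_eq. Qed.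

(** The inverse of [b l] is [b (- l)] up to sign. Signs depend on degrees modulo doubles only, so
    [- l] can be replaced by [l] in all of them. *)
Lemma tb_invertible l x : comp A l x -> x <> 0 -> invertible x.
Proof.
move=> /(tb_comp tb)[k ->] kb0; have k0 : k != 0.
  by apply/eqP => k0; apply: kb0; rewrite k0 scale0r.
have mN m : chi (- l) m = chi l m.
  by rewrite -(tb_perl tb l m (- l)); congr (chi _ _); zmod.
have mM m : chi m (- l) = chi m l.
  by rewrite -(tb_perr tb m l (- l)); congr (chi _ _); zmod.
have mR m : chi l (m - l) = chi l (m + l).
  by rewrite -(tb_perr tb l (m - l) l); congr (chi _ _); zmod.
have mL m : chi (m - l) l = chi (m + l) l.
  by rewrite -(tb_perl tb (m - l) l l); congr (chi _ _); zmod.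
have ss (m n : L) : (-1) ^+ chi m n * (-1) ^+ chi m n = 1 :> F.
  by rewrite -signr_addb addbb.
have lin0 : linear (fun _ : A => 0 : A) by move=> c u v; rewrite scaler0 addr0.
have LL (p q : A) : linear (fun z => p *a (q *a z) - q *a (p *a z)).
  by move=> c u v; rewrite !(amulDr, amulZr) scalerBr opprD addrACA.
have RR (p q : A) : linear (fun z => z *a q *a p - z *a p *a q).
  by move=> c u v; rewrite !(amulDl, amulZl) scalerBr opprD addrACA.
exists ((k^-1 * (-1) ^+ chi l l) *: b (- l)); split.
- rewrite amulZl amulZr (tb_mul tb) mM subrr (tb_one tb) !scalerA.
  by rewrite [_ * _ * _](_ : _ = 1) ?scale1r //; apply: etrans (ss l l); field.
- rewrite amulZl amulZr (tb_mul tb) mN addNr (tb_one tb) !scalerA.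
  by rewrite [_ * _ * _](_ : _ = 1) ?scale1r //; apply: etrans (ss l l); field.
- apply: (tb_ext (LL _ _) lin0) => m.
  rewrite !(amulZl, amulZr, tb_mul tb) !scalerA !addrA addrN add0r addNr add0r !mN.
  rewrite [- l + m]addrC mR [m + l]addrC; apply: subr_eq_zero.
  by congr (_ *: _); ring.
apply: (tb_ext (RR _ _) lin0) => m.
rewrite !(amulZl, amulZr, tb_mul tb) !scalerA addrK subrK !mM mL.
by apply: subr_eq_zero; congr (_ *: _); ring.
Qed.

Lemma tb_torus : structurable A -> structurable_torus A.
Proof.
move=> strA; split=> //; [exact: tb_fine | exact: tb_invertible |].
have gT l : generated (supp (@setT A)) l.
  move=> P [_]; apply; exists (b l); last exact: tb_neq0.
  by split=> //; apply/(tb_comp tb); exists 1; rewrite scale1r.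
by apply/seteqP; split=> // l _; apply: gT.
Qed.

Lemma tb_supp_skew l : supp (skew A) l <-> tau l.
Proof.
split=> [[x [/(tb_comp tb)[k ->]]]|tl].
  rewrite /skew /= starZ (tb_star tb); case: (tau l) => // + kb0.
  rewrite scale1r => H; case: kb0; apply: (muln_inj2 two0).
  by rewrite mulr2n {1}H addNr.
exists (b l); last exact: tb_neq0.
split; first by apply/(tb_comp tb); exists 1; rewrite scale1r.
by rewrite /skew /= (tb_star tb) tl scaleN1r.
Qed.

Lemma tb_class_I : (exists l, tau l) ->
  (forall l, generated [set l | tau l]%classic l) -> class_I A.
Proof.
move=> [l0 tl0] gT.
have suppE : supp (skew A) = [set l | tau l]%classic.
  by apply/seteqP; split=> l /tb_supp_skew.
rewrite /class_I suppE; split; first by exists l0.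
have -> : generated [set l | tau l]%classic = setT by apply/seteqP; split=> // l _; apply: gT.
by case: tb_graded.
Qed.

Lemma tb_associative :
  (forall l m n, chi l m (+) chi (l + m) n = chi m n (+) chi l (m + n)) ->
  associative_alg A.
Proof.
move=> chiA.
have E (x y z : A) : asso x y z = 0.
  have lin0 : linear (fun _ : A => 0 : A) by move=> c u v; rewrite scaler0 addr0.
  have L1 (p q : A) : linear (fun x => asso x p q) by move=> c u v; rewrite assoDl assoZl.
  have L2 (p q : A) : linear (fun x => asso p x q) by move=> c u v; rewrite assoDm assoZm.
  have L3 (p q : A) : linear (asso p q) by move=> c u v; rewrite assoDr assoZr.
  move: x; apply: (tb_ext (L1 _ _) lin0) => l.
  move: y; apply: (tb_ext (L2 _ _) lin0) => m.
  move: z; apply: (tb_ext (L3 _ _) lin0) => n.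
  rewrite /asso !(tb_mul tb, amulZl, amulZr) !scalerA -!signr_addb chiA addrA.
  by rewrite [chi m n (+) _]addbC subrr.
by move=> x y z; apply: subr0_eq; rewrite -opprB -[X in - X]/(asso x y z) E oppr0.
Qed.

End TwistedBasis.

(** Here [triple x y] is left multiplication by [p] plus right multiplication by the skew element
    [r], and [triple y x] is the same with [star p] and [- r]. Left and right multiplications
    commute, so both sides reduce to commutators of the [p] and of the [r]. *)
Lemma associative_structurable (F : fieldType) (A : alginv F) :
  associative_alg A -> structurable A.
Proof.
move=> assA.
have tE (x y z : A) : triple x y z = (x *a star y) *a z + z *a (star y *a x - star x *a y).
  by rewrite /triple amulDr amulNr !assA addrA.
have stE (x y : A) : star (star y *a x - star x *a y) = - (star y *a x - star x *a y).
  by rewrite starD starN !star_anti !starK opprB.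
move=> x y z w q; pose p := x *a star y; pose r := star y *a x - star x *a y.
pose p' := z *a star w; pose r' := star w *a z - star z *a w.
have sp : star p = y *a star x by rewrite star_anti starK.
have sr : star r = - r by apply: stE.
have xy u : triple x y u = p *a u + u *a r by rewrite tE.
have yx u : triple y x u = star p *a u - u *a r by rewrite tE sp -[X in _ = _ + X]amulNr /r opprB.
have zw u : triple z w u = p' *a u + u *a r' by rewrite tE.
transitivity ((p *a p' - p' *a p) *a q + q *a (r' *a r - r *a r')).
  rewrite !(xy, zw) !(amulDl, amulDr, amulNl, amulNr) !assA; zmod.
rewrite xy yx !tE !(starD, starN, star_anti, starK, sr) /p' /r'; clearbody p r.
rewrite !(amulDl, amulDr, amulNl, amulNr, opprK) !assA; zmod.
Qed.

(** * Bases of tensor products, Laurent polynomials and scalars *)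

Section TensorBasis.
Variables (F : fieldType) (A B : galg F).
Variables (chi1 : grp A -> grp A -> bool) (tau1 : grp A -> bool)
  (b1 : grp A -> A) (psi1 : grp A -> A -> F^o).
Variables (chi2 : grp B -> grp B -> bool) (tau2 : grp B -> bool)
  (b2 : grp B -> B) (psi2 : grp B -> B -> F^o).
Hypotheses (tb1 : twisted_basis chi1 tau1 b1 psi1) (tb2 : twisted_basis chi2 tau2 b2 psi2).

(** The lift of [tpure] is linear and fixes pure tensors, so it is the identity; unfolded, it writes
    [t] as a finite sum of pure tensors. *)
Lemma tens_sum (t : tens A B) :
  t = extend (fun p : (A * B)%type => tpure p.1 p.2) (generic_quotient.repr t).
Proof.
have bt : bilinear_map (@tpure F A B).
  by split=> [b|a] c u v; [apply: tpure_linearl | apply: tpure_linearr].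
have H := @tens_linear_ext F A B (tens A B) (tlift (@tpure F A B)) id
  (tlift_linear bt) (fun _ _ _ => erefl).
by rewrite -[LHS]H // => a b; rewrite tlift_pure.
Qed.

Lemma tpureZl c (x : A) (y : B) : tpure (c *: x) y = c *: tpure x y.
Proof.
have p0 : tpure (0 : A) y = 0 by have /= := @tpure_linearl F A B y (-1) 0 0; rewrite !scaleN1r !addNr.
by have /= := tpure_linearl y c x 0; rewrite p0 !addr0.
Qed.

Lemma tpureZr c (x : A) (y : B) : tpure x (c *: y) = c *: tpure x y.
Proof.
have p0 : tpure x (0 : B) = 0 by have := @tpure_linearr F A B x (-1) 0 0; rewrite !scaleN1r !addNr.
by have := tpure_linearr x c y 0; rewrite p0 !addr0.
Qed.

Let bil l m : bilinear_map (fun x y => psi1 l x * psi2 m y : F^o).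
Proof.
split=> [y|x] c u v /=.
  by rewrite (tb_lin tb1) mulrDl -[c *: psi1 l u]/(c * psi1 l u) -mulrA.
by rewrite (tb_lin tb2) mulrDr -[c *: psi2 m u]/(c * psi2 m u) mulrCA.
Qed.

Lemma tensor_basis : @twisted_basis F (tensor A B)
  (fun l m => chi1 l.1 m.1 (+) chi2 l.2 m.2) (fun l => tau1 l.1 (+) tau2 l.2)
  (fun l => tpure (b1 l.1) (b2 l.2))
  (fun l => tlift (fun x y => psi1 l.1 x * psi2 l.2 y : F^o)).
Proof.
split=> /=.
- move=> [l m] x; split=> [|[k ->]]; last first.
    apply: (subspaceZ _ (subspace_span _)).
    apply: sub_span; exists (b1 l) => /=; first by apply/(tb_comp tb1); exists 1; rewrite scale1r.
    by exists (b2 m) => //; apply/(tb_comp tb2); exists 1; rewrite scale1r.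
  move: x; apply: span_ind; first split.
  - by exists 0; rewrite scale0r.
  - move=> c u v [i ->] [j ->]; exists (c * i + j).
    by rewrite scalerDl scalerA.
  move=> _ [x /(tb_comp tb1)[i ->] [y /(tb_comp tb2)[j ->] <-]] /=.
  by exists (i * j); rewrite tpureZl tpureZr scalerA.
- by move=> l; apply: tlift_linear.
- move=> [l m] [l' m'] /=; rewrite (tlift_pure _ _ (bil _ _)) (tb_dual tb1) (tb_dual tb2).
  by rewrite -natrM mulnb.
- move=> P sP Pb x; rewrite [x]tens_sum unlock; apply: subspace_sum => // -[y z] /=.
  apply: subspaceZ => //; move: y; apply: (tb_span tb1).
    have [P0 PZ] := sP; split=> [|c u v Pu Pv] /=.
      by rewrite -(scale0r (0 : A)) tpureZl scale0r.
    by rewrite tpure_linearl; apply: PZ.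
  move=> l; move: z; apply: (tb_span tb2).
    have [P0 PZ] := sP; split=> [|c u v Pu Pv] /=.
      by rewrite -(scale0r (0 : B)) tpureZr scale0r.
    by rewrite tpure_linearr; apply: PZ.
  by move=> m; apply: (Pb (l, m)).
- by rewrite (tb_one tb1) (tb_one tb2).
- move=> [l m] [l' m']; rewrite /amul /= tens_mul_pure (tb_mul tb1) (tb_mul tb2).
  by rewrite tpureZl tpureZr scalerA -signr_addb.
- move=> [l m]; rewrite /star /= tens_star_pure (tb_star tb1) (tb_star tb2).
  by rewrite tpureZl tpureZr scalerA -signr_addb.
- by move=> [l m] [l' m'] [k k'] /=; rewrite (tb_perl tb1) (tb_perl tb2).
by move=> [l m] [l' m'] [k k'] /=; rewrite (tb_perr tb1) (tb_perr tb2).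
Qed.

End TensorBasis.

Lemma malg_span (F : fieldType) (K : choiceType) (Q : set {malg F[K]}) :
  subspace Q -> (forall k, Q << k >>) -> forall g, Q g.
Proof.
move=> sQ Qk g; rewrite [g]monalgE; apply: subspace_sum => // k.
have -> : << g@_k *g k >> = g@_k *: << k >> :> {malg F[K]}.
  by apply/malgP => j; rewrite mcoeffZ !mcoeffU mulrnAr mulr1.
exact: subspaceZ.
Qed.

Lemma laurent_basis (F : fieldType) (r : nat) :
  @twisted_basis F (P F r) (fun _ _ => false) (fun=> false)
    (fun k => << k >> : {malg F['rV[int]_r]}) (fun k (g : {malg F['rV[int]_r]}) => g@_k).
Proof.
split=> //=.
- move=> l x; split=> [|[k ->]]; last first.
    apply: (subspaceZ _ (subspace_span _)).
    by apply: sub_span; exists l.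
  move: x; apply: span_ind; first split.
  - by exists 0; rewrite scale0r.
  - move=> c u v [i ->] [j ->]; exists (c * i + j).
    by rewrite scalerDl scalerA.
  by move=> _ [k kl <-]; exists 1; rewrite scale1r -kl.
- by move=> l c u v; rewrite mcoeffD mcoeffZ.
- by move=> l m; rewrite mcoeffU eq_sym.
- exact: malg_span.
- by move=> l m; rewrite scale1r; apply: laurent_mulU.
by move=> l; rewrite scale1r.
Qed.

Lemma scalar_basis (F : fieldType) :
  @twisted_basis F (scalar_galg F) (fun _ _ => false) (fun=> false)
    (fun _ => 1 : F^o) (fun _ (x : F^o) => x).
Proof.
split=> //=.
- by move=> l x; split=> // _; exists x; rewrite -[_ *: _]/(x * 1) mulr1.
- by move=> l m; rewrite [l]thinmx0 [m]thinmx0 eqxx.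
- by move=> Q sQ Qb x; rewrite -[x]mulr1; apply: (subspaceZ _ sQ); apply: (Qb 0).
by move=> l; rewrite expr0 scale1r.
Qed.

(** The four branches are the four terms of the Cayley-Dickson product: the order of the factors is
    exchanged, and the norm of [a] is added where a conjugate occurs. *)
Fixpoint cd_sign (i : nat) (a b : nat -> bool) : bool :=
  if i is j.+1 then
    if a j then if b j then cd_norm j a (+) cd_sign j b a else cd_sign j b a
    else if b j then cd_norm j a (+) cd_sign j a b else cd_sign j a b
  else false.

Lemma cd_norm_eq i a a' : (forall j, (j < i)%N -> a j = a' j) -> cd_norm i a = cd_norm i a'.
Proof.
elim: i => //= i IH H; rewrite (H i) // IH // => j ji.
by apply: H; apply: ltnW.
Qed.

Lemma cd_sign_eq i a a' b b' : (forall j, (j < i)%N -> a j = a' j) ->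
  (forall j, (j < i)%N -> b j = b' j) -> cd_sign i a b = cd_sign i a' b'.
Proof.
elim: i a a' b b' => //= i IH a a' b b' Ha Hb; rewrite (Ha i) // (Hb i) //.
have Ha' j : (j < i)%N -> a j = a' j by move=> ji; apply/Ha/ltnW.
have Hb' j : (j < i)%N -> b j = b' j by move=> ji; apply/Hb/ltnW.
by rewrite (cd_norm_eq Ha') (IH _ _ _ _ Ha' Hb') (IH _ _ _ _ Hb' Ha').
Qed.

Lemma scale_signs (F : fieldType) (V : lmodType F) (s t : bool) (v : V) :
  (-1) ^+ s *: ((-1) ^+ t *: v) = (-1) ^+ (s (+) t) *: v.
Proof. by rewrite scalerA -signr_addb. Qed.

(** * Bases of the Cayley-Dickson algebras *)

Section CayleyDickson.
Variables (F : fieldType) (n : nat).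
Local Notation K := (laurent_alg F n).
Local Notation L := 'rV[int]_n.

Definition even_from (i : nat) (l : L) : bool :=
  [forall j : 'I_n, (i <= j)%N ==> ~~ bits l j].

(** Before the doublings adjoining [x_i], [x_(i+1)], ... only degrees with even
    entries at these places occur. *)
Record partial_basis (D : galg_over K L) (i : nat) (b : L -> D) (psi : L -> D -> F^o) :
    Prop := PartialBasis {
  pb_comp : forall l x, over_comp D l x <->
    if even_from i l then exists k, x = k *: b l else x = 0;
  pb_lin : forall l, linear (psi l);
  pb_dual : forall l m, even_from i l -> even_from i m -> psi l (b m) = (l == m)%:R;
  pb_span : forall P : set D, subspace P -> (forall l, even_from i l -> P (b l)) ->
    forall x, P x;
  pb_one : b 0 = aone;
  pb_mul : forall l m, even_from i l -> even_from i m ->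
    b l *a b m = (-1) ^+ cd_sign i (bits l) (bits m) *: b (l + m);
  pb_star : forall l, even_from i l -> star (b l) = (-1) ^+ cd_norm i (bits l) *: b l;
  pb_incl : forall k l, even_from i l -> incl D << k >> *a b l = b (l + k *+ 2)
}.

(** Since [t_i] has degree twice [eps i], the Laurent monomial of even degree [l] has exponent
    [half l]. *)
Definition half (l : L) : L := \row_j divz (l 0 j) 2.

Lemma even_from0 l : even_from 0 l -> half l *+ 2 = l.
Proof.
move/forallP => H; apply/rowP => j; rewrite mulr2n !mxE.
have := H j; rewrite bits_ord /= => /negbTE/oddz_even[q ->].
have -> : q *+ 2 = (q * 2)%Z by rewrite mulr2n; ring.
by rewrite mulzK //; ring.
Qed.

Lemma half_double l : half (l *+ 2) = l.
Proof.
apply/rowP => j; rewrite mulr2n !mxE.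
have -> : l 0 j + l 0 j = (l 0 j * 2) by ring.
by rewrite mulzK.
Qed.

Lemma double_even l : even_from 0 (l *+ 2).
Proof. by apply/forallP => j; rewrite mulr2n bitsD addbb implybT. Qed.

Lemma laurent_partial_basis : @partial_basis (laurent_over F n) 0
  (fun l => << half l >> : {malg F[L]}) (fun l (g : {malg F[L]}) => g@_(half l)).
Proof.
split.
- move=> l x; split.
    move: x; apply: span_ind; first split.
    + by case: ifP => // _; exists 0; rewrite scale0r.
    + move=> c u v; case: ifP => _; last by move=> -> ->; rewrite scaler0 addr0.
      by move=> [i ->] [j ->]; exists (c * i + j); rewrite scalerDl scalerA.
    move=> _ [k <- <-]; rewrite double_even half_double.
    by exists 1; rewrite scale1r.
  case: ifP => [el [k ->]|_ ->]; last by move=> Q [[]].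
  apply: (subspaceZ _ (subspace_span _)); apply: sub_span.
  by exists (half l) => //; apply: even_from0.
- by move=> l c u v; rewrite mcoeffD mcoeffZ.
- move=> l m el em; rewrite mcoeffU; congr (_%:R); congr nat_of_bool.
  apply/eqP/eqP => [H|->//]; by rewrite -(even_from0 el) -(even_from0 em) H.
- move=> Q sQ Qb; apply: (malg_span sQ) => k.
  by have := Qb _ (double_even k); rewrite half_double.
- by congr << _ >>; apply/rowP => j; rewrite !mxE.
- move=> l m el em; rewrite /= expr0 scale1r; have /= -> := laurent_mulU F (half l) (half m).
  by congr << _ >>; rewrite -[in RHS](even_from0 el) -[in RHS](even_from0 em) -mulrnDl half_double.
- by move=> l _; rewrite /= expr0 scale1r.
move=> k l el; have /= -> := laurent_mulU F k (half l).
by congr << _ >>; rewrite -[in RHS](even_from0 el) -mulrnDl half_double addrC.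
Qed.

Lemma bits_eps i j : (i < n)%N -> bits (eps n i) j = (j == i).
Proof.
move=> lt_in; rewrite /bits; case: insubP => [k _ <-|].
  by rewrite mxE; case: eqP.
by rewrite -leqNgt => nj; apply/esym/negbTE; rewrite neq_ltn (leq_trans lt_in nj) orbT.
Qed.

Lemma bits_epsB i l j : (i < n)%N -> bits (l - eps n i) j = bits l j (+) (j == i).
Proof.
move=> lt_in; rewrite bitsD -(bits_eps j lt_in); congr (_ (+) _).
by rewrite /bits; case: insub => // k; rewrite mxE oddzN.
Qed.

Lemma even_fromS i l : (i < n)%N -> even_from i l = even_from i.+1 l && ~~ bits l i.
Proof.
move=> lt_in; apply/forallP/andP => [H|[/forallP H bi] j].
  split; last by have := H (Ordinal lt_in); rewrite leqnn.
  by apply/forallP => j; apply/implyP => ij; apply: (implyP (H j)); apply: ltnW.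
apply/implyP; rewrite leq_eqVlt => /orP[/eqP<-//|ij].
by have := H j; rewrite ij.
Qed.

Lemma even_from_eps i l : (i < n)%N ->
  even_from i (l - eps n i) = even_from i.+1 l && bits l i.
Proof.
move=> lt_in; rewrite even_fromS // bits_epsB // eqxx addbT negbK; congr (_ && _).
apply: eq_forallb => j; case ij: (i < j)%N => //=.
by rewrite bits_epsB // gtn_eqF // addbF.
Qed.

Lemma even_fromD i l m : even_from i l -> even_from i m -> even_from i (l + m).
Proof.
move=> /forallP el /forallP em; apply/forallP => j; apply/implyP => ij.
by have := el j; have := em j; rewrite bitsD ij /= => /negbTE-> /negbTE->.
Qed.

Section Step.
Variables (D : galg_over K L) (i : nat) (b : L -> D) (psi : L -> D -> F^o).
Hypothesis lt_in : (i < n)%N.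
Hypothesis pb : partial_basis i b psi.
Local Notation dl := (eps n i).
Local Notation D' := (cd_step D (tvar F n i) dl).

Definition step_basis (l : L) : (D * D)%type :=
  if bits l i then (0, b (l - dl)) else (b l, 0).

Definition step_dual (l : L) (x : (D * D)%type) : F^o :=
  if bits l i then psi (l - dl) x.2 else psi l x.1.

Lemma step_partial_basis : @partial_basis D' i.+1 step_basis step_dual.
Proof.
have ev0 l : even_from i.+1 l -> bits l i = false -> even_from i l.
  by move=> el bi; rewrite even_fromS // el bi.
have ev1 l : even_from i.+1 l -> bits l i -> even_from i (l - dl).
  by move=> el bi; rewrite even_from_eps // el bi.
have sE (l l' m m' : L) : (forall j, (j < i)%N -> bits l j = bits l' j) ->
    (forall j, (j < i)%N -> bits m j = bits m' j) ->
    cd_sign i (bits l) (bits m) = cd_sign i (bits l') (bits m') by move=> *; apply: cd_sign_eq.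
have bB l j : (j < i)%N -> bits (l - dl) j = bits l j.
  by move=> ji; rewrite bits_epsB // ltn_eqF // addbF.
have pair0 (x y : D) : ((x, y) : D') = ((x, 0) : D') + ((0, y) : D').
  by congr pair; rewrite /= ?addr0 ?add0r.
have scalep c (x y : D) : c *: ((x, y) : D') = (c *: x, c *: y) by [].
split.
- move=> l [x y]; have -> : over_comp D' l (x, y) = (over_comp D l x /\ over_comp D (l - dl) y) by [].
  rewrite !(pb_comp pb) even_fromS // even_from_eps // /step_basis.
  case: (even_from i.+1 l); case: (bits l i) => /=.
  + split=> [[-> [k ->]]|[k]]; first by exists k; rewrite scalep scaler0.
    by rewrite scalep scaler0 => -[-> ->]; split=> //; exists k.
  + split=> [[[k ->] ->]|[k]]; first by exists k; rewrite scalep scaler0.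
    by rewrite scalep scaler0 => -[-> ->]; split=> //; exists k.
  + by split=> [[-> ->]|[-> ->]].
  + by split=> [[-> ->]|[-> ->]].
- move=> l c [x y] [x' y']; rewrite /step_dual; case: ifP => _; exact: (pb_lin pb).
- move=> l m el em; rewrite /step_dual /step_basis.
  have psi0 k : psi k 0 = 0 by have := pb_lin pb k (-1) 0 0; rewrite !scaleN1r !addNr.
  case bl: (bits l i); case bm: (bits m i) => /=.
  + by rewrite (pb_dual pb) ?ev1 // (inj_eq (addIr _)).
  + by rewrite psi0; case: eqP => // e; rewrite e bm in bl.
  + by rewrite psi0; case: eqP => // e; rewrite e bm in bl.
  + by rewrite (pb_dual pb) ?ev0.
- move=> Q sQ Qb [x y]; rewrite pair0; apply: (subspaceD sQ).
    move: x; apply: (pb_span pb).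
      have [Q0 QZ] := sQ; split=> // c u v Qu Qv.
      by have := QZ c _ _ Qu Qv; congr Q; rewrite scalep; congr pair; rewrite /= scaler0 addr0.
    move=> l; rewrite even_fromS // => /andP[el /negbTE bi].
    by have := Qb _ el; rewrite /step_basis bi.
  move: y; apply: (pb_span pb).
    have [Q0 QZ] := sQ; split=> // c u v Qu Qv.
    by have := QZ c _ _ Qu Qv; congr Q; rewrite scalep; congr pair; rewrite /= scaler0 addr0.
  move=> l el; have := el; rewrite even_fromS // => /andP[el1 /negbTE bi].
  have := Qb (l + dl); rewrite /step_basis bitsD bi bits_eps // eqxx addrK; apply.
  by have := even_from_eps (l + dl) lt_in; rewrite addrK el => /esym/andP[].
- by rewrite /step_basis bits0 (pb_one pb).
- move=> l m el em; rewrite /step_basis bitsD.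
  have E (x y z t : D) : ((x, y) : D') *a ((z, t) : D') =
    (x *a z + incl D (tvar F n i) *a (t *a star y), star x *a t + z *a y) by [].
  have st : (@star F D 0 = 0) by exact: star0.
  case bl: (bits l i); case bm: (bits m i);
    rewrite E st !(amul0l, amul0r, addr0, add0r) /= bl bm scalep scaler0.
  + congr pair; rewrite (pb_star pb) ?ev1 // amulZr (pb_mul pb) ?ev1 // amulZr amulZr scale_signs.
    rewrite /tvar (pb_incl pb) ; last exact: even_fromD (ev1 _ em bm) (ev1 _ el bl).
    rewrite (cd_norm_eq (bB l)) (sE _ m _ l (bB m) (bB l)).
    by congr (_ *: b _); zmod.
  + congr pair; rewrite (pb_mul pb) ?ev1 ?ev0 //; rewrite (sE m m _ l (fun _ _ => erefl) (bB l)).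
    by congr (_ *: b _); zmod.
  + congr pair; rewrite (pb_star pb) ?ev0 // amulZl (pb_mul pb) ?ev1 ?ev0 // scale_signs.
    rewrite (sE l l _ m (fun _ _ => erefl) (bB m)).
    by congr (_ *: b _); zmod.
  + by rewrite (pb_mul pb) ?ev0.
- move=> l el; rewrite /step_basis /=; case bi: (bits l i) => /=.
    by rewrite scaleN1r; congr pair; rewrite /= ?(star0, oppr0).
  by rewrite scalep scaler0 -(pb_star pb) ?ev0 //; congr pair; rewrite /= oppr0.
move=> k l el; rewrite /step_basis bitsD mulr2n bitsD addbb addbF.
have E (x z t : D) : ((x, 0) : D') *a ((z, t) : D') = (x *a z, star x *a t).
  by rewrite /amul /= /cd_mul /= (star0 D) !(amul0r, addr0).
have -> : incl D' << k >> = ((incl D << k >>, 0) : D') by [].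
case bi: (bits l i); rewrite E incl_star ?amul0r; congr pair; last by rewrite (pb_incl pb) ?ev0.
rewrite (pb_incl pb); last exact: ev1.
by congr b; zmod.
Qed.

End Step.

Lemma CDP_partial_basis i : (i <= n)%N -> exists b psi,
  @partial_basis (foldl (fun D j => cd_step D (tvar F n j) (eps n j)) (laurent_over F n)
    (seq.iota 0 i)) i b psi.
Proof.
elim: i => [_|i IH lt_in]; first by eexists; eexists; apply: laurent_partial_basis.
have [b [psi pb]] := IH (ltnW lt_in).
have -> : seq.iota 0 i.+1 = seq.iota 0 i ++ [:: i] by rewrite -addn1 iotaD.
rewrite foldl_cat; exists (step_basis i b), (step_dual i psi).
exact: step_partial_basis.
Qed.

End CayleyDickson.

Lemma bits_period n (l k : 'rV[int]_n) : bits (l + k + k) =1 bits l.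
Proof. by move=> j; rewrite !bitsD -addbA addbb addbF. Qed.

Lemma partial_twisted_basis (F : fieldType) n (D : galg_over (laurent_alg F n) 'rV[int]_n)
    b psi : @partial_basis F n D n b psi ->
  @twisted_basis F (@GAlg F D 'rV[int]_n (over_comp D))
  (fun l m => cd_sign n (bits l) (bits m)) (fun l => cd_norm n (bits l)) b psi.
Proof.
move=> pb; have ev (l : 'rV[int]_n) : even_from n l.
  by apply/forallP => j; rewrite leqNgt ltn_ord.
split=> [l x|l|l m|Q sQ Qb x||l m|l|l m k|l m k].
- by have := pb_comp pb l x; rewrite ev.
- exact: (pb_lin pb l).
- exact: (pb_dual pb (ev l) (ev m)).
- by apply: (pb_span pb sQ) => l _; apply: Qb.
- exact: (pb_one pb).
- exact: (pb_mul pb (ev l) (ev m)).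
- exact: (pb_star pb (ev l)).
- by apply: cd_sign_eq => // j _; apply: bits_period.
- by apply: cd_sign_eq => // j _; apply: bits_period.
Qed.

Definition cd_bits (F : fieldType) (n : nat) : grp (C F n) -> nat -> bool :=
  if n is m.+1 then @bits m.+1 else @bits 0.

Lemma CD_basis (F : fieldType) n : exists b psi, @twisted_basis F (C F n)
  (fun l m => cd_sign n (cd_bits l) (cd_bits m)) (fun l => cd_norm n (cd_bits l)) b psi.
Proof.
case: n => [|n]; first by do 2 eexists; apply: scalar_basis.
have [b [psi pb]] := @CDP_partial_basis F n.+1 n.+1 (leqnn _).
exists b, psi; exact: partial_twisted_basis pb.
Qed.

Lemma Cstar2_basis (F : fieldType) : exists b psi, @twisted_basis F (Cstar2 F)
  (fun l m => cd_sign 2 (bits l) (bits m)) (fun l => bits l 1 && bits l 0) b psi.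
Proof.
(* Only the involution differs from [C(2)]. It is computed on pairs over the first doubling, so a
   basis at that stage is required too. *)
have [b [psi pb]] := @CDP_partial_basis F 2 1 isT.
have tb2 := partial_twisted_basis (step_partial_basis (isT : (1 < 2)%N) pb).
exists (step_basis 1 b), (step_dual 1 psi); split.
- exact: (tb_comp tb2).
- exact: (tb_lin tb2).
- exact: (tb_dual tb2).
- exact: (tb_span tb2).
- exact: (tb_one tb2).
- exact: (tb_mul tb2).
- move=> l; set D1 := foldl _ _ _ in b psi pb tb2 *.
  rewrite [star _]/(cd_star' _) /cd_star' /step_basis; case: ifP => bl /=; last first.
    rewrite expr0 scale1r; congr pair; exact: (star0 D1).
  have el : even_from 1 (l - eps 2 1).
    by rewrite even_from_eps // bl andbT; apply/forallP => j; rewrite leqNgt ltn_ord.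
  have st := pb_star pb el.
  have E : cd_norm 1 (bits (l - eps 2 1)) = bits l 0.
    by rewrite /= bits_epsB // addbF; case: (bits l 0).
  rewrite E in st.
  transitivity ((0, (-1) ^+ bits l 0 *: b (l - eps 2 1)) : Cstar2 F).
    by congr pair.
  by congr pair; rewrite scaler0.
- exact: (tb_perl tb2).
- exact: (tb_perr tb2).
Qed.

(** * The nonassociative models are structurable *)

Section TripleSigns.
Variables (G : Type) (add : G -> G -> G) (chi : G -> G -> bool) (tau : G -> bool).

Definition triple_signs (x y z : G) : seq bool :=
  [:: tau y (+) chi x y (+) chi (add x y) z;
      tau y (+) chi z y (+) chi (add z y) x;
      ~~ (tau x (+) chi z x (+) chi (add z x) y)].

Definition products_signs (s t : seq bool) : seq bool :=
  [seq a (+) b | a <- s, b <- t].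

(** The signs of the thirty-six products in the structurable identity, all moved
    to one side. *)
Definition identity_signs (x y z w q : G) : seq bool :=
  products_signs (triple_signs z w q) (triple_signs x y (add (add z w) q)) ++
  map negb (products_signs (triple_signs x y q) (triple_signs z w (add (add x y) q))) ++
  map negb (products_signs (triple_signs x y z) (triple_signs (add (add x y) z) w q)) ++
  products_signs (triple_signs y x w) (triple_signs z (add (add y x) w) q).

End TripleSigns.

(** Equal numbers of both signs make their sum vanish in every field, and this can be computed. *)
Definition balanced (u : seq bool) : bool := count id u == count negb u.

Section SignSums.
Variable F : fieldType.

Definition sign_sum (u : seq bool) : F := \sum_(s <- u) (-1) ^+ s.

Lemma sign_sum_cat u v : sign_sum (u ++ v) = sign_sum u + sign_sum v.
Proof. exact: big_cat. Qed.

Lemma sign_sum_negb u : sign_sum (map negb u) = - sign_sum u.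
Proof.
rewrite /sign_sum big_map -sumrN; apply: eq_bigr => s _.
by case: s; rewrite /= ?opprK.
Qed.

Lemma sign_sum_products u v : sign_sum (products_signs u v) = sign_sum u * sign_sum v.
Proof.
elim: u => [|a u IH]; first by rewrite /sign_sum !big_nil mul0r.
rewrite /products_signs allpairs_cons sign_sum_cat IH /sign_sum big_cons mulrDl; congr (_ + _).
by rewrite big_map mulr_sumr; apply: eq_bigr => b _; rewrite signr_addb.
Qed.

Lemma sign_sum_balanced u : balanced u -> sign_sum u = 0.
Proof.
suff -> : sign_sum u = (count negb u)%:R - (count id u)%:R.
  by move=> /eqP ->; rewrite subrr.
rewrite /sign_sum; elim: u => [|s u IH]; first by rewrite big_nil subrr.
by rewrite big_cons IH; case: s; rewrite /= !natrD; ring.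
Qed.

End SignSums.

Lemma linearZ1 (F : fieldType) (V W : lmodType F) (f : V -> W) :
  linear f -> forall c u, f (c *: u) = c *: f u.
Proof.
move=> lf c u; have f0 : f 0 = 0 by have := lf (-1) 0 0; rewrite !scaleN1r !addNr.
by rewrite -[c *: u]addr0 lf f0 addr0.
Qed.

Section StructurableBasis.
Variables (F : fieldType) (A : galg F).
Variables (chi : grp A -> grp A -> bool) (tau : grp A -> bool)
  (b : grp A -> A) (psi : grp A -> A -> F^o).
Hypothesis tb : twisted_basis chi tau b psi.

Lemma triple_linear1 (y z : A) : linear (fun x => triple x y z).
Proof.
move=> c u v; rewrite /triple starD starZ !(amulDl, amulDr, amulZl, amulZr).
by rewrite [in LHS]addrACA -[in LHS]scalerDr opprD [in LHS]addrACA -scalerBr.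
Qed.

Lemma triple_linear2 (x z : A) : linear (fun y => triple x y z).
Proof.
move=> c u v; rewrite /triple starD starZ !(amulDl, amulDr, amulZl, amulZr).
by rewrite [in LHS]addrACA -[in LHS]scalerDr opprD [in LHS]addrACA -scalerBr.
Qed.

Lemma triple_linear3 (x y : A) : linear (triple x y).
Proof.
move=> c u v; rewrite /triple !(amulDl, amulDr, amulZl, amulZr).
by rewrite [in LHS]addrACA -[in LHS]scalerDr opprD [in LHS]addrACA -scalerBr.
Qed.

Lemma tb_triple x y z :
  triple (b x) (b y) (b z) = sign_sum F (triple_signs +%R chi tau x y z) *: b (x + y + z).
Proof.
rewrite /triple !(tb_star tb) !(amulZl, amulZr, tb_mul tb) !scale_signs.
have e1 : z + y + x = x + y + z by zmod.
have e2 : z + x + y = x + y + z by zmod.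
rewrite e1 e2 /sign_sum !big_cons big_nil addr0 addrA !scalerDl; congr (_ + _ + _).
by rewrite -scaleNr; congr (_ *: _); case: (_ (+) _); rewrite ?opprK.
Qed.

Lemma tb_structurable :
  (forall x y z w q, balanced (identity_signs +%R chi tau x y z w q)) -> structurable A.
Proof.
move=> bal x y z w q.
move: x; apply: (tb_ext tb) => [c u v|c u v|x].
- by rewrite !(triple_linear1, triple_linear3) scalerBr opprD addrACA.
- by rewrite !(triple_linear1, triple_linear2, triple_linear3) scalerBr opprD addrACA.
move: y; apply: (tb_ext tb) => [c u v|c u v|y].
- by rewrite !(triple_linear2, triple_linear3) scalerBr opprD addrACA.
- by rewrite !(triple_linear1, triple_linear2, triple_linear3) scalerBr opprD addrACA.
move: z; apply: (tb_ext tb) => [c u v|c u v|z].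
- by rewrite !(triple_linear1, triple_linear3) scalerBr opprD addrACA.
- by rewrite !(triple_linear1, triple_linear3) scalerBr opprD addrACA.
move: w; apply: (tb_ext tb) => [c u v|c u v|w].
- by rewrite !(triple_linear2, triple_linear3) scalerBr opprD addrACA.
- by rewrite !(triple_linear2, triple_linear3) scalerBr opprD addrACA.
move: q; apply: (tb_ext tb) => [c u v|c u v|q].
- by rewrite !triple_linear3 scalerBr opprD addrACA.
- by rewrite !triple_linear3 scalerBr opprD addrACA.
have tZ1 (c : F) (u v t : A) : triple (c *: u) v t = c *: triple u v t.
  exact: (linearZ1 (triple_linear1 v t) c).
have tZ2 (c : F) (u v t : A) : triple u (c *: v) t = c *: triple u v t.
  exact: (linearZ1 (triple_linear2 u t) c).
have tZ3 (c : F) (u v t : A) : triple u v (c *: t) = c *: triple u v t.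
  exact: (linearZ1 (triple_linear3 u v) c).
rewrite !(tb_triple, tZ1, tZ2, tZ3) !scalerA.
have -> : x + y + (z + w + q) = x + y + z + w + q by zmod.
have -> : z + w + (x + y + q) = x + y + z + w + q by zmod.
have -> : z + (y + x + w) + q = x + y + z + w + q by zmod.
rewrite -!scalerBl; congr (_ *: _); apply: subr0_eq.
have := sign_sum_balanced F (bal x y z w q).
rewrite !(sign_sum_cat, sign_sum_negb, sign_sum_products) => e.
by rewrite -[RHS]e; ring.
Qed.

End StructurableBasis.

Definition trivial_signs : seq bool :=
  identity_signs (fun _ _ => tt) (fun _ _ => false) (fun=> false) tt tt tt tt tt.

(** Multiplying two twisted bases adds their signs, except those of the identity
    itself, which [trivial_signs] corrects for. *)
Fixpoint combine_signs (u v w : seq bool) : seq bool :=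
  match u, v, w with
  | a :: u', b :: v', c :: w' => a (+) b (+) c :: combine_signs u' v' w'
  | _, _, _ => [::]
  end.

Lemma combine_cat u v w u' v' w' : size u = size v -> size u = size w ->
  combine_signs (u ++ u') (v ++ v') (w ++ w') = combine_signs u v w ++ combine_signs u' v' w'.
Proof.
elim: u v w => [|a u IH] [|b v] [|c w] //= [uv] [uw].
by rewrite IH.
Qed.

Lemma combine_negb u v w :
  combine_signs (map negb u) (map negb v) (map negb w) = map negb (combine_signs u v w).
Proof.
elim: u v w => [|a u IH] [|b v] [|c w] //=.
by rewrite IH !addNb !addbN !negbK addNb.
Qed.

Lemma combine_shift u v w a b c : combine_signs (map (addb a) u) (map (addb b) v) (map (addb c) w)
  = map (addb (a (+) b (+) c)) (combine_signs u v w).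
Proof.
elim: u v w => [|a' u IH] [|b' v] [|c' w] //=.
by rewrite IH; congr (_ :: _); rewrite (addbACA a) addbACA.
Qed.

Lemma combine_products u v w u' v' w' : size u = size v -> size u = size w ->
    size u' = size v' -> size u' = size w' ->
  combine_signs (products_signs u u') (products_signs v v') (products_signs w w')
  = products_signs (combine_signs u v w) (combine_signs u' v' w').
Proof.
move=> + + uv' uw'; elim: u v w => [|a u IH] [|b v] [|c w] //= [uv] [uw].
have pE s (t t' : seq bool) : products_signs (s :: t) t' = map (addb s) t' ++ products_signs t t'.
  exact: allpairs_cons.
by rewrite !pE combine_cat ?size_map // combine_shift IH.
Qed.

Lemma combine_identity (G G1 G2 : Type) (add : G -> G -> G) add1 add2
    (p1 : G -> G1) (p2 : G -> G2) chi tau chi1 tau1 chi2 tau2 :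
  (forall l m, p1 (add l m) = add1 (p1 l) (p1 m)) ->
  (forall l m, p2 (add l m) = add2 (p2 l) (p2 m)) ->
  (forall l m, chi l m = chi1 (p1 l) (p1 m) (+) chi2 (p2 l) (p2 m)) ->
  (forall l, tau l = tau1 (p1 l) (+) tau2 (p2 l)) ->
  forall x y z w q, identity_signs add chi tau x y z w q =
    combine_signs (identity_signs add1 chi1 tau1 (p1 x) (p1 y) (p1 z) (p1 w) (p1 q))
      (identity_signs add2 chi2 tau2 (p2 x) (p2 y) (p2 z) (p2 w) (p2 q)) trivial_signs.
Proof.
move=> D1 D2 chiE tauE x y z w q.
pose s0 := triple_signs (fun _ _ => tt) (fun _ _ => false) (fun=> false) tt tt tt.
have tE a b c : triple_signs add chi tau a b c =
    combine_signs (triple_signs add1 chi1 tau1 (p1 a) (p1 b) (p1 c))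
      (triple_signs add2 chi2 tau2 (p2 a) (p2 b) (p2 c)) s0.
  rewrite /triple_signs /s0 /= !chiE !tauE !D1 !D2.
  have E (i i' j j' k k' : bool) : i (+) i' (+) (j (+) j') (+) (k (+) k')
      = i (+) j (+) k (+) (i' (+) j' (+) k').
    by rewrite (addbACA i) addbACA.
  by rewrite !E !addbF addbT addbN addNb negbK.
rewrite /identity_signs /trivial_signs /identity_signs !tE !D1 !D2.
by rewrite -!combine_products // -!combine_negb -!combine_cat.
Qed.

Section OctonionSigns.

Definition bits3_fun (p : bits3) (i : nat) : bool :=
  match i with 0 => p.1.1 | 1 => p.1.2 | 2 => p.2 | _ => false end.

Definition oct_sign (p q : bits3) : bool := cd_sign 3 (bits3_fun p) (bits3_fun q).
Definition oct_norm (p : bits3) : bool := cd_norm 3 (bits3_fun p).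

Local Notation oct_signs := (identity_signs addb3 oct_sign oct_norm).

(** Conditionals in place of [&&] let [vm_compute] stop at the first difference. *)
Fixpoint eq_signs (u v : seq bool) : bool :=
  match u, v with
  | [::], [::] => true
  | a :: u', b :: v' =>
    if a then if b then eq_signs u' v' else false
    else if b then false else eq_signs u' v'
  | _, _ => false
  end.

Lemma eq_signsP u v : eq_signs u v -> u = v.
Proof. by elim: u v => [|[] u IH] [|[] v] //= /IH->. Qed.

Fixpoint mem_signs (u : seq bool) (D : seq (seq bool)) : bool :=
  if D is v :: D' then if eq_signs u v then true else mem_signs u D' else false.

Lemma mem_signsP u D : mem_signs u D -> u \in D.
Proof.
elim: D => //= v D IH; rewrite inE; case E: (eq_signs u v).
  by rewrite (eq_signsP E) eqxx.
by move/IH->; rewrite orbT.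
Qed.

(** These few quintuples of basis octonions produce all sign patterns up to negation. *)
Definition oct_classes : seq (seq bool) := Eval vm_compute in
  let b3 n : bits3 := (odd n, odd n./2, odd n./2./2) in
  let D := [seq oct_signs (b3 0) y.1 y.2 z.1 z.2 |
     y <- [seq (b3 y, b3 z) | y <- [:: 0; 1; 2], z <- [:: 0; 2; 4; 3]],
     z <- [seq (b3 z, b3 w) | z <- [:: 2; 3; 7], w <- [:: 0; 1; 2; 4]]]%N in
  undup (D ++ [seq [seq ~~ b | b <- v] | v <- D]).

Lemma oct_signs_classes x y z w q : oct_signs x y z w q \in oct_classes.
Proof.
apply: mem_signsP; move: x y z w q.
have : all3 (fun x => all3 (fun y => all3 (fun z => all3 (fun w => all3 (fun q =>
  mem_signs (oct_signs x y z w q) oct_classes))))) by vm_compute.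
move=> H x y z w q.
by move: H => /all3P/(_ x)/all3P/(_ y)/all3P/(_ z)/all3P/(_ w)/all3P.
Qed.

Lemma oct_classes_balanced u v : u \in oct_classes -> v \in oct_classes ->
  balanced (combine_signs u v trivial_signs).
Proof.
have : all (fun u => all (fun v => balanced (combine_signs u v trivial_signs)) oct_classes)
  oct_classes by vm_compute.
by move=> /allP H /H /allP; apply.
Qed.

Lemma double_octonionic_balanced (L : zmodType) (p1 p2 : L -> bits3) chi tau :
  (forall l m, p1 (l + m) = addb3 (p1 l) (p1 m)) ->
  (forall l m, p2 (l + m) = addb3 (p2 l) (p2 m)) ->
  (forall l m, chi l m = oct_sign (p1 l) (p1 m) (+) oct_sign (p2 l) (p2 m)) ->
  (forall l, tau l = oct_norm (p1 l) (+) oct_norm (p2 l)) ->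
  forall x y z w q : L, balanced (identity_signs +%R chi tau x y z w q).
Proof.
move=> D1 D2 chiE tauE x y z w q; rewrite (combine_identity D1 D2 chiE tauE).
by apply: oct_classes_balanced; apply: oct_signs_classes.
Qed.

End OctonionSigns.

(** * Associativity and class I for the models *)

Definition cocycle (L : zmodType) (chi : L -> L -> bool) : Prop :=
  forall l m n, chi l m (+) chi (l + m) n = chi m n (+) chi l (m + n).

Lemma cd_sign_cocycle n (a b c ab bc : nat -> bool) : (n <= 2)%N ->
  (forall j, ab j = a j (+) b j) -> (forall j, bc j = b j (+) c j) ->
  cd_sign n a b (+) cd_sign n ab c = cd_sign n b c (+) cd_sign n a bc.
Proof.
case: n => [|[|[|]]] //= _ abE bcE; rewrite !abE !bcE;
  by case: (a 0) (b 0) (c 0) => [] [] []; case: (a 1) (b 1) (c 1) => [] [] [].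
Qed.

Lemma cd_bitsD (F : fieldType) n (l m : grp (C F n)) j :
  cd_bits (l + m) j = cd_bits l j (+) cd_bits m j.
Proof. by case: n l m => [|n] l m; apply: bitsD. Qed.

Section ModelBases.
Variable F : fieldType.
Hypothesis two0 : 2%:R != 0 :> F.

Definition associative_basis (A : galg F) (tau : grp A -> bool) : Prop :=
  exists chi b psi, @twisted_basis F A chi tau b psi /\ cocycle chi.

Lemma associative_basis_tensor (A B : galg F) tau1 tau2 :
  @associative_basis A tau1 -> @associative_basis B tau2 ->
  @associative_basis (tensor A B) (fun l => tau1 l.1 (+) tau2 l.2).
Proof.
move=> [chi1 [b1 [psi1 [tb1 co1]]]] [chi2 [b2 [psi2 [tb2 co2]]]].
do 3 eexists; split; first exact: tensor_basis tb1 tb2.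
by move=> l m n /=; rewrite addbACA co1 co2 addbACA.
Qed.

Lemma CD_associative_basis n : (n <= 2)%N ->
  @associative_basis (C F n) (fun l => cd_norm n (cd_bits l)).
Proof.
move=> n2; have [b [psi tb]] := CD_basis F n.
exists (fun l m => cd_sign n (cd_bits l) (cd_bits m)), b, psi; split=> // l m k.
by apply: cd_sign_cocycle => // j; apply: cd_bitsD.
Qed.

Lemma base_associative_basis b : @associative_basis (base_galg F b) (@base_norm F b).
Proof.
case: b.
- by do 3 eexists; split; first exact: scalar_basis.
- have [chi [b [psi [tb co]]]] := @CD_associative_basis 1 isT; exists chi, b, psi; split=> //.
  by have -> : @base_norm F BaseC1 = fun l => cd_norm 1 (cd_bits l)
    by apply/funext => l /=; case: bits.
have [b [psi tb]] := Cstar2_basis F.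
exists (fun l m : 'rV[int]_2 => cd_sign 2 (bits l) (bits m)), b, psi; split.
  by have -> : @base_norm F BaseCstar2 = fun l : 'rV[int]_2 => bits l 1 && bits l 0
    by apply/funext => l /=; rewrite andbC.
by move=> l m k; apply: cd_sign_cocycle => // j; apply: bitsD.
Qed.

Lemma model_associative_basis k b r :
  @associative_basis (model_a k (base_galg F b) r) (@model_norm F k b r).
Proof.
elim: k => [|k IH].
  have lb : @associative_basis (P F r) (fun=> false).
    by do 3 eexists; split; first exact: laurent_basis.
  have := associative_basis_tensor (base_associative_basis b) lb.
  by have -> : @model_norm F 0 b r = fun l => @base_norm F b l.1 (+) false
    by apply/funext => l; rewrite addbF.
exact: (associative_basis_tensor (@CD_associative_basis 2 isT) IH).
Qed.

Lemma tb_tau0 (A : galg F) chi tau b psi : @twisted_basis F A chi tau b psi -> tau 0 = false.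
Proof.
move=> tb; case t0: (tau 0) => //; case: (tb_neq0 tb (l := 0)).
apply: (muln_inj2 two0); have := tb_star tb 0.
by rewrite t0 (tb_one tb) star1 scaleN1r mulr2n => {2}->; rewrite subrr.
Qed.

(** With [e] the degree of the first generator, (x, 0) is skew or the difference of the skew degrees
    (x + e, 0) and (e, 0); likewise (0, y) is skew or the difference of (e, y) and (e, 0). *)
Lemma tensor_CD_class_I n (A : galg F) chi tau b psi :
  @twisted_basis F A chi tau b psi -> class_I (tensor (C F n.+1) A).
Proof.
move=> tbA; have tau0 := tb_tau0 tbA.
have [b1 [psi1 tb1]] := CD_basis F n.+1.
pose e := eps n.+1 0.
have ne (a : 'rV[int]_n.+1) : cd_norm n.+1 (bits a) = false -> cd_norm n.+1 (bits (a + e)).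
  move=> na; rewrite cd_norm_bits; apply/existsP; exists 0.
  rewrite -bits_ord bitsD bits_eps // eqxx addbT.
  apply/negP => a0; move/negbT/negP: na; apply; rewrite cd_norm_bits.
  by apply/existsP; exists 0; rewrite -bits_ord.
have n0 : cd_norm n.+1 (bits (0 : 'rV[int]_n.+1)) = false.
  by rewrite cd_norm_bits; apply/existsP => -[i]; rewrite mxE.
have nE : cd_norm n.+1 (bits e) by have := ne 0 n0; rewrite add0r.
apply: (tb_class_I two0 (tensor_basis tb1 tbA)).
  by exists (e, 0) => /=; rewrite tau0 addbF.
move=> [a m] Q [[Q0 QB] SQ'].
have SQ (x : 'rV[int]_n.+1) y : cd_norm n.+1 (bits x) (+) tau y -> Q (x, y).
  by move=> xy; exact: (SQ' (x, y) xy).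
have Qe (x : 'rV[int]_n.+1) : Q (x, 0).
  case nx: (cd_norm n.+1 (bits x)); first by apply: SQ; rewrite nx tau0.
  have -> : (x, 0) = (x + e, 0) - (e, 0) :> 'rV[int]_n.+1 * grp A.
    by congr pair; rewrite /= ?addrK ?subrr.
  by apply: QB; apply: SQ; rewrite tau0 addbF; [apply: ne|].
have Qm x : Q (0, x).
  case tx: (tau x); first by apply: SQ; rewrite n0 tx.
  have -> : (0, x) = (e, x) - (e, 0) :> 'rV[int]_n.+1 * grp A.
    by congr pair; rewrite /= ?subr0 ?subrr.
  by apply: QB => //; apply: SQ; rewrite nE tx.
have -> : (a, m) = (a, 0) - (0, - m) :> 'rV[int]_n.+1 * grp A.
  by congr pair; rewrite /= ?subr0 ?sub0r ?opprK.
exact: QB.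
Qed.

End ModelBases.

(** * Classification of the tori *)

Lemma eq_twisted_basis (F : fieldType) (A : galg F) chi tau tau' b psi :
  @twisted_basis F A chi tau b psi -> tau =1 tau' -> twisted_basis chi tau' b psi.
Proof. by move=> tb /funext <-. Qed.

Lemma sk_twisted_basis (F : fieldType) (A : galg F) chi tau b psi : 2%:R != 0 :> F ->
  @twisted_basis F A chi tau b psi -> forall l : grp A, sk l = tau l.
Proof.
move=> two0 tb l; apply/asboolP/idP; first by move/(tb_supp_skew two0 tb).
by move=> tl; apply/(tb_supp_skew two0 tb).
Qed.

(** Padding with zero bits lets the octonion computation cover the second factor [C(k)] for all [k]
    up to 3. *)
Lemma cd_sign_supported k n a b : (k <= n)%N -> (forall j, (k <= j)%N -> a j = false) ->
  (forall j, (k <= j)%N -> b j = false) -> cd_sign k a b = cd_sign n a b.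
Proof.
move=> kn a0 b0; rewrite -(subnK kn); elim: (n - k)%N => //= d ->.
by rewrite a0 ?b0 // leq_addl.
Qed.

Lemma cd_norm_supported k n a : (k <= n)%N -> (forall j, (k <= j)%N -> a j = false) ->
  cd_norm k a = cd_norm n a.
Proof.
move=> kn a0; rewrite -(subnK kn); elim: (n - k)%N => //= d ->.
by rewrite a0 // leq_addl.
Qed.

Definition to_bits3 (a : nat -> bool) : bits3 := (a 0, a 1, a 2).

Lemma oct_signE a b : oct_sign (to_bits3 a) (to_bits3 b) = cd_sign 3 a b.
Proof. by apply: cd_sign_eq => -[|[|[|]]]. Qed.

Lemma oct_normE a : oct_norm (to_bits3 a) = cd_norm 3 a.
Proof. by apply: cd_norm_eq => -[|[|[|]]]. Qed.

Lemma bits_ge n (l : 'rV[int]_n) j : (n <= j)%N -> bits l j = false.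
Proof. by move=> nj; rewrite /bits; case: insubP => // i; rewrite ltnNge nj. Qed.

Lemma cd_bits_ge (F : fieldType) n (l : grp (C F n)) j : (n <= j)%N -> cd_bits l j = false.
Proof. by case: n l => [|n] l; apply: bits_ge. Qed.

Lemma bitsN n (l : 'rV[int]_n) j : bits (- l) j = bits l j.
Proof. by rewrite -(bits_period (- l) l) addNr add0r. Qed.

Section Tori.
Variable F : fieldType.
Hypotheses (two0 : 2%:R != 0 :> F) (three0 : 3%:R != 0 :> F).

Lemma octonion_model_basis k r : exists chi b psi,
  @twisted_basis F (tensor (C F 3) (tensor (C F k) (P F r))) chi
    (fun l => cd_norm 3 (cd_bits l.1) (+) cd_norm k (cd_bits l.2.1)) b psi /\
  ((k <= 3)%N -> forall x y z w q, balanced (identity_signs +%R chi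
    (fun l => cd_norm 3 (cd_bits l.1) (+) cd_norm k (cd_bits l.2.1)) x y z w q)).
Proof.
have [b1 [psi1 tb1]] := CD_basis F 3; have [b2 [psi2 tb2]] := CD_basis F k.
have tb := tensor_basis tb1 (tensor_basis tb2 (laurent_basis F r)).
do 3 eexists; split.
  by apply: (eq_twisted_basis tb) => l /=; rewrite addbF.
move=> k3; apply: (double_octonionic_balanced (p1 := fun l => to_bits3 (cd_bits l.1))
  (p2 := fun l => to_bits3 (cd_bits l.2.1))).
- by move=> l m; congr (_, _, _); apply: cd_bitsD.
- by move=> l m; congr (_, _, _); apply: cd_bitsD.
- move=> l m; rewrite !oct_signE addbF; congr (_ (+) _).
  by apply: cd_sign_supported => // j kj; apply: cd_bits_ge.
move=> l; rewrite !oct_normE; congr (_ (+) _).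
by apply: cd_norm_supported => // j kj; apply: cd_bits_ge.
Qed.

Lemma octonion_model_torus k r : (k <= 3)%N ->
  let T := tensor (C F 3) (tensor (C F k) (P F r)) in structurable_torus T /\ class_I T.
Proof.
move=> k3 T; have [chi [b [psi [tb bal]]]] := octonion_model_basis k r.
split; first exact: (tb_torus tb (tb_structurable tb (bal k3))).
have [b2 [psi2 tb2]] := CD_basis F k.
exact: (@tensor_CD_class_I F two0 2 _ _ _ _ _ (tensor_basis tb2 (laurent_basis F r))).
Qed.

Lemma model_torus k b r : (k = 0%N -> b = BaseC1) ->
  let T := model_a k (base_galg F b) r in structurable_torus T /\ class_I T.
Proof.
move=> k0 T; have [chi [B [psi [tb co]]]] := model_associative_basis F k b r.
split.
  exact: (tb_torus tb (associative_structurable (tb_associative tb co))).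
clear tb co; case: k k0 @T chi B psi => [|k] k0 T _ _ _.
  rewrite /T k0 //; exact: (@tensor_CD_class_I F two0 0 _ _ _ _ _ (laurent_basis F r)).
have [chi' [B' [psi' [tb' _]]]] := model_associative_basis F k b r.
exact: (@tensor_CD_class_I F two0 1 _ _ _ _ _ tb').
Qed.

Lemma isograded_of_ziso (A T : galg F) (g : ziso (grp A) (grp T)) :
  free_abelian_finite_rank (grp A) ->
  structurable_torus A -> class_I A -> structurable_torus T -> class_I T ->
  (forall l, sk l = sk (g l)) -> isograded A T.
Proof.
move=> fA tA cA tT cT skE.
exact: (isograded_of_skew two0 three0 tA cA tT cT (th := ziso_additive g) (zfunK g) (zinvK g)).
Qed.

Lemma free_ziso (L : zmodType) : free_abelian_finite_rank L ->
  exists n, inhabited (ziso 'rV[int]_n L).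
Proof.
move=> [n [f [g fK gK]]]; exists n; constructor.
by apply: (@Ziso _ _ f g) => // x y; apply: raddfD.
Qed.

Lemma associative_torus_classified (A : galg F) :
  free_abelian_finite_rank (grp A) -> structurable_torus A -> class_I A ->
  associative_alg A -> exists T, listed_a T /\ isograded A T.
Proof.
move=> fA tA cA assA; have [n [f]] := free_ziso fA.
have qQ : quadratic (fun x => @sk F A (f x)).
  split=> [x y z|x]; last first.
    by have := sk_add2 two0 three0 tA cA 0 (f x); rewrite add0r zfunD (sk0 two0 tA cA).
  by have := comm_sign_additive two0 three0 tA cA (f x) (f y) (f z) assA; rewrite /comm_sign !zfunD.
have [k [b [r [g gE]]]] := quadratic_classified F qQ.
pose h := ziso_trans (ziso_sym f) g.
have hE l : @sk F A l = model_norm (h l) by rewrite -gE /= zinvK.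
have k0 : k = 0%N -> b = BaseC1.
  move=> k0; case: k k0 b g gE h hE => [|//] _ [] // g gE h hE; exfalso.
    by case: cA => -[l /asboolP sl] _; have := hE l; rewrite [sk l]sl.
  (* For [Cstar2] with [k = 0] both parities of a skew degree are odd, so the skew degrees stay in
     the proper subgroup of equal parities. *)
  pose Q : set (grp A) := [set l | bits ((h l).1 : 'rV[int]_2) 0 = bits ((h l).1 : 'rV[int]_2) 1]%classic.
  have QT l : Q l.
    apply: (generated_skew tA cA); split=> [|m /asboolP sm].
      split=> [|x y]; rewrite /Q /=; first by rewrite zfun0 !bits0.
      by rewrite (zfunB h) !bitsD !bitsN => -> ->.
    have := hE m; rewrite [sk m]sm => /esym/andP[m0 m1].
    by rewrite /Q /= m0 m1.
  have := QT (zinv h (eps 2 0, 0)); rewrite /Q /= zinvK /=.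
  by rewrite !bits_eps.
have [tT cT] := model_torus r k0.
exists (model_a k (base_galg F b) r); split.
  exists k, r, (base_galg F b); split=> //; last by move/k0->.
  by case: b {h g gE hE k0 tT cT} => /=; constructor.
apply: (isograded_of_ziso (g := h) fA tA cA tT cT) => l.
have [chi [B [psi [tb co]]]] := model_associative_basis F k b r.
by rewrite (sk_twisted_basis two0 tb).
Qed.

Lemma nonassociative_torus_classified (A : galg F) :
  free_abelian_finite_rank (grp A) -> structurable_torus A -> class_I A ->
  ~ associative_alg A -> exists T, listed_b T /\ isograded A T.
Proof.
move=> fA tA cA assA; have [n [f]] := free_ziso fA.
have [a [b [c [sa sb sc abc]]]] := octonionic_of_nonassociative two0 three0 tA cA assA.
have Sgen (Q : set (grp A)) : subgroup Q -> (forall l, sk l -> Q l) -> forall l, Q l.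
  move=> sQ Qs l; apply: (generated_skew tA cA); split=> // m sm.
  by apply: Qs; apply/asboolP.
have [k [r [g [k3 gE]]]] := octonionic_classified (sk0 two0 tA cA) (sk_add2 two0 three0 tA cA)
  (@sk_add3 _ _ two0 three0 tA cA) (@no_four_octonionic _ _ two0 three0 tA cA) Sgen sa sb sc abc f.
have [tT cT] := octonion_model_torus r k3.
exists (tensor (C F 3) (tensor (C F k) (P F r))); split; first by exists k, r.
have [h hE] : exists h : ziso (grp A) (grp (tensor (C F 3) (tensor (C F k) (P F r)))),
    forall x, @sk F A x = cd_norm 3 (cd_bits (h x).1) (+) cd_norm k (cd_bits (h x).2.1).
  (* The group of [C F k] reduces to a group of row vectors only once [k] is 0 or a successor. *)
  by case: k k3 g gE {tT cT} => [|k] k3 g gE; exists g.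
have [chi [B [psi [tb _]]]] := octonion_model_basis k r.
apply: (isograded_of_ziso (g := h) fA tA cA tT cT) => l.
by rewrite hE (sk_twisted_basis two0 tb).
Qed.

End Tori.

Theorem theorem5p19 (F : fieldType)
    (char2 : 2%N \notin [pchar F]%R) (char3 : 3%N \notin [pchar F]%R) :
  (forall A : galg F,
     free_abelian_finite_rank (grp A) -> structurable_torus A -> class_I A ->
       (associative_alg A -> exists T : galg F, listed_a T /\ isograded A T) /\
       (~ associative_alg A -> exists T : galg F, listed_b T /\ isograded A T)) /\
  (forall T : galg F, listed_a T \/ listed_b T ->
     structurable_torus T /\ class_I T).
Proof.
have two0 : 2%:R != 0 :> F by move: char2; rewrite inE.
have three0 : 3%:R != 0 :> F by move: char3; rewrite inE.
split=> [A fA tA cA|T].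
  by split; [apply: associative_torus_classified | apply: nonassociative_torus_classified].
case=> [[k [r [B [Bl B0 ->]]]]|[k [r [k3 ->]]]]; last exact: octonion_model_torus.
have [b Bb] : exists b, B = base_galg F b.
  by case: Bl => ->; [exists BaseF | exists BaseC1 | exists BaseCstar2].
case: (posnP k) => [k0|]; last first.
  by rewrite Bb => k0; apply: (model_torus two0) => // k00; rewrite k00 in k0.
by rewrite (B0 k0); apply: (@model_torus F two0 k BaseC1 r).
Qed.
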